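(* Let $H\in(0,1/2)$. There exist positive constants $\bar A_H\le 36$ and $\bar B_H$, depending only on $H$, such that for every $S>0$, every $c\in(0,S^H]$ and every $u>0$, $$\mathbf P\left(\left|\mathrm{TV}^c(W^H,S)-\mathbf E\,\mathrm{TV}^c(W^H,S)\right|>u\right)\le \bar A_H\exp\left(-\bar B_H\,S^{-1}c^{\frac1H-2}u^{1+2H}\min\left(Sc^{1-\frac1H},u\right)^{1-2H}\right),$$ or, equivalently (writing $u=Sc^{1-\frac1H}v$), for every $v>0$, $$\mathbf P\left(\left|\mathrm{TV}^c(W^H,S)-\mathbf E\,\mathrm{TV}^c(W^H,S)\right|>Sc^{1-\frac1H}v\right)\le \bar A_H\exp\left(-\bar B_H\,Sc^{-\frac1H}\min\left(v^{1+2H},v^2\right)\right).$$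
   Context: $W^H=(W^H_t)_{t\ge0}$ is a fractional Brownian motion with Hurst index $H\in(0,1)$, i.e. a centered Gaussian process with (a.s.) continuous trajectories and $\mathbf E(W^H_sW^H_t)=\frac12\{|s|^{2H}+|t|^{2H}-|t-s|^{2H}\}$ for $s,t\ge0$. For a path $f:[0,+\infty)\to\mathbb R$ that is right-continuous with left limits, $c\ge0$ and $0\le s<t$, the truncated variation is $$\mathrm{TV}^c(f,[s,t])=\sup_{n\ge1}\ \sup_{s\le s_1<t_1\le s_2<t_2\le\dots\le s_n<t_n\le t}\ \sum_{i=1}^n\left(|f(t_i)-f(s_i)|-c\right)_+,\qquad (x)_+=\max(x,0),$$ and $\mathrm{TV}^c(f,S):=\mathrm{TV}^c(f,[0,S])$ for $S>0$. *)

(* Defs.v *)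
From mathcomp Require Export all_boot all_order all_algebra.
From mathcomp Require Export all_classical all_reals all_analysis.
Export Order.TTheory GRing.Theory Num.Theory.
Export numFieldNormedType.Exports.

Set Implicit Arguments.
Unset Strict Implicit.
Unset Printing Implicit Defensive.

Local Open Scope classical_set_scope.
Local Open Scope ring_scope.

(* The values of the functional lie in \bar R: the supremum may be infinite
   for c = 0 or for an irregular path. The n.+1 intervals of a partition are
   [l i, r i], i <= n; values of l and r beyond n are irrelevant. *)
Definition truncated_variation (R : realType) (c : R) (f : R -> R) (s t : R) :
    \bar R :=
  ereal_sup [set x : \bar R | exists (n : nat) (l r : nat -> R),
    [/\ s <= l 0%N,
        forall i, (i <= n)%N -> l i < r i,
        forall i, (i < n)%N -> r i <= l i.+1,
        r n <= t &
        x = (\sum_(i < n.+1) Num.max (`|f (r i) - f (l i)| - c) 0)%:E]].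

(* Degenerate (constant) variables count as Gaussian. They are treated apart
   because [normal_prob m 0] is, by convention, the uniform law on [0, 1]. *)
Definition gaussian_variable (d : measure_display) (T : measurableType d)
    (R : realType) (P : probability T R) (X : T -> R) : Prop :=
  exists m sigma : R, forall A : set R, measurable A ->
    P (X @^-1` A) = if sigma == 0 then \d_m A else normal_prob m sigma A.

(* Processes are indexed by [0, +oo[ : nothing is required of X t for t < 0. *)
Definition gaussian_process (d : measure_display) (T : measurableType d)
    (R : realType) (P : probability T R) (X : R -> T -> R) : Prop :=
  (forall t, 0 <= t -> measurable_fun setT (X t)) /\
  forall (n : nat) (t a : 'I_n -> R), (forall i, 0 <= t i) ->
    gaussian_variable P (fun w => \sum_(i < n) a i * X (t i) w).

Record fractional_brownian_motion (d : measure_display) (T : measurableType d)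
    (R : realType) (P : probability T R) (H : R) (W : R -> T -> R) : Prop := {
  fbm_gaussian : gaussian_process P W ;
  fbm_centered : forall t, 0 <= t -> ('E_P[W t] = 0)%E ;
  fbm_covariance : forall s t, 0 <= s -> 0 <= t ->
    ('E_P[fun w => (W s w * W t w)%R] =
     (2^-1 * (`|s| `^ (2 * H) + `|t| `^ (2 * H) - `|t - s| `^ (2 * H)))%:E)%E ;
  fbm_continuous :
    {ae P, forall w, {within `[0, +oo[, continuous (fun t => W t w)}} }.

Section TruncatedVariationOfProcess.
Context (d : measure_display) (T : measurableType d) (R : realType).
Context (P : probability T R) (W : R -> T -> R) (c S : R).

Definition TV (w : T) : \bar R := truncated_variation c (W ^~ w) 0 S.

Definition mean_TV : \bar R := (\int[P]_w TV w)%E.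

(* As trajectories are only almost surely continuous and P need not be
   complete, the deviation event is measurable only up to a P-null set; its
   probability is therefore given by the outer measure of P, which coincides
   with P on measurable sets and with the completion of P on P-completion
   measurable sets. For the same reason [mean_TV] may integrate a function
   that is only a.e. equal to a measurable one, which does not change its
   value (the integrand is nonnegative, and the integral is a supremum over
   simple functions). *)
Definition deviation_probability (x : R) : \bar R :=
  mu_ext P [set w | (x%:E < `|TV w - mean_TV|)%E].

End TruncatedVariationOfProcess.

(* Main.v *)
Require Import Defs.
From mathcomp Require Import measurable_realfun ring lra.

(* On a finite grid the truncated variation is the maximum, over families of
   disjoint intervals with signs, of [sum (+- increment) - c * (number of
   intervals)], a maximum of affine functionals of a Gaussian vector. Such a
   maximum concentrates at the scale of the largest variance (the rotation
   argument of Maurey and Pisier, discretised). As H < 1/2, increments over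
   disjoint intervals are negatively correlated, and the variance of a sum of
   [k * M] signed increments is at most of order [M * c^2 * k^(1 - 2H)], where
   [M] is comparable with [n = S * c^(-1/H)].
   The number of intervals is controlled as follows. If [k * M] intervals do not
   realise the maximum, then the truncated variation at the threshold [c / 2]
   restricted to [k * M] intervals is at least [k * M * c / 2], whereas its mean
   is O(M * c) by chaining over dyadic levels; by concentration this has
   probability at most [exp (- M * k^(1 + 2H) / 512)] for [k] large. A bounded [k]
   gives the Gaussian regime [v^2], and [k] of order [v] the regime [v^(1 + 2H)].
   The bounds do not depend on the mesh, which is then sent to 0. *)

Set Implicit Arguments.
Unset Strict Implicit.
Unset Printing Implicit Defensive.

Local Open Scope classical_set_scope.
Local Open Scope ring_scope.

(** * Real-valued expectation *)

Section RealExpectation.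
Context (d : measure_display) (T : measurableType d) (R : realType).
Context (P : probability T R).
Implicit Types (f g : T -> R) (a b : R).

(** Two obstacles shape the proof. The maximum is not differentiable, so the rotation between two
    independent copies is cut into finitely many steps: over an angle [e] the maximum decreases by
    at most the decrease of the functional that is maximal at the start, whose main part, of size
    [sin e], is driven by a variable independent of which functional that is. The remaining part, of
    size [1 - cos e], is bounded crudely by a union bound and vanishes as the steps are refined, so
    the number of functionals leaves no trace. The independence is derived from moment generating
    functions alone, indicators of half-spaces being limits of functions built from exponentials.
    The second obstacle is that concentration holds around the mean of the gain over [k * M]
    intervals, not around the full mean. The two differ by O(c * sqrt M), by Young's inequality with
    the second moment from the chaining and a failure probability O(1 / M). Deviations of that size
    are covered by the prefactor, [36 * exp (- 1 / 2)] being above 1; larger ones spend at most half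
    of themselves on the difference. *)

Definition integ f := P.-integrable setT (EFin \o f).
Definition Ex f : R := \int[P]_x f x.

Lemma integ_meas f : integ f -> measurable_fun setT f.
Proof. by move=> /measurable_int/measurable_EFinP. Qed.

Lemma EFin_Ex f : integ f -> (Ex f)%:E = (\int[P]_x (f x)%:E)%E.
Proof.
by move=> fi; rewrite /Ex /Rintegral fineK//; exact: integrable_fin_num.
Qed.

Lemma integ_cst a : integ (fun=> a).
Proof. exact: finite_measure_integrable_cst. Qed.

Lemma Ex_cst a : Ex (fun=> a) = a.
Proof.
rewrite /Ex Rintegral_cst// -[RHS]mulr1; congr (_ * _).
exact: (congr1 fine (probability_setT P)).
Qed.

Lemma integD f g : integ f -> integ g -> integ (fun x => f x + g x).
Proof. by move=> fi gi; exact: (integrableD measurableT fi gi). Qed.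

Lemma ExD f g : integ f -> integ g -> Ex (fun x => f x + g x) = Ex f + Ex g.
Proof. exact: RintegralD. Qed.

Lemma integZ a f : integ f -> integ (fun x => a * f x).
Proof. by move=> fi; exact: (integrableZl measurableT a fi). Qed.

Lemma ExZ a f : integ f -> Ex (fun x => a * f x) = a * Ex f.
Proof. exact: RintegralZl. Qed.

Lemma integB f g : integ f -> integ g -> integ (fun x => f x - g x).
Proof. by move=> fi gi; exact: (integrableB measurableT fi gi). Qed.

Lemma ExB f g : integ f -> integ g -> Ex (fun x => f x - g x) = Ex f - Ex g.
Proof. exact: RintegralB. Qed.

Lemma integ_sum (I : Type) (s : seq I) (Q : pred I) (f : I -> T -> R) :
  (forall i, integ (f i)) -> integ (fun x => \sum_(i <- s | Q i) f i x).
Proof.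
move=> fi; rewrite /integ.
rewrite (_ : _ \o _ = (fun x => \sum_(i <- s | Q i) (f i x)%:E)%E); last first.
  by apply/funext => x /=; rewrite sumEFin.
by apply: integrable_sum => // i _; exact: fi.
Qed.

Lemma Ex_sum (I : Type) (s : seq I) (Q : pred I) (f : I -> T -> R) :
  (forall i, integ (f i)) ->
  Ex (fun x => \sum_(i <- s | Q i) f i x) = \sum_(i <- s | Q i) Ex (f i).
Proof.
move=> fi; elim: s => [|i s IH].
  by rewrite big_nil -[RHS](Ex_cst 0); congr Ex; apply/funext => x; rewrite big_nil.
rewrite big_cons -IH; case: ifP => Qi; last first.
  by congr Ex; apply/funext => x; rewrite big_cons Qi.
rewrite -ExD//; last exact: integ_sum.
by congr Ex; apply/funext => x; rewrite big_cons Qi.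
Qed.

Lemma le_integ f g : measurable_fun setT f -> integ g ->
  (forall x, `|f x| <= g x) -> integ f.
Proof.
move=> mf gi fg; apply: le_integrable gi => //; first exact/measurable_EFinP.
by move=> x _ /=; rewrite lee_fin (le_trans (fg x))// ler_norm.
Qed.

Lemma integ_norm f : integ f -> integ (fun x => `|f x|).
Proof. exact: integrable_norm. Qed.

Lemma le_Ex f g : integ f -> integ g -> (forall x, f x <= g x) -> Ex f <= Ex g.
Proof. by move=> fi gi fg; apply: le_Rintegral. Qed.

Lemma Ex_ge0 f : (forall x, 0 <= f x) -> 0 <= Ex f.
Proof. by move=> f0; apply: Rintegral_ge0. Qed.

Lemma integ_ge0E f r : measurable_fun setT f -> (forall x, 0 <= f x) ->
  (\int[P]_x (f x)%:E = r%:E)%E -> integ f /\ Ex f = r.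
Proof.
move=> mf f0 fr; split; last by rewrite /Ex /Rintegral fr.
apply/integrableP; split; first exact/measurable_EFinP.
under eq_integral do rewrite /= ger0_norm//.
by rewrite fr ltry.
Qed.

Lemma Ex_dct (f_ : nat -> T -> R) f g :
  (forall n, measurable_fun setT (f_ n)) ->
  (forall x, f_ n x @[n --> \oo] --> f x) -> integ g ->
  (forall n x, `|f_ n x| <= g x) ->
  [/\ forall n, integ (f_ n), integ f & Ex (f_ n) @[n --> \oo] --> Ex f].
Proof.
move=> mf cf gi fg.
have mlim : measurable_fun setT f.
  by apply: (measurable_fun_cvg mf) => x _; exact: cf.
have if_ n : integ (f_ n) by exact: (le_integ (mf n) gi (fg n)).
have [||//||] := @dominated_convergence _ T R P setT measurableT
    (fun n => EFin \o f_ n) (EFin \o f) (EFin \o g) _ _ _ gi _.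
- by move=> n; exact/measurable_EFinP.
- exact/measurable_EFinP.
- by apply/aeW => x _; apply: cvg_EFin; [exact: nearW|exact: cf].
- by apply/aeW => x n _ /=; rewrite lee_fin.
move=> fi _ cE; split => //.
apply: fine_cvg; rewrite -/(Ex _) EFin_Ex//.
Qed.

Lemma measurable_le_set f g : measurable_fun setT f -> measurable_fun setT g ->
  measurable [set x | f x <= g x].
Proof.
by move=> mf mg; rewrite -[X in measurable X]setTI; exact: measurable_fun_le.
Qed.

Lemma measurable_lt_set f g : measurable_fun setT f -> measurable_fun setT g ->
  measurable [set x | f x < g x].
Proof.
move=> mf mg; rewrite (_ : [set x | _] = ~` [set x | g x <= f x]).
  by apply: measurableC; exact: measurable_le_set.
by apply/seteqP; split => x /=; rewrite ltNge => /negP.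
Qed.

Lemma integ_indic (A : set T) : measurable A -> integ (\1_A).
Proof. by move=> mA; apply: integrable_indic. Qed.

Lemma Ex_indic (A : set T) : measurable A -> (Ex (\1_A))%:E = P A.
Proof.
by move=> mA; rewrite EFin_Ex ?integral_indic ?setIT//; exact: integ_indic.
Qed.

Lemma Ex_markov f a : integ f -> (forall x, 0 <= f x) -> 0 < a ->
  (P [set x | (a <= f x)%R] <= (Ex f / a)%:E)%E.
Proof.
move=> fi f0 a0; have mA : measurable [set x | a <= f x].
  by apply: measurable_le_set => //; exact: integ_meas.
rewrite -Ex_indic// lee_fin mulrC -ExZ//.
apply: le_Ex; [exact: integ_indic|exact: integZ|move=> x].
rewrite indicE; case: (boolP (x \in _)) => [|_]; last first.
  by rewrite mulr_ge0// invr_ge0 ltW.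
by rewrite inE/= => ax; rewrite mulrC ler_pdivlMr ?mul1r.
Qed.

End RealExpectation.

(** * Gaussian spaces *)

Section ExpInequalities.
Context (R : realType).
Implicit Types x y : R.

Lemma norm_le_expR x : `|x| <= expR `|x|.
Proof. by have := expR_ge1Dx `|x|; lra. Qed.

Lemma expR_norm_le x : expR `|x| <= expR x + expR (- x).
Proof.
by case: (ger0P x) => _; [rewrite lerDl|rewrite lerDr]; exact: expR_ge0.
Qed.

Lemma norm_expR_sub1_le x : `|expR x - 1| <= `|x| * expR `|x|.
Proof.
have h1 := expR_ge1Dx x; have h2 := expR_ge1Dx (- x).
have e0 := expR_gt0 x; have e1 : expR x * expR (- x) = 1 by rewrite expRxMexpNx_1.
have [x0|x0] := ger0P x.
  by rewrite ger0_norm; nra.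
have : expR x < 1 by rewrite expR_lt1.
have : 1 <= expR (- x) by rewrite -expR0 ler_expR; lra.
by move=> ? ?; rewrite ltr0_norm; nra.
Qed.

Lemma expR_taylor1_le x : `|expR x - 1 - x| <= x ^+ 2 * expR `|x|.
Proof.
have h1 := expR_ge1Dx x; rewrite ger0_norm; last lra.
have := norm_expR_sub1_le x; have e0 := expR_gt0 `|x|.
have h2 := expR_ge1Dx (- x).
have e1 : expR x * expR (- x) = 1 by rewrite expRxMexpNx_1.
have [x0|x0] := ger0P x.
  rewrite ger0_norm; last lra.
  by move: (expR_gt0 x); nra.
have : expR x < 1 by rewrite expR_lt1.
have : 1 <= expR (- x) by rewrite -expR0 ler_expR; lra.
by move: (expR_gt0 x) => ? ? ?; rewrite ltr0_norm; nra.
Qed.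

End ExpInequalities.

(** * Densities and Gaussian exponential moments *)

Section GaussianMoments.
Context (R : realType).
Local Notation mu := (@lebesgue_measure R).

Import HBNNSimple.

(** True for indicators by hypothesis, hence for simple functions, hence in general by monotone
    convergence. The sign of [r] is discussed because the level sets of negative values are
    empty. *)
Lemma ge0_integral_density (nu : {measure set (measurableTypeR R) -> \bar R})
  (g : R -> R) (f : measurableTypeR R -> \bar R) : measurable_fun setT g -> (forall x, 0 <= g x) ->
  (forall A, measurable A -> nu A = (\int[mu]_(x in A) (g x)%:E)%E) ->
  measurable_fun setT f -> (forall x, 0 <= f x)%E ->
  (\int[nu]_x f x = \int[mu]_x (f x * (g x)%:E))%E.
Proof.
move=> mg g0 nug mf f0.
pose f_ := nnsfun_approx measurableT mf.
have mf_ n : measurable_fun setT (fun x => (f_ n x)%:E).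
  exact/measurable_EFinP.
have nnsE (h : {nnsfun measurableTypeR R >-> R}) :
    (\int[nu]_x (h x)%:E = \int[mu]_x ((h x)%:E * (g x)%:E))%E.
  under eq_integral do rewrite fimfunE -fsumEFin//.
  rewrite ge0_integral_fsum//; last 2 first.
  - by move=> r; exact/measurable_EFinP/measurableT_comp.
  - by move=> n x _; rewrite EFinM nnfun_muleindic_ge0.
  under [RHS]eq_integral => x _.
    rewrite fimfunE -fsumEFin// ge0_mule_fsuml; last first.
      by move=> r; rewrite EFinM nnfun_muleindic_ge0.
    over.
  rewrite ge0_integral_fsum//; last 2 first.
  - move=> r; apply: emeasurable_funM; last exact/measurable_EFinP.
    by apply/measurable_EFinP/measurable_funM => //; exact: measurable_indic.
  - move=> n x _; rewrite mule_ge0 ?lee_fin//.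
    by rewrite -lee_fin EFinM nnfun_muleindic_ge0.
  apply: eq_fsbigr => r _; rewrite integralZl_indic_nnsfun// integral_indic// setIT.
  have [->|r0] := eqVneq r 0.
    by rewrite mul0e; under eq_integral do rewrite mul0r mul0e; rewrite integral0.
  have [r1|r1] := ltP r 0.
    rewrite preimage_nnfun0// measure0 mule0.
    by under eq_integral do rewrite indic0 mulr0 mul0e; rewrite integral0.
  under eq_integral do rewrite EFinM -muleA.
  rewrite ge0_integralZl//; last 2 first.
  - by apply: emeasurable_funM; apply/measurable_EFinP => //; exact: measurable_indic.
  - by move=> x _; rewrite mule_ge0 ?lee_fin.
  rewrite nug//; congr (_ * _)%E; rewrite [LHS]integral_mkcond.
  apply: eq_integral => x _; rewrite patchE indicE.
  by case: ifP => _; rewrite ?mul1e ?mul0e.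
transitivity (lim (\int[nu]_x (f_ n x)%:E @[n --> \oo])%E).
  rewrite -monotone_convergence//=.
  - by apply: eq_integral => x _; apply/esym/cvg_lim => //; exact: cvg_nnsfun_approx.
  - by move=> n x _; rewrite lee_fin.
  - by move=> x _ a b ab; rewrite lee_fin; exact/lefP/nd_nnsfun_approx.
under eq_fun do rewrite nnsE.
rewrite -monotone_convergence//=.
- apply: eq_integral => x _; apply/cvg_lim => //.
  apply: cvgeZr => //; exact: cvg_nnsfun_approx.
- by move=> n; apply: emeasurable_funM => //; exact/measurable_EFinP.
- by move=> n x _; rewrite mule_ge0 ?lee_fin.
- move=> x _ a b ab; rewrite lee_wpmul2r ?lee_fin//.
  exact/lefP/nd_nnsfun_approx.
Qed.

End GaussianMoments.

Section GaussianMgf.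
Context (d : measure_display) (T : measurableType d) (R : realType).
Context (P : probability T R).
Local Notation mu := (@lebesgue_measure R).

Lemma ge0_integral_law (X : T -> measurableTypeR R)
    (nu : {measure set (measurableTypeR R) -> \bar R}) (f : R -> \bar R) :
  measurable_fun setT X -> (forall A : set R, measurable A -> P (X @^-1` A) = nu A) ->
  measurable_fun setT f -> (forall x, 0 <= f x)%E ->
  (\int[P]_w f (X w) = \int[nu]_x f x)%E.
Proof.
move=> mX lawX mf f0.
have := @ge0_integral_pushforward _ _ T (measurableTypeR R) R X mX P setT f measurableT mf (fun y _ => f0 y).
rewrite preimage_setT => <-.
by apply: eq_measure_integral => A mA _; rewrite -lawX.
Qed.

(** Completing the square: the tilt shifts the mean, and the constant in front is the moment
    generating function, since the shifted density has mass one. *)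
Lemma normal_pdf_tilt (m s t x : R) : s != 0 ->
  expR (t * x) * normal_pdf m s x =
  expR (t * m + t ^+ 2 * s ^+ 2 / 2) * normal_pdf (m + t * s ^+ 2) s x.
Proof.
move=> s0; rewrite !normal_pdfE// mulrCA [RHS]mulrCA; congr (_ * _).
rewrite /normal_fun -!expRD; congr expR.
by rewrite -mulr_natr; field.
Qed.

(** The parameters are only asserted to exist; their meaning as moments is recovered below by
    differentiating this formula at 0. *)
Lemma gaussian_mgf (X : T -> R) :
  measurable_fun setT X -> gaussian_variable P X ->
  exists m v : R, 0 <= v /\ forall t, integ P (fun w => expR (t * X w)) /\
    Ex P (fun w => expR (t * X w)) = expR (t * m + t ^+ 2 * v / 2).
Proof.
move=> mX [m [s lawX]]; exists m, (s ^+ 2); split; first exact: sqr_ge0.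
move=> t; apply: integ_ge0E => //.
  by apply: measurableT_comp => //; exact: measurable_funM.
have mf : measurable_fun setT (fun x : R => (expR (t * x))%:E).
  by apply/measurable_EFinP/measurableT_comp => //; exact: measurable_funM.
have f0 (x : R) : (0 <= (expR (t * x))%:E)%E by rewrite lee_fin expR_ge0.
have [s0|s0] := eqVneq s 0.
  rewrite (@ge0_integral_law X (\d_(m : measurableTypeR R)) (fun x => (expR (t * x))%:E))//.
    rewrite integral_dirac// diracT mul1e s0 expr0n/= mulr0 mul0r addr0//.
  by move=> A /lawX; rewrite s0 eqxx.
rewrite (@ge0_integral_law X (normal_prob m s) (fun x => (expR (t * x))%:E))//; last first.
  by move=> A /lawX; rewrite (negbTE s0).
rewrite (@ge0_integral_density _ _ (normal_pdf m s))//; last 2 first.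
- exact: measurable_normal_pdf.
- by move=> x; exact: normal_pdf_ge0.
under eq_integral do rewrite -EFinM normal_pdf_tilt// EFinM.
rewrite ge0_integralZl//; last 2 first.
- apply/measurable_EFinP; exact: measurable_normal_pdf.
- by move=> x _; rewrite lee_fin normal_pdf_ge0.
by rewrite integral_normal_pdf mule1.
Qed.

End GaussianMgf.

(** * Moments from the moment generating function *)

Section ExpQuotient.
Context (R : realType).

(** The derivative at 0 of [r -> exp (r * x + r^2 * b)]. It is used with [b = 0] at each outcome,
    and with [b = v / 2] for the moment generating function itself. *)
Lemma cvg_expR_quotient (r : nat -> R) (x b : R) :
  (forall n, 0 < r n <= 1) -> r n @[n --> \oo] --> 0 ->
  (r n)^-1 * (expR (r n * x + r n ^+ 2 * b) - 1) @[n --> \oo] --> x.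
Proof.
move=> r01 r0; set C := `|b| + (`|x| + `|b|) ^+ 2 * expR (`|x| + `|b|).
suff bnd n : `|(r n)^-1 * (expR (r n * x + r n ^+ 2 * b) - 1) - x| <= C * r n.
  apply/cvgrPdist_le => e e0; have CrC : C * r n @[n --> \oo] --> C * 0.
    by apply: cvgM => //; exact: cvg_cst.
  rewrite mulr0 in CrC; move/cvgrPdist_le : CrC => /(_ e e0).
  apply: filterS => n; rewrite sub0r normrN => Crn.
  by rewrite distrC (le_trans (bnd n))// (le_trans (ler_norm _)).
have /andP[rn0 rn1] := r01 n; set y := r n * x + _.
have yle : `|y| <= r n * (`|x| + `|b|).
  rewrite (le_trans (ler_normD _ _))// normrM [X in _ + X]normrM normrX.
  rewrite (gtr0_norm rn0) mulrDr.
  by rewrite lerD2l ler_wpM2r// expr2 ler_piMr// ltW.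
have yle1 : `|y| <= `|x| + `|b|.
  by rewrite (le_trans yle)// ler_piMl// addr_ge0.
have -> : (r n)^-1 * (expR y - 1) - x = (r n)^-1 * (expR y - 1 - y) + r n * b.
  by rewrite /y; field; rewrite gt_eqF.
rewrite (le_trans (ler_normD _ _))// normrM [X in _ + X]normrM gtr0_norm ?invr_gt0// (gtr0_norm rn0).
rewrite /C mulrDl [leRHS]addrC mulrC; apply: lerD; last by rewrite mulrC.
rewrite ler_pdivrMr// (le_trans (expR_taylor1_le y))//.
have -> : (`|x| + `|b|) ^+ 2 * expR (`|x| + `|b|) * r n * r n =
    (r n * (`|x| + `|b|)) ^+ 2 * expR (`|x| + `|b|) by ring.
apply: ler_pM; rewrite ?sqr_ge0 ?expR_ge0 ?ler_expR//.
by rewrite -[leLHS]real_normK ?num_real// lerXn2r// nnegrE mulr_ge0// ltW.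
Qed.

End ExpQuotient.

Section Moments.
Context (d : measure_display) (T : measurableType d) (R : realType).
Context (P : probability T R).
Implicit Types X : T -> R.

Lemma expR_norm_le2 (t x : R) : expR (t * `|x|) <= expR (t * x) + expR (- t * x).
Proof.
case: (ger0P x) => _; rewrite ?mulrN -?mulNr; first by rewrite lerDl expR_ge0.
by rewrite lerDr expR_ge0.
Qed.

Lemma integ_expR_norm X : measurable_fun setT X ->
  (forall t, integ P (fun w => expR (t * X w))) ->
  forall t, integ P (fun w => expR (t * `|X w|)).
Proof.
move=> mX iX t.
apply: (@le_integ _ _ _ _ _ (fun w => expR (t * X w) + expR (- t * X w))).
- apply: measurableT_comp => //; apply: measurable_funM => //.
  exact: measurableT_comp.
- exact: integD.
- by move=> w; rewrite ger0_norm ?expR_ge0// expR_norm_le2.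
Qed.

Lemma cvg_Ex_quotient X (r : nat -> R) : measurable_fun setT X ->
  (forall t, integ P (fun w => expR (t * X w))) ->
  (forall n, 0 < r n <= 1) -> r n @[n --> \oo] --> 0 ->
  integ P X /\
  Ex P (fun w => (r n)^-1 * (expR (r n * X w) - 1)) @[n --> \oo] --> Ex P X.
Proof.
move=> mX iX r01 r0.
have [n|w||n w|_ iX1 cX] := @Ex_dct _ _ _ P
    (fun n w => (r n)^-1 * (expR (r n * X w) - 1)) X (fun w => expR (2 * `|X w|)).
- apply: measurable_funM => //; apply: measurable_funB => //.
  by apply: measurableT_comp => //; exact: measurable_funM.
- have := @cvg_expR_quotient R _ (X w) 0 r01 r0.
  by under eq_fun do rewrite mulr0 addr0.
- exact: integ_expR_norm.
- have /andP[rn0 rn1] := r01 n.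
  rewrite normrM gtr0_norm ?invr_gt0// ler_pdivrMl//.
  rewrite (le_trans (norm_expR_sub1_le _))// normrM gtr0_norm// -mulrA.
  rewrite ler_pM2l// mulrDl mul1r expRD ler_pM ?norm_le_expR// ler_expR.
  by rewrite ler_piMl.
by split.
Qed.

(** The difference quotients along [1 / (n + 1)] have expectations that converge to [Ex P X] by
    dominated convergence and to [m] by the explicit formula. *)
Lemma mgf_mean X (m v : R) : measurable_fun setT X ->
  (forall t, integ P (fun w => expR (t * X w)) /\
    Ex P (fun w => expR (t * X w)) = expR (t * m + t ^+ 2 * v / 2)) ->
  integ P X /\ Ex P X = m.
Proof.
move=> mX mgfX; have iX t := (mgfX t).1.
have r01 n : 0 < @harmonic R n <= 1.
  by rewrite /harmonic/= invr_gt0 ltr0n invf_le1 ?ltr0n// ler1n.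
have [iX1 cX] := cvg_Ex_quotient mX iX r01 (@cvg_harmonic R).
split => //.
have cm := @cvg_expR_quotient R _ m (v / 2) r01 (@cvg_harmonic R).
have qE (n : nat) : Ex P (fun w => (harmonic n)^-1 * (expR (harmonic n * X w) - 1)) =
    (harmonic n)^-1 * (expR (harmonic n * m + harmonic n ^+ 2 * (v / 2)) - 1).
  rewrite ExZ; last by apply: integB; [exact: iX|exact: integ_cst].
  rewrite ExB; [|exact: iX|exact: integ_cst].
  by rewrite Ex_cst (mgfX _).2 mulrA.
by move: cX; under eq_fun do rewrite qE; move=> cX; exact: (cvg_unique _ cX cm).
Qed.

Lemma integ_sqr_mgf X : measurable_fun setT X ->
  (forall t, integ P (fun w => expR (t * X w))) -> integ P (fun w => X w ^+ 2).
Proof.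
move=> mX iX; apply: (@le_integ _ _ _ _ _ (fun w => expR (2 * `|X w|))).
- exact: measurable_funX.
- exact: integ_expR_norm.
- move=> w; rewrite normrX mulrDl mul1r expRD -expr2.
  by rewrite lerXn2r ?nnegrE ?expR_ge0// norm_le_expR.
Qed.

Lemma mgf_variance X (v : R) : measurable_fun setT X ->
  (forall t, integ P (fun w => expR (t * X w)) /\
    Ex P (fun w => expR (t * X w)) = expR (t ^+ 2 * v / 2)) ->
  Ex P (fun w => X w ^+ 2) = v.
Proof.
move=> mX mgfX; have iX t := (mgfX t).1.
pose r n := @harmonic R n.
have r01 n : 0 < r n <= 1.
  by rewrite /r /harmonic/= invr_gt0 ltr0n invf_le1 ?ltr0n// ler1n.
have r0 : r n @[n --> \oo] --> 0 by exact: cvg_harmonic.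
have r201 n : 0 < r n ^+ 2 <= 1.
  by have /andP[? ?] := r01 n; rewrite exprn_gt0//= exprn_ile1// ltW.
have r20 : r n ^+ 2 @[n --> \oo] --> 0.
  by rewrite -(mulr0 0); under eq_fun do rewrite expr2; exact: cvgM.
(* A symmetric difference quotient: [q n] tends to [X], and its square is a second difference of
   [exp (t * X)] at [t = 0], whose expectation is known. That expectation is twice a first-order
   quotient with step [r n ^+ 2], hence the limit [v / 2 + v / 2]. *)
pose q n w := (r n)^-1 * (expR (r n * (X w / 2)) - 1) -
  (r n)^-1 * (expR (r n * (- X w / 2)) - 1).
have qE n w : q n w ^+ 2 =
    (r n ^+ 2)^-1 * (expR (r n * X w) + expR (- r n * X w) - 2).
  have -> : q n w = (r n)^-1 * (expR (r n * (X w / 2)) - expR (r n * (- X w / 2))).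
    by rewrite /q; ring.
  rewrite exprMn exprVn; congr (_ * _).
  rewrite sqrrB -!expRM_natl -expRD.
  have -> : r n * (X w / 2) + r n * (- X w / 2) = 0 by field.
  rewrite expR0; have -> : 2 * (r n * (X w / 2)) = r n * X w by field.
  have -> : 2 * (r n * (- X w / 2)) = - r n * X w by field.
  by ring.
have mq n : measurable_fun setT (q n).
  apply: measurable_funB; apply: measurable_funM => //; apply: measurable_funB => //;
  apply: measurableT_comp => //; apply: measurable_funM => //;
  apply: measurable_funM => //; exact: measurableT_comp.
have [n|w||n w|_ _ cX] := @Ex_dct _ _ _ P (fun n w => q n w ^+ 2)
    (fun w => X w ^+ 2) (fun w => expR (4 * `|X w|)).
- exact: measurable_funX.
- have c1 : (r n)^-1 * (expR (r n * (X w / 2)) - 1) @[n --> \oo] --> X w / 2.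
    have := @cvg_expR_quotient R _ (X w / 2) 0 r01 r0.
    by under eq_fun do rewrite mulr0 addr0.
  have c2 : (r n)^-1 * (expR (r n * (- X w / 2)) - 1) @[n --> \oo] --> - X w / 2.
    have := @cvg_expR_quotient R _ (- X w / 2) 0 r01 r0.
    by under eq_fun do rewrite mulr0 addr0.
  have cq : q n w @[n --> \oo] --> X w.
    rewrite [X in _ --> X](_ : X w = X w / 2 - - X w / 2); last by field.
    exact: cvgB.
  by under eq_fun do rewrite expr2; rewrite expr2; exact: cvgM.
- exact: integ_expR_norm.
- have /andP[rn0 rn1] := r01 n.
  have half (y : R) : `|(r n)^-1 * (expR (r n * y) - 1)| <= `|y| * expR `|y|.
    rewrite normrM gtr0_norm ?invr_gt0// ler_pdivrMl//.
    rewrite (le_trans (norm_expR_sub1_le _))// normrM gtr0_norm// -mulrA.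
    by rewrite ler_pM2l// ler_wpM2l// ler_expR ler_piMl.
  have qle : `|q n w| <= expR (2 * `|X w|).
    rewrite (le_trans (ler_normB _ _))//.
    rewrite (le_trans (lerD (half _) (half _)))//.
    rewrite mulNr normrN normrM [`|2^-1|]gtr0_norm//.
    have -> (a : R) : a / 2 * expR (a / 2) + a / 2 * expR (a / 2) = a * expR (a / 2).
      by field.
    rewrite mulrDl mul1r expRD ler_pM ?expR_ge0 ?norm_le_expR// ler_expR.
    by rewrite ler_piMr// invf_le1// ler1n.
  rewrite normrX (_ : 4 * `|X w| = 2 * `|X w| + 2 * `|X w|); last by ring.
  by rewrite expRD -expr2 lerXn2r// nnegrE expR_ge0.
have cv := @cvg_expR_quotient R _ (v / 2) 0 r201 r20.
have EqE (n : nat) : Ex P (fun w => q n w ^+ 2) = (r n ^+ 2)^-1 *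
  (expR (r n ^+ 2 * (v / 2) + (r n ^+ 2) ^+ 2 * 0) - 1) + (r n ^+ 2)^-1 *
  (expR (r n ^+ 2 * (v / 2) + (r n ^+ 2) ^+ 2 * 0) - 1).
  under [X in Ex P X]eq_fun do rewrite qE.
  have i1 : integ P (fun w => expR (r n * X w) + expR (- r n * X w)) by exact: integD.
  rewrite ExZ; last by apply: integB => //; exact: integ_cst.
  rewrite ExB//; last exact: integ_cst.
  rewrite ExD// !(mgfX _).2 Ex_cst mulr0 addr0 sqrrN.
  by rewrite mulrA; ring.
rewrite [RHS](_ : v = v / 2 + v / 2); last by field.
move: cX; under eq_fun do rewrite EqE; move=> cX.
exact: (cvg_unique _ cX (cvgD cv cv)).
Qed.

End Moments.

(** * Linear spaces of centred Gaussian variables *)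

Section GaussianSpace.
Context (d : measure_display) (T : measurableType d) (R : realType).
Context (P : probability T R).
Implicit Types (V : set (T -> R)) (f g : T -> R).

(** Centred Gaussian variables described by their exponential moments alone: by linearity [gs_mgf]
    fixes all joint moment generating functions, and no later step refers to a law. *)
Record gaussian_space V : Prop := {
  gs_lin : forall a b f g, V f -> V g -> V (fun w => a * f w + b * g w) ;
  gs_meas : forall f, V f -> measurable_fun setT f ;
  gs_sqr : forall f, V f -> integ P (fun w => f w ^+ 2) ;
  gs_exp : forall f, V f -> integ P (fun w => expR (f w)) ;
  gs_mgf : forall f, V f ->
    Ex P (fun w => expR (f w)) = expR (Ex P (fun w => f w ^+ 2) / 2) }.

Definition process_span (W : R -> T -> R) : set (T -> R) :=
  [set f | exists n (t a : 'I_n -> R), (forall i, 0 <= t i) /\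
     f = fun w => \sum_(i < n) a i * W (t i) w].

Lemma process_span1 (W : R -> T -> R) t : 0 <= t -> process_span W (W t).
Proof.
move=> t0; exists 1%N, (fun=> t), (fun=> 1); split => //.
by apply/funext => w; rewrite big_ord1 mul1r.
Qed.

Lemma process_span_lin (W : R -> T -> R) a b f g : process_span W f ->
  process_span W g -> process_span W (fun w => a * f w + b * g w).
Proof.
move=> [n [t [x [t0 ->]]]] [m [s [y [s0 ->]]]].
exists (n + m)%N, (fun i : 'I_(n + m) => match fintype.split i with inl j => t j | inr j => s j end),
  (fun i : 'I_(n + m) => match fintype.split i with inl j => a * x j | inr j => b * y j end).
split; first by move=> i; case: (fintype.split i).
apply/funext => w; rewrite big_split_ord/= !mulr_sumr.
congr (_ + _); apply: eq_bigr => i _.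
  by rewrite (unsplitK (inl i)) mulrA.
by rewrite (unsplitK (inr i)) mulrA.
Qed.

Lemma gaussian_process_space (W : R -> T -> R) : gaussian_process P W ->
  (forall t, 0 <= t -> ('E_P[W t] = 0)%E) -> gaussian_space (process_span W).
Proof.
move=> [mW gW] EW.
have measV f : process_span W f -> measurable_fun setT f.
  move=> [n [t [a [t0 ->]]]]; apply: measurable_sum => i.
  by apply: measurable_funM => //; exact: mW.
have mgfV f : process_span W f -> exists m v : R, 0 <= v /\
    forall s, integ P (fun w => expR (s * f w)) /\
    Ex P (fun w => expR (s * f w)) = expR (s * m + s ^+ 2 * v / 2).
  move=> Vf; apply: gaussian_mgf; first exact: measV.
  by case: Vf => n [t [a [t0 ->]]]; exact: gW.
have intV f : process_span W f -> integ P f.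
  move=> Vf; have [m [v [_ h]]] := mgfV _ Vf.
  by have [] := mgf_mean (measV _ Vf) h.
have Ex0 f : process_span W f -> Ex P f = 0.
  move=> [n [t [a [t0 ->]]]]; rewrite Ex_sum.
    rewrite big1// => i _; rewrite ExZ; last exact/intV/process_span1.
    have := EW _ (t0 i); rewrite unlock -EFin_Ex; last exact/intV/process_span1.
    by move=> [->]; rewrite mulr0.
  by move=> i; apply: integZ; exact/intV/process_span1.
have mgf0 f : process_span W f -> forall s, integ P (fun w => expR (s * f w)) /\
    Ex P (fun w => expR (s * f w)) = expR (s ^+ 2 * Ex P (fun w => f w ^+ 2) / 2).
  move=> Vf; have [m [v [_ h]]] := mgfV _ Vf.
  have [_] := mgf_mean (measV _ Vf) h; rewrite (Ex0 _ Vf) => m0.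
  have h' s : integ P (fun w => expR (s * f w)) /\
      Ex P (fun w => expR (s * f w)) = expR (s ^+ 2 * v / 2).
    by have [? ->] := h s; rewrite -m0 mulr0 add0r.
  by rewrite (mgf_variance (measV _ Vf) h').
split => //.
- by move=> a b f g; exact: process_span_lin.
- by move=> f Vf; apply: integ_sqr_mgf => [|s]; [exact: measV|exact: (mgf0 _ Vf s).1].
- by move=> f Vf; have [+ _] := mgf0 _ Vf 1; under eq_fun do rewrite mul1r.
- by move=> f Vf; have [_] := mgf0 _ Vf 1; under eq_fun do rewrite mul1r; rewrite expr1n mul1r.
Qed.

End GaussianSpace.

(** * Independence through exponential moments *)

Section StepApproximation.
Context (R : realType).
Implicit Types u r x : R.

(** [1 - r ^+ n] is [1 - r] times a sum of [n] powers of [r], each at least [r ^+ n]. *)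
Lemma mulrn_exprn_le r (n : nat) : 0 <= r < 1 -> n%:R * r ^+ n <= (1 - r)^-1.
Proof.
move=> /andP[r0 r1]; have r10 : 0 < 1 - r by lra.
rewrite -[leRHS]mul1r ler_pdivlMr// (@le_trans _ _ (1 - r ^+ n))//; last first.
  by rewrite lerBlDr lerDl exprn_ge0.
elim: n => [|n IH]; first by rewrite !mul0r expr0 subrr.
have rn : 0 <= r ^+ n by exact: exprn_ge0.
have nn : 0 <= (n%:R : R) by exact: ler0n.
have rn1 : r ^+ n <= 1 by rewrite exprn_ile1// ltW.
rewrite -natr1 exprS; move: IH; set p := r ^+ n in rn rn1 *; set m := n%:R in nn *.
move=> IH; have h1 : r * (m * p * (1 - r)) <= r * (1 - p) by rewrite ler_wpM2l.
have h2 : 0 <= (1 - r) * (1 - r * p) by rewrite mulr_ge0; nra.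
by nra.
Qed.

Lemma cvg_mulrn_exprn r : 0 <= r < 1 -> n%:R * r ^+ n @[n --> \oo] --> 0.
Proof.
move=> /andP[r0 r1]; pose s := Num.sqrt r.
have s0 : 0 <= s by exact: sqrtr_ge0.
have s1 : s < 1 by rewrite -sqrtr1 ltr_sqrt.
have cs : geometric (1 - s)^-1 s n @[n --> \oo] --> 0.
  by apply: cvg_geometric; rewrite ger0_norm.
apply: (squeeze_cvgr _ (cvg_cst 0) cs); apply: nearW => n.
rewrite mulr_ge0 ?exprn_ge0 ?ler0n//=.
rewrite -(sqr_sqrtr r0) -/s expr2 exprMn mulrA ler_wpM2r ?exprn_ge0//.
by apply: mulrn_exprn_le; rewrite s0.
Qed.

Lemma bernoulli_ineq x (n : nat) : 0 <= x <= 1 -> 1 - n%:R * x <= (1 - x) ^+ n.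
Proof.
move=> /andP[x0 x1]; elim: n => [|n IH]; first by rewrite mul0r subr0.
have xn : 0 <= (1 - x) ^+ n by rewrite exprn_ge0// subr_ge0.
have nn : 0 <= (n%:R : R) by exact: ler0n.
rewrite -natr1 exprS; move: IH; set p := (1 - x) ^+ n in xn *; set m := n%:R in nn *.
by nra.
Qed.

(** Polynomials in [u] that tend to the indicator of [u < 1/2] at every point of [0, 1]. As
    [n * 2 ^ n * u ^ n = n * (2 * u) ^ n], Bernoulli's inequality gives the limit 1 below 1/2, and
    [1 - x <= exp (- x)] the limit 0 from 1/2 on. The factor [n] in the exponent settles the point
    1/2 itself. *)
Lemma cvg_step u : 0 <= u <= 1 ->
  (1 - u ^+ n) ^+ (n * 2 ^ n) @[n --> \oo] --> ((u < 2^-1)%R%:R : R).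
Proof.
move=> /andP[u0 u1].
have un n : 0 <= u ^+ n <= 1 by rewrite exprn_ge0//= exprn_ile1.
have NE n : (n * 2 ^ n)%:R * u ^+ n = n%:R * (2 * u) ^+ n.
  by rewrite natrM natrX exprMn mulrA.
have [uh|uh] := ltP u 2^-1.
  have r01 : 0 <= 2 * u < 1 by lra.
  have c1 : 1 - n%:R * (2 * u) ^+ n @[n --> \oo] --> (1 : R).
    by rewrite -[X in _ --> X]subr0; apply: cvgB; [exact: cvg_cst|exact: cvg_mulrn_exprn].
  rewrite [X in _ --> X](_ : _ = 1)//.
  apply: (squeeze_cvgr _ c1 (cvg_cst (1 : R))); apply: nearW => n.
  rewrite -NE bernoulli_ineq//=; have /andP[? ?] := un n.
  by rewrite exprn_ile1 ?subr_ge0// gerBl.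
rewrite [X in _ --> X](_ : _ = 0)//.
apply: (squeeze_cvgr _ (cvg_cst 0) (@cvg_harmonic R)); apply: nearW => n.
have /andP[un0 un1] := un n; rewrite exprn_ge0 ?subr_ge0//=.
have le1 : (1 - u ^+ n) ^+ (n * 2 ^ n) <= expR (- n%:R).
  rewrite (@le_trans _ _ (expR (- (u ^+ n)) ^+ (n * 2 ^ n)))//.
    by rewrite lerXn2r ?nnegrE ?subr_ge0 ?expR_ge0// expR_ge1Dx.
  rewrite -expRM_natl ler_expR mulrN lerN2 NE.
  by rewrite ler_peMr ?ler0n// exprn_ege1//; lra.
rewrite (le_trans le1)// expRN /= lef_pV2 ?posrE ?expR_gt0 ?ltr0n//.
by rewrite -natr1 addrC expR_ge1Dx.
Qed.

Lemma norm_series_sin_coeff_le x n : `|series (sin_coeff x) n| <= expR `|x|.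
Proof.
rewrite (@le_trans _ _ (series (exp_coeff `|x|) n))//.
  rewrite /series/= (le_trans (ler_norm_sum _ _ _))//.
  apply: ler_sum => i _; rewrite /sin_coeff/= /exp_coeff/= !normrM.
  rewrite normr_nat normrX normrN1 expr1n mulr1 normfV normr_nat normrX.
  rewrite ler_wpM2r ?invr_ge0// ler_piMl ?exprn_ge0//.
  by case: (odd i).
apply: nondecreasing_cvgn_le; last exact: is_cvg_series_exp_coeff.
by apply: nondecreasing_series => i _ _; exact: exp_coeff_ge0.
Qed.

(** At a low enough frequency the argument lies strictly between [- pi] and [pi], where the sine has
    the sign of its argument. *)
Lemma cvg_sin_lt0 x : ((sin (n.+1%:R^-1 * x) < 0)%R%:R : R) @[n --> \oo] --> ((x < 0)%R%:R : R).
Proof.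
have [N xN] : exists N : nat, `|x| < N.+1%:R * pi.
  exists (Num.bound (`|x| / pi)).
  rewrite -ltr_pdivrMr ?pi_gt0//.
  have := archi_boundP (divr_ge0 (normr_ge0 x) (pi_ge0 R)).
  by move/lt_trans; apply; rewrite ltr_nat.
apply: cvg_near_cst.
exists N => // n /= Nn; congr (_%:R).
have n0 : 0 < (n.+1%:R^-1 : R) by rewrite invr_gt0.
have xn : `|n.+1%:R^-1 * x| < pi.
  rewrite normrM gtr0_norm// ltr_pdivrMl// (lt_le_trans xN)//.
  by rewrite ler_pM2r ?pi_gt0// ler_nat.
set y := _ * x in xn *.
have -> : (x < 0) = (y < 0) by rewrite /y pmulr_rlt0.
move: xn; rewrite ltr_norml => /andP[y1 y2].
have [y0|y0] := ltP y 0.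
  rewrite -[y]opprK sinN oppr_lt0 sin_gt0_pi//; lra.
by rewrite ltNge sin_ge0_pi // y0 ltW.
Qed.

End StepApproximation.

Section Multipliers.
Context (d : measure_display) (T : measurableType d) (R : realType).
Context (P : probability T R) (V : set (T -> R)).
Hypothesis Vlin : forall a b f g, V f -> V g -> V (fun w => a * f w + b * g w).
Hypothesis Vmeas : forall f, V f -> measurable_fun setT f.
Implicit Types (h rho Z : T -> R).

(* [rho] is orthogonal to all functions of [V] when it is orthogonal to all
   exponentials. Multipliers make this precise: they form an algebra that is
   closed under dominated limits, contains [V] and hence the indicators of
   half-spaces, the latter as limits of polynomials in [sin (t * Z)]. *)
Definition exp_null rho := measurable_fun setT rho /\
  forall Z, V Z -> integ P (fun w => expR (Z w) * rho w) /\
    Ex P (fun w => expR (Z w) * rho w) = 0.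

Definition multiplier h := measurable_fun setT h /\
  forall rho, exp_null rho -> exp_null (fun w => h w * rho w).

Lemma multiplier_cst a : multiplier (fun=> a).
Proof.
split => // rho [mrho h]; split; first exact: measurable_funM.
move=> Z /h [i e]; under eq_fun do rewrite mulrCA.
by split; [exact: integZ|rewrite ExZ// e mulr0].
Qed.

Lemma multiplierM h1 h2 : multiplier h1 -> multiplier h2 ->
  multiplier (fun w => h1 w * h2 w).
Proof.
move=> [m1 H1] [m2 H2]; split; first exact: measurable_funM.
move=> rho rho0; under eq_fun do rewrite -mulrA.
exact/H1/H2.
Qed.

Lemma multiplierD h1 h2 : multiplier h1 -> multiplier h2 ->
  multiplier (fun w => h1 w + h2 w).
Proof.
move=> [m1 H1] [m2 H2]; split; first exact: measurable_funD.
move=> rho rho0; have [mr1 r1] := H1 _ rho0; have [mr2 r2] := H2 _ rho0.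
under eq_fun do rewrite mulrDl.
split; first exact: measurable_funD.
move=> Z VZ; have [i1 e1] := r1 _ VZ; have [i2 e2] := r2 _ VZ.
under eq_fun do rewrite mulrDr.
by split; [exact: integD|rewrite ExD// e1 e2 addr0].
Qed.

Lemma multiplierB h1 h2 : multiplier h1 -> multiplier h2 ->
  multiplier (fun w => h1 w - h2 w).
Proof.
move=> H1 H2; under eq_fun do rewrite -mulN1r.
by apply: multiplierD => //; apply: multiplierM => //; exact: multiplier_cst.
Qed.

Lemma multiplierX h n : multiplier h -> multiplier (fun w => h w ^+ n).
Proof.
move=> H; elim: n => [|n IH]; first exact: multiplier_cst.
by under eq_fun do rewrite exprS; exact: multiplierM.
Qed.

Lemma multiplier_sum (h_ : nat -> T -> R) n : (forall i, multiplier (h_ i)) ->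
  multiplier (fun w => \sum_(0 <= i < n) h_ i w).
Proof.
move=> H; elim: n => [|n IH].
  by under eq_fun do rewrite big_nil; exact: multiplier_cst.
by under eq_fun do rewrite big_nat_recr//=; exact: multiplierD.
Qed.

(** Domination by [exp Z + exp (- Z)] admits unbounded approximations: multiplied by [exp Z'] it
    only moves the exponent to [Z' + Z] or [Z' - Z], both in [V], where integrability is known. *)
Lemma multiplier_lim (h_ : nat -> T -> R) h Z C : (forall n, multiplier (h_ n)) ->
  V Z -> (forall n w, `|h_ n w| <= C * (expR (Z w) + expR (- Z w))) ->
  (forall w, h_ n w @[n --> \oo] --> h w) -> multiplier h.
Proof.
move=> H VZ hC hh.
have mh : measurable_fun setT h.
  by apply: (measurable_fun_cvg (fun n => (H n).1)) => w _; exact: hh.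
split => // rho [mrho rho0]; split; first exact: measurable_funM.
move=> Z' VZ'.
have V1 : V (fun w => Z' w + Z w).
  by have := Vlin 1 1 VZ' VZ; under eq_fun do rewrite !mul1r.
have V2 : V (fun w => Z' w - Z w).
  by have := Vlin 1 (-1) VZ' VZ; under eq_fun do rewrite mul1r mulN1r.
have [i1 _] := rho0 _ V1; have [i2 _] := rho0 _ V2.
have [n|w||n w|_ iE cE] := @Ex_dct _ _ _ P
    (fun n w => expR (Z' w) * (h_ n w * rho w)) (fun w => expR (Z' w) * (h w * rho w))
    (fun w => C * (`|expR (Z' w + Z w) * rho w| + `|expR (Z' w - Z w) * rho w|)).
- apply: measurable_funM; first by apply: measurableT_comp => //; exact: Vmeas.
  by apply: measurable_funM => //; exact: (H n).1.
- by apply: cvgM; [exact: cvg_cst|apply: cvgM; [exact: hh|exact: cvg_cst]].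
- by apply: integZ; apply: integD; exact: integ_norm.
- rewrite !normrM !(ger0_norm (expR_ge0 _)) !expRD -mulrDl -mulrDr.
  rewrite [leRHS](_ : _ = expR (Z' w) * (C * (expR (Z w) + expR (- Z w)) * `|rho w|)).
    by rewrite ler_wpM2l ?expR_ge0// ler_wpM2r.
  by ring.
split => //.
have e n : Ex P (fun w => expR (Z' w) * (h_ n w * rho w)) = 0.
  by have [_] := H n; move=> /(_ rho (conj mrho rho0)) [_ /(_ _ VZ')] [].
move: cE; under eq_fun do rewrite e.
by move=> cE; apply/esym; exact: (cvg_unique _ (cvg_cst 0) cE).
Qed.

Lemma one_le_expR2 (x : R) : 1 <= expR x + expR (- x).
Proof.
apply: (le_trans _ (expR_norm_le x)).
by rewrite -expR0 ler_expR.
Qed.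

Lemma multiplier_exp Z t : V Z -> multiplier (fun w => expR (t * Z w)).
Proof.
move=> VZ; split.
  by apply: measurableT_comp => //; apply: measurable_funM => //; exact: Vmeas.
move=> rho [mrho rho0]; split.
  apply: measurable_funM => //.
  by apply: measurableT_comp => //; apply: measurable_funM => //; exact: Vmeas.
move=> Z' VZ'; have := rho0 _ (Vlin 1 t VZ' VZ).
under eq_fun do rewrite mul1r expRD -mulrA.
by [].
Qed.

Lemma multiplier_id Z : V Z -> multiplier Z.
Proof.
move=> VZ; pose r n := @harmonic R n.
have r01 n : 0 < r n <= 1.
  by rewrite /r /harmonic/= invr_gt0 ltr0n invf_le1 ?ltr0n// ler1n.
have V2 : V (fun w => 2 * Z w).
  by have := Vlin 2 0 VZ VZ; under eq_fun do rewrite mul0r addr0.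
apply: (@multiplier_lim (fun n w => (r n)^-1 * (expR (r n * Z w) - 1)) _ _ 1 _ V2).
- move=> n; apply: multiplierM; first exact: multiplier_cst.
  by apply: multiplierB; [exact: multiplier_exp|exact: multiplier_cst].
- move=> n w; have /andP[rn0 rn1] := r01 n; rewrite mul1r.
  apply: (le_trans _ (expR_norm_le _)).
  rewrite normrM gtr0_norm ?invr_gt0// ler_pdivrMl//.
  rewrite (le_trans (norm_expR_sub1_le _))// normrM gtr0_norm// -mulrA.
  rewrite ler_pM2l// [`|2 * _|]normrM [`|2|]gtr0_norm// mulrDl mul1r expRD.
  by rewrite ler_pM ?norm_le_expR ?expR_ge0// ler_expR ler_piMl.
- move=> w; have := @cvg_expR_quotient R _ (Z w) 0 r01 (@cvg_harmonic R).
  by under eq_fun do rewrite mulr0 addr0.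
Qed.

Lemma multiplier_sin Z t b : V Z -> multiplier (fun w => sin (t * (Z w + b))).
Proof.
move=> VZ.
have VtZ : V (fun w => t * Z w).
  by have := Vlin t 0 VZ VZ; under eq_fun do rewrite mul0r addr0.
apply: (@multiplier_lim (fun n w => series (sin_coeff (t * (Z w + b))) n) _ _
  (expR `|t * b|) _ VtZ).
- move=> n; rewrite /series/=; apply: multiplier_sum => i.
  rewrite /sin_coeff/=; apply: multiplierM; last exact: multiplier_cst.
  apply: multiplierM; first exact: multiplier_cst.
  apply: multiplierX; apply: multiplierM; first exact: multiplier_cst.
  by apply: multiplierD; [exact: multiplier_id|exact: multiplier_cst].
- move=> n w; rewrite (le_trans (norm_series_sin_coeff_le _ _))//.
  rewrite mulrDr (@le_trans _ _ (expR (`|t * b| + `|t * Z w|)))//.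
    by rewrite ler_expR [leRHS]addrC ler_normD.
  by rewrite expRD ler_wpM2l ?expR_ge0// expR_norm_le.
- by move=> w; rewrite trigo.sin.unlock; exact: is_cvg_series_sin_coeff.
Qed.

(** [cvg_step] needs an argument in [0, 1], whereas [Z] may be unbounded; hence the passage through
    the sine, rescaled so that its change of sign sits at 1/2. *)
Lemma multiplier_sin_lt0 Z t b : V Z ->
  multiplier (fun w => (sin (t * (Z w + b)) < 0)%R%:R).
Proof.
move=> VZ; pose u w : R := (1 + sin (t * (Z w + b))) / 2.
have u01 w : 0 <= u w <= 1.
  rewrite /u; have := sin_le1 (t * (Z w + b)); have := sin_geN1 (t * (Z w + b)).
  by move=> ? ?; apply/andP; split; lra.
have mu : multiplier u.
  apply: multiplierM; last exact: multiplier_cst.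
  by apply: multiplierD; [exact: multiplier_cst|exact: multiplier_sin].
apply: (@multiplier_lim (fun n w => (1 - u w ^+ n) ^+ (n * 2 ^ n)) _ _ 1 _ VZ).
- move=> n; apply: multiplierX; apply: multiplierB; first exact: multiplier_cst.
  exact: multiplierX.
- move=> n w; rewrite mul1r (le_trans _ (one_le_expR2 _))//.
  have /andP[u0 u1] := u01 w.
  have un : 0 <= 1 - u w ^+ n by rewrite subr_ge0 exprn_ile1.
  by rewrite ger0_norm ?exprn_ge0// exprn_ile1// gerBl exprn_ge0.
- move=> w; have := cvg_step (u01 w).
  suff -> : (u w < 2^-1) = (sin (t * (Z w + b)) < 0) by [].
  by rewrite /u; apply/idP/idP => ?; lra.
Qed.

Lemma multiplier_lt0 Z b : V Z -> multiplier (fun w => (Z w + b < 0)%R%:R).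
Proof.
move=> VZ.
apply: (@multiplier_lim (fun n w => (sin (n.+1%:R^-1 * (Z w + b)) < 0)%R%:R)
   _ _ 1 _ VZ).
- by move=> n; exact: multiplier_sin_lt0.
- move=> n w; rewrite mul1r (le_trans _ (one_le_expR2 _))//.
  by case: (_ < _); rewrite ?normr1 ?normr0.
- by move=> w; exact: cvg_sin_lt0.
Qed.

Lemma multiplier_ge0 Z b : V Z -> multiplier (fun w => (0 <= Z w + b)%R%:R).
Proof.
move=> VZ; rewrite (_ : (fun w => _) = (fun w => 1 - (Z w + b < 0)%R%:R)).
  by apply: multiplierB; [exact: multiplier_cst|exact: multiplier_lt0].
by apply/funext => w; case: ltP; rewrite ?subrr ?subr0.
Qed.

Lemma multiplier_prod (h_ : nat -> T -> R) n : (forall i, multiplier (h_ i)) ->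
  multiplier (fun w => \prod_(0 <= i < n) h_ i w).
Proof.
move=> H; elim: n => [|n IH].
  by under eq_fun do rewrite big_nil; exact: multiplier_cst.
by under eq_fun do rewrite big_nat_recr//=; exact: multiplierM.
Qed.

End Multipliers.

(** * Concentration of finite Gaussian maxima *)

Section TrigBounds.
Context (R : realType).

Lemma norm_sin_le (x : R) : `|sin x| <= `|x|.
Proof.
wlog x0 : x / 0 <= x => [h|].
  have [/h//|/ltW x0] := leP 0 x.
  by rewrite -normrN -sinN -[leRHS]normrN h// oppr_ge0.
have [c _] := @MVT_segment R sin cos 0 x x0 (fun y _ => is_derive_sin y)
  (continuous_subspaceT (@continuous_sin R)).
rewrite sin0 !subr0 => ->; rewrite normrM ler_piMl//.
by rewrite ler_norml cos_geN1 cos_le1.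
Qed.

Lemma one_sub_cos_le (x : R) : 1 - cos x <= x ^+ 2 / 2.
Proof.
have -> : 1 - cos x = 2 * sin (x / 2) ^+ 2.
  rewrite {1}[x](_ : x = (x / 2) *+ 2); last by rewrite -mulr_natr divfK.
  by rewrite cos_mulr2n cos2sin2; ring.
have : sin (x / 2) ^+ 2 <= (x / 2) ^+ 2.
  rewrite -[leLHS]real_normK ?num_real// -[leRHS]real_normK ?num_real//.
  by rewrite lerXn2r ?nnegrE// norm_sin_le.
set s := sin _; move=> h; have -> : x ^+ 2 / 2 = 2 * (x / 2) ^+ 2 by field.
by rewrite ler_pM2l.
Qed.

Lemma pi_le4 : (pi : R) <= 4.
Proof. by have [/andP[_ ?] _] := pihalf_02_cos_pihalf R; lra. Qed.

(** Convexity from the tangent at [a * x], evaluated at [x] and at 0 and averaged with weights [a]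
    and [1 - a]. *)
Lemma expR_convex1 (x a : R) : 0 <= a <= 1 -> expR (a * x) <= 1 - a + a * expR x.
Proof.
move=> /andP[a0 a1]; have a1' : 0 <= 1 - a by rewrite subr_ge0.
have h1 : expR (a * x) * (1 + (1 - a) * x) <= expR x.
  have -> : expR x = expR (a * x) * expR ((1 - a) * x) by rewrite -expRD; congr expR; ring.
  by rewrite ler_pM2l ?expR_gt0// expR_ge1Dx.
have h2 : expR (a * x) * (1 - a * x) <= 1.
  have {2}-> : 1 = expR (a * x) * expR (- (a * x)) by rewrite expRxMexpNx_1.
  by rewrite ler_pM2l ?expR_gt0// expR_ge1Dx.
have h := lerD (ler_wpM2l a0 h1) (ler_wpM2l a1' h2).
rewrite [leLHS](_ : _ = a * (expR (a * x) * (1 + (1 - a) * x)) +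
  (1 - a) * (expR (a * x) * (1 - a * x))); last by ring.
by rewrite (le_trans h)// mulr1 addrC.
Qed.

End TrigBounds.

(** * Finite maxima and their first maximiser *)

Section FiniteMax.
Context (R : realType).
Implicit Types y : nat -> R.

Fixpoint fmax (m : nat) y : R :=
  if m is m'.+1 then Num.max (fmax m' y) (y m) else y 0%N.

Lemma le_fmax m y i : (i <= m)%N -> y i <= fmax m y.
Proof.
elim: m => [|m IH]; first by rewrite leqn0 => /eqP ->.
rewrite leq_eqVlt => /orP[/eqP ->|im]/=; rewrite le_max ?lexx ?orbT//.
by rewrite IH.
Qed.

Lemma fmaxP m y : exists2 i, (i <= m)%N & fmax m y = y i.
Proof.
elim: m => [|m [i im IH]] /=; first by exists 0%N.
rewrite IH; case: (leP (y i) (y m.+1)) => _; first by exists m.+1.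
by exists i => //; exact: leqW.
Qed.

Lemma measurable_fmax (d : measure_display) (T : measurableType d) m
    (Y : nat -> T -> R) : (forall i, measurable_fun setT (Y i)) ->
  measurable_fun setT (fun w => fmax m (fun i => Y i w)).
Proof. by move=> mY; elim: m => [|m IH] //=; apply: measurable_maxr. Qed.

(** The indicator that [i] is the smallest index of a maximum. The strict inequality for [j < i]
    breaks ties, so that exactly one of these indicators is 1. The product form matters: each factor
    is the indicator of a half-space, and multipliers are stable under products. *)
Definition first_argmax (m i : nat) y : R :=
  \prod_(0 <= j < m.+1) (if (j < i)%N then (y j < y i)%R else (y j <= y i)%R)%:R.

Lemma first_argmax01 m i y :
  first_argmax m i y = (all (fun j => if (j < i)%N then (y j < y i)%R else (y j <= y i)%R)
    (index_iota 0 m.+1))%:R.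
Proof.
rewrite /first_argmax; elim: (index_iota _ _) => [|j s IH]; first by rewrite big_nil.
by rewrite big_cons IH /= -natrM mulnb.
Qed.

Lemma first_argmax_ge0 m i y : 0 <= first_argmax m i y.
Proof. by rewrite first_argmax01 ler0n. Qed.

Lemma first_argmax_neq0 m i y : first_argmax m i y != 0 ->
  forall j, (j <= m)%N -> y j <= y i.
Proof.
rewrite first_argmax01; case: allP => [h _ j jm|]; last by rewrite eqxx.
by have := h j; rewrite mem_index_iota/= ltnS => /(_ jm); case: ifP => // _ /ltW.
Qed.

Lemma sum_first_argmax m y : \sum_(0 <= i < m.+1) first_argmax m i y = 1.
Proof.
pose p i := all (fun j => (j <= m)%N && (y j <= y i)) (index_iota 0 m.+1) && (i <= m)%N.
have ex_p : exists i, p i.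
  have [i im e] := fmaxP m y; exists i; rewrite /p im andbT; apply/allP => j.
  by rewrite mem_index_iota/= ltnS => jm; rewrite jm -e le_fmax.
have [i /andP[/allP hi im] mini] := ex_minnP ex_p.
have Hi j : (j <= m)%N -> y j <= y i.
  by move=> jm; have := hi j; rewrite mem_index_iota/= ltnS jm => /(_ isT).
have fi : first_argmax m i y = 1.
  rewrite first_argmax01; case: allP => // h; exfalso; apply: h => j.
  rewrite mem_index_iota/= ltnS => jm; case: ifP => ji; last exact: Hi.
  rewrite lt_neqAle Hi// andbT; apply/eqP => yji.
  have : p j.
    rewrite /p jm andbT; apply/allP => k; rewrite mem_index_iota/= ltnS => km.
    by rewrite km yji Hi.
  by move=> /mini; rewrite leqNgt ji.
have f0 k : (k <= m)%N -> k != i -> first_argmax m k y = 0.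
  move=> km ki; apply/eqP/negPn/negP => /[dup] fk /first_argmax_neq0 hk.
  move: fk; rewrite first_argmax01; case: allP => [h _|_]; last by rewrite eqxx.
  have [ik|ik] := ltnP i k.
    by have := h i; rewrite mem_index_iota/= ltnS im ik => /(_ isT); rewrite ltNge Hi.
  have ki' : (k < i)%N by rewrite ltn_neqAle ki.
  have : p k.
    rewrite /p km andbT; apply/allP => j; rewrite mem_index_iota/= ltnS => jm.
    by rewrite jm hk.
  by move=> /mini; rewrite leqNgt ki'.
rewrite (bigD1_seq i) ?iota_uniq ?mem_index_iota//= fi big_seq_cond big1 ?addr0//.
by move=> k; rewrite mem_index_iota/= ltnS => /andP[km ki]; exact: f0.
Qed.

End FiniteMax.

Section ProductExpectation.
Context (d : measure_display) (T : measurableType d) (R : realType).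
Context (P : probability T R).
Local Open Scope ereal_scope.

Lemma integ_prod (f g : T -> R) : integ P f -> integ P g ->
  (forall x, 0 <= f x)%R -> (forall x, 0 <= g x)%R ->
  integ (P \x P) (fun z => f z.1 * g z.2)%R /\
  Ex (P \x P) (fun z => f z.1 * g z.2)%R = (Ex P f * Ex P g)%R.
Proof.
move=> fi gi f0 g0.
have mf := integ_meas fi; have mg := integ_meas gi.
have mfg : measurable_fun setT (fun z : T * T => f z.1 * g z.2)%R.
  by apply: measurable_funM; [exact: measurableT_comp measurable_fst|exact: measurableT_comp measurable_snd].
apply: integ_ge0E => //; first by move=> z; rewrite mulr_ge0.
rewrite (fubini_tonelli1 (fun z => (f z.1 * g z.2)%:E)); last 2 first.
- exact/measurable_EFinP.
- by move=> z; rewrite lee_fin mulr_ge0.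
transitivity (\int[P]_x ((Ex P g)%:E * (f x)%:E)).
  apply: eq_integral => x _; rewrite /fubini_F/=.
  under eq_integral do rewrite EFinM.
  rewrite ge0_integralZl//; last 3 first.
  - exact/measurable_EFinP.
  - by move=> y _; rewrite lee_fin.
  - by rewrite lee_fin.
  by rewrite -EFin_Ex// muleC.
rewrite ge0_integralZl//; last 3 first.
- exact/measurable_EFinP.
- by move=> y _; rewrite lee_fin.
- by rewrite lee_fin Ex_ge0.
by rewrite -EFin_Ex// -EFinM mulrC.
Qed.

End ProductExpectation.

(** * Rotation of two independent copies *)

Section Rotation.
Context (d : measure_display) (T : measurableType d) (R : realType).
Context (P : probability T R) (V : set (T -> R)).
Hypothesis gV : gaussian_space P V.
Implicit Types (f g : T -> R) (t s : R).

Local Notation var f := (Ex P (fun w => f w ^+ 2)).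
Local Notation Q := (P \x P)%E.

(* Two independent copies are rotated into each other; [rot t f] and
   [rot_orth t f] are independent, and [rot_orth t f] is the derivative of
   [rot t f] in [t]. *)
Definition rot t f : T * T -> R := fun z => cos t * f z.1 + sin t * f z.2.
Definition rot_orth t f : T * T -> R := fun z => - sin t * f z.1 + cos t * f z.2.

Lemma measurable_lift f g a b : V f -> V g ->
  measurable_fun setT (fun z : T * T => a * f z.1 + b * g z.2).
Proof.
move=> /(gs_meas gV) mf /(gs_meas gV) mg.
apply: measurable_funD; apply: measurable_funM => //.
  exact: measurableT_comp measurable_fst.
exact: measurableT_comp measurable_snd.
Qed.

Lemma Ex_exp_lift f g : V f -> V g ->
  integ Q (fun z => expR (f z.1 + g z.2)) /\
  Ex Q (fun z => expR (f z.1 + g z.2)) = expR ((var f + var g) / 2).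
Proof.
move=> Vf Vg.
have [i e] := integ_prod (gs_exp gV Vf) (gs_exp gV Vg)
  (fun x => expR_ge0 (f x)) (fun x => expR_ge0 (g x)).
under eq_fun do rewrite expRD; split => //.
by rewrite e !(gs_mgf gV)// mulrDl expRD.
Qed.

(** The cross terms of the two coordinates cancel and [cos ^ 2 + sin ^ 2 = 1], so the exponent
    splits into the variances of [f] and [g]: this is the independence of [rot t f] and
    [rot_orth t g] at the level of exponentials. *)
Lemma Ex_exp_rot t s f g : V f -> V g ->
  integ Q (fun z => expR (rot t f z + s * rot_orth t g z)) /\
  Ex Q (fun z => expR (rot t f z + s * rot_orth t g z)) =
    expR ((var f + s ^+ 2 * var g) / 2).
Proof.
move=> Vf Vg.
have Vu : V (fun w => cos t * f w + (- s * sin t) * g w) by exact: (gs_lin gV).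
have Vv : V (fun w => sin t * f w + (s * cos t) * g w) by exact: (gs_lin gV).
have [i e] := Ex_exp_lift Vu Vv.
have E z : rot t f z + s * rot_orth t g z = (cos t * f z.1 + (- s * sin t) * g z.1) +
    (sin t * f z.2 + (s * cos t) * g z.2) by rewrite /rot /rot_orth; ring.
under eq_fun do rewrite E; split => //.
rewrite e; congr (expR (_ / 2)).
rewrite -ExD; [|exact: (gs_sqr gV)|exact: (gs_sqr gV)].
rewrite -ExZ; last exact: (gs_sqr gV).
rewrite -ExD; [|exact: (gs_sqr gV)|by apply: integZ; exact: (gs_sqr gV)].
congr (Ex P); apply/funext => w.
have := cos2Dsin2 t; set c := cos t; set sn := sin t => cs.
rewrite [RHS](_ : _ = (c ^+ 2 + sn ^+ 2) * (f w ^+ 2 + s ^+ 2 * g w ^+ 2)); last first.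
  by rewrite cs mul1r.
by ring.
Qed.

Definition rot_space t : set (T * T -> R) := [set rot t f | f in V].

Lemma rot_space_lin t a b (f g : T * T -> R) : rot_space t f -> rot_space t g ->
  rot_space t (fun w => a * f w + b * g w).
Proof.
move=> [f' Vf' <-] [g' Vg' <-]; exists (fun w => a * f' w + b * g' w).
  exact: (gs_lin gV).
by apply/funext => z; rewrite /rot; ring.
Qed.

Lemma rot_space_meas t (f : T * T -> R) : rot_space t f -> measurable_fun setT f.
Proof. by move=> [f' Vf' <-]; exact: measurable_lift. Qed.

(** Independence in the form on which multipliers act: the constant subtracted is the mean of the
    exponential of [s * rot_orth t g]. *)
Lemma rot_exp_null t s g : V g -> exp_null Q (rot_space t)
  (fun z => expR (s * rot_orth t g z) - expR (s ^+ 2 * var g / 2)).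
Proof.
move=> Vg; split.
  apply: measurable_funB => //; apply: measurableT_comp => //.
  by apply: measurable_funM => //; exact: measurable_lift.
move=> _ [f Vf <-].
have [i1 e1] := Ex_exp_rot t s Vf Vg.
have [i2 e2] := Ex_exp_rot t 0 Vf Vg.
have E z : expR (rot t f z) * (expR (s * rot_orth t g z) - expR (s ^+ 2 * var g / 2)) =
    expR (rot t f z + s * rot_orth t g z) -
    expR (s ^+ 2 * var g / 2) * expR (rot t f z + 0 * rot_orth t g z).
  by rewrite mul0r addr0 expRD; ring.
under eq_fun do rewrite E.
have i3 := integZ (expR (s ^+ 2 * var g / 2)) i2.
split; first exact: integB.
rewrite ExB// ExZ// e1 e2 expr0n/= mul0r addr0 -expRD.
by apply/eqP; rewrite subr_eq0; apply/eqP; congr expR; ring.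
Qed.

End Rotation.

(** * Exponential moments of the rotated maximum *)

Section Concentration.
Context (d : measure_display) (T : measurableType d) (R : realType).
Context (P : probability T R) (V : set (T -> R)).
Hypothesis gV : gaussian_space P V.
Context (m : nat) (Y : nat -> T -> R) (b : nat -> R) (L2 : R).
Hypothesis VY : forall i, V (Y i).
Hypothesis varY : forall i, Ex P (fun w => Y i w ^+ 2) <= L2.

Local Notation Q := (P \x P)%E.

Let F w := fmax m (fun i => Y i w - b i).
Let Frot t z := fmax m (fun i => rot t (Y i) z - b i).
Let ind t i z := first_argmax m i (fun j => rot t (Y j) z - b j).

Lemma multiplier_first_argmax t i : multiplier Q (rot_space V t) (ind t i).
Proof.
rewrite /ind /first_argmax.
have lin := @rot_space_lin _ _ _ _ _ gV t.
have meas := @rot_space_meas _ _ _ _ _ gV t.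
have VYr j : rot_space V t (rot t (Y j)) by exists (Y j).
apply: multiplier_prod => // j.
case: (j < i)%N.
  have Vd : rot_space V t (fun z => rot t (Y j) z - rot t (Y i) z).
    by have := lin 1 (-1) _ _ (VYr j) (VYr i); under eq_fun do rewrite mul1r mulN1r.
  rewrite [X in multiplier _ _ X](_ : _ = fun z =>
      (rot t (Y j) z - rot t (Y i) z + (b i - b j) < 0)%R%:R).
    exact: (multiplier_lt0 Q lin meas).
  apply/funext => z; congr (_%:R); congr nat_of_bool; apply/idP/idP => ?; lra.
have Vd : rot_space V t (fun z => rot t (Y i) z - rot t (Y j) z).
  by have := lin 1 (-1) _ _ (VYr i) (VYr j); under eq_fun do rewrite mul1r mulN1r.
rewrite [X in multiplier _ _ X](_ : _ = fun z =>
    (0 <= rot t (Y i) z - rot t (Y j) z + (b j - b i))%R%:R).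
  exact: (multiplier_ge0 Q lin meas).
by apply/funext => z; congr (_%:R); congr nat_of_bool; apply/idP/idP => ?; lra.
Qed.

Let term t s a i z :=
  ind t i z * expR (a * rot t (Y i) z + s * rot_orth t (Y i) z).

Lemma first_argmax_le1 (y : nat -> R) i : first_argmax m i y <= 1.
Proof. by rewrite first_argmax01; case: all. Qed.

Lemma integ_exp_rot t a i : integ Q (fun z => expR (a * rot t (Y i) z)).
Proof.
have VaY : V (fun w => a * Y i w + 0 * Y i w) by exact: (gs_lin gV).
have [+ _] := Ex_exp_rot gV t 0 VaY VaY.
congr integ; apply/funext => z; congr expR; rewrite /rot /rot_orth; ring.
Qed.

Lemma Ex_exp_rot_le t i : Ex Q (fun z => expR (rot t (Y i) z)) <= expR (L2 / 2).
Proof.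
have [_] := Ex_exp_rot gV t 0 (VY i) (VY i).
under eq_fun do rewrite mul0r addr0.
by move=> ->; rewrite expr0n/= mul0r addr0 ler_expR ler_pM2r.
Qed.

Lemma integ_ind_exp t a i : integ Q (fun z => ind t i z * expR (a * rot t (Y i) z)).
Proof.
have ie := integ_exp_rot t a i.
apply: (le_integ _ ie).
  apply: measurable_funM; first exact: (multiplier_first_argmax t i).1.
  exact: integ_meas ie.
move=> z; rewrite normrM !ger0_norm ?expR_ge0 ?first_argmax_ge0//.
by rewrite ler_piMl ?expR_ge0// first_argmax_le1.
Qed.

(** Which functional is maximal at [t] is decided within [rot_space t], so [rot_orth t (Y i)] is
    independent of it and contributes its exact exponential moment. The latter is bounded alike for
    all [i], which later lets the indicators be summed to 1. *)
Lemma Ex_term t s a i : integ Q (term t s a i) /\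
  Ex Q (term t s a i) = expR (s ^+ 2 * Ex P (fun w => Y i w ^+ 2) / 2) *
    Ex Q (fun z => ind t i z * expR (a * rot t (Y i) z)).
Proof.
have [_ /(_ _ (rot_exp_null gV t s (VY i)))] := multiplier_first_argmax t i.
set k := expR (s ^+ 2 * _ / 2).
have Va : rot_space V t (fun z => a * rot t (Y i) z).
  exists (fun w => a * Y i w + 0 * Y i w); first exact: (gs_lin gV).
  by apply/funext => z; rewrite /rot; ring.
move=> [_ /(_ _ Va) [iA eA]].
have iB := integ_ind_exp t a i.
have E : term t s a i = (fun z => expR (a * rot t (Y i) z) *
    (ind t i z * (expR (s * rot_orth t (Y i) z) - k)) +
    k * (ind t i z * expR (a * rot t (Y i) z))).
  by apply/funext => z; rewrite /term expRD; ring.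
rewrite E; split; first by apply: integD => //; exact: integZ.
by rewrite ExD ?ExZ ?eA ?add0r//; exact: integZ.
Qed.

(* The increment of the maximum over a rotation by [e] is bounded by that of the
   functional which is maximal at time [t]. *)
Let G t mu e z := \sum_(0 <= i < m.+1) term t (- (mu * sin e)) (mu * (1 - cos e)) i z.

Lemma exp_fmax_rot_le t mu e z : 0 <= mu ->
  expR (mu * (Frot t z - Frot (t + e) z)) <= G t mu e z.
Proof.
move=> mu0.
rewrite -[leLHS]mul1r -(sum_first_argmax m (fun j => rot t (Y j) z - b j)) mulr_suml.
rewrite big_seq_cond [leRHS]big_seq_cond; apply: ler_sum => i.
rewrite mem_index_iota/= ltnS andbT => im; rewrite /term -/(ind t i z).
have [->|ind0] := eqVneq (ind t i z) 0; first by rewrite !mul0r.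
rewrite ler_wpM2l ?first_argmax_ge0// ler_expR.
have Fi : Frot t z <= rot t (Y i) z - b i.
  rewrite /Frot; have [j jm ->] := fmaxP m (fun i => rot t (Y i) z - b i).
  by have := first_argmax_neq0 ind0; exact.
have Fi' : rot (t + e) (Y i) z - b i <= Frot (t + e) z.
  exact: (le_fmax (fun i => rot (t + e) (Y i) z - b i)).
(* By the addition formulas, [rot (t + e)] is [cos e * rot t + sin e * rot_orth t]. *)
rewrite [leRHS](_ : _ = mu * (rot t (Y i) z - rot (t + e) (Y i) z)).
  by rewrite ler_wpM2l//; lra.
by rewrite /rot /rot_orth cosD sinD; ring.
Qed.

Let C := m.+1%:R * expR (L2 / 2).

(** The first factor is the Gaussian cost of one step. The second comes from the drift [1 - cos e]:
    convexity makes it linear in [mu * (1 - cos e)], and only then does the union bound [C] enter,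
    with a coefficient that will tend to 0. *)
Lemma Ex_exp_fmax_rot_le t mu e : 0 <= mu -> mu * (1 - cos e) <= 1 ->
  integ Q (G t mu e) /\
  Ex Q (G t mu e) <= expR (mu ^+ 2 * e ^+ 2 * L2 / 2) * (1 + mu * (1 - cos e) * C).
Proof.
move=> mu0; set a := mu * (1 - cos e) => a1.
have a0 : 0 <= a by rewrite mulr_ge0// subr_ge0 cos_le1.
have L0 : 0 <= L2 by apply: le_trans (varY 0); apply: Ex_ge0 => w; exact: sqr_ge0.
set s := - (mu * sin e).
have iT i := (Ex_term t s a i).1.
have eT i := (Ex_term t s a i).2.
split; first exact: integ_sum.
rewrite /G Ex_sum//.
have s2 : s ^+ 2 <= mu ^+ 2 * e ^+ 2.
  rewrite /s sqrrN exprMn ler_wpM2l ?sqr_ge0//.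
  rewrite -[leLHS]real_normK ?num_real// -[leRHS]real_normK ?num_real//.
  by rewrite lerXn2r ?nnegrE// norm_sin_le.
have iB i := integ_ind_exp t a i.
set K := expR _; rewrite (@le_trans _ _ (\sum_(0 <= i < m.+1) K *
    Ex Q (fun z => ind t i z * expR (a * rot t (Y i) z))))//.
  apply: ler_sum => i _; rewrite eT ler_wpM2r//.
    by apply: Ex_ge0 => z; rewrite mulr_ge0 ?expR_ge0// first_argmax_ge0.
  rewrite ler_expR ler_pM2r// ler_pM ?sqr_ge0//.
  by apply: Ex_ge0 => w; exact: sqr_ge0.
rewrite -mulr_sumr ler_wpM2l ?expR_ge0// -Ex_sum//.
have iE i : integ Q (fun z => expR (rot t (Y i) z)).
  by have := integ_exp_rot t 1 i; under eq_fun do rewrite mul1r.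
have iS : integ Q (fun z => \sum_(0 <= i < m.+1) expR (rot t (Y i) z)) by exact: integ_sum.
rewrite (@le_trans _ _ (Ex Q (fun z => (1 - a) + a * \sum_(0 <= i < m.+1) expR (rot t (Y i) z))))//.
  apply: le_Ex.
  - exact: integ_sum.
  - by apply: integD; [exact: integ_cst|exact: integZ].
  move=> z; have -> : 1 - a = \sum_(0 <= i < m.+1) (1 - a) * ind t i z.
    by rewrite -mulr_sumr [X in _ * X]sum_first_argmax mulr1.
  rewrite mulr_sumr -big_split/=; apply: ler_sum => i _.
  have i0 : 0 <= ind t i z by exact: first_argmax_ge0.
  have i1 : ind t i z <= 1 by exact: first_argmax_le1.
  rewrite (@le_trans _ _ (ind t i z * (1 - a + a * expR (rot t (Y i) z))))//.
    by rewrite ler_wpM2l// expR_convex1// a0.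
  rewrite mulrDr [X in X + _ <= _]mulrC lerD2l mulrCA ler_wpM2l//.
  by rewrite ler_piMl ?expR_ge0.
rewrite ExD; [|exact: integ_cst|exact: integZ].
rewrite Ex_cst ExZ// Ex_sum//.
have SC : \sum_(0 <= i < m.+1) Ex Q (fun z => expR (rot t (Y i) z)) <= C.
  rewrite (@le_trans _ _ (\sum_(0 <= i < m.+1) expR (L2 / 2)))//.
    by apply: ler_sum => i _; exact: Ex_exp_rot_le.
  by rewrite sumr_const_nat subn0 /C mulr_natl.
by apply: lerD; [rewrite gerBl|rewrite ler_wpM2l].
Qed.

Lemma integ_exp_fmax a : integ P (fun w => expR (a * F w)).
Proof.
have mF : measurable_fun setT F.
  apply: measurable_fmax => i; apply: measurable_funB => //; exact: (gs_meas gV).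
have iE i : integ P (fun w => expR (a * (Y i w - b i))).
  have -> : (fun w => expR (a * (Y i w - b i))) =
      (fun w => expR (- (a * b i)) * expR (a * Y i w + 0 * Y i w)).
    by apply/funext => w; rewrite -expRD; congr expR; ring.
  by apply: integZ; apply: (gs_exp gV); exact: (gs_lin gV).
apply: (@le_integ _ _ _ _ _ (fun w => \sum_(0 <= i < m.+1) expR (a * (Y i w - b i)))).
- by apply: measurableT_comp => //; exact: measurable_funM.
- exact: integ_sum.
- move=> w; rewrite ger0_norm ?expR_ge0// /F.
  have [j jm ->] := fmaxP m (fun i => Y i w - b i).
  rewrite (bigD1_seq j) ?iota_uniq ?mem_index_iota//= lerDl.
  by apply: sumr_ge0 => i _; exact: expR_ge0.
Qed.

Lemma integ_fmax : integ P F.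
Proof.
apply: (@le_integ _ _ _ _ _ (fun w => expR (1 * F w) + expR (- 1 * F w))).
- apply: measurable_fmax => i; apply: measurable_funB => //; exact: (gs_meas gV).
- by apply: integD; exact: integ_exp_fmax.
- move=> w; rewrite mul1r mulN1r.
  exact: (le_trans (norm_le_expR _) (expR_norm_le _)).
Qed.

Lemma jensen_exp (n : nat) (x : nat -> R) : (0 < n)%N ->
  expR (n%:R^-1 * \sum_(0 <= k < n) x k) <= n%:R^-1 * \sum_(0 <= k < n) expR (x k).
Proof.
move=> n0; set u := n%:R^-1 * _.
have nR : 0 < (n%:R : R) by rewrite ltr0n.
rewrite ler_pdivlMl//.
have Su : \sum_(0 <= k < n) x k = n%:R * u by rewrite /u mulVKf ?gt_eqF.
have -> : n%:R * expR u = \sum_(0 <= k < n) (expR u * (1 + (x k - u))).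
  rewrite -mulr_sumr big_split/= sumr_const_nat subn0 sumrB Su sumr_const_nat subn0.
  by rewrite -[u *+ n]mulr_natl; ring.
apply: ler_sum => k _; have -> : expR (x k) = expR u * expR (x k - u).
  by rewrite -expRD; congr expR; ring.
by rewrite ler_wpM2l ?expR_ge0// expR_ge1Dx.
Qed.

(** [F z.1 - F z.2] telescopes over [n] rotations by [e = pi / (2 * n)], from the first copy to the
    second. Jensen's inequality replaces the exponential of the sum by an average of exponentials
    with [mu = a * n]. As [mu * e = a * pi / 2], the Gaussian cost does not depend on [n], and
    [pi <= 4] rounds it to [2 * a^2 * L2]. *)
Lemma Ex_exp_fmax_diff_le a (n : nat) : (0 < n)%N -> 0 <= a ->
  (a * n%:R) * (1 - cos (pi / 2 / n%:R)) <= 1 ->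
  Ex Q (fun z => expR (a * (F z.1 - F z.2))) <=
  expR (2 * a ^+ 2 * L2) * (1 + (a * n%:R) * (1 - cos (pi / 2 / n%:R)) * C).
Proof.
move=> n0 a0 h1; set e := pi / 2 / n%:R in h1 *; set mu := a * n%:R in h1 *.
have nR : 0 < (n%:R : R) by rewrite ltr0n.
have L0 : 0 <= L2 by apply: le_trans (varY 0); apply: Ex_ge0 => w; exact: sqr_ge0.
have mu0 : 0 <= mu by rewrite mulr_ge0// ltW.
have G1 k := (Ex_exp_fmax_rot_le (k%:R * e) mu0 h1).1.
have G2 k := (Ex_exp_fmax_rot_le (k%:R * e) mu0 h1).2.
have [iF _] := integ_prod (integ_exp_fmax a) (integ_exp_fmax (- a))
  (fun w => expR_ge0 _) (fun w => expR_ge0 _).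
rewrite (@le_trans _ _ (Ex Q (fun z => n%:R^-1 * \sum_(0 <= k < n) G (k%:R * e) mu e z)))//.
  apply: le_Ex.
  - move: iF; congr integ; apply/funext => z; rewrite -expRD; congr expR; ring.
  - by apply: integZ; exact: integ_sum.
  move=> z; pose x (k : nat) := mu * (Frot (k%:R * e) z - Frot (k%:R * e + e) z).
  rewrite (@le_trans _ _ (n%:R^-1 * \sum_(0 <= k < n) expR (x k)))//; last first.
    rewrite ler_wpM2l ?invr_ge0 ?(ltW nR)//; apply: ler_sum => k _; exact: exp_fmax_rot_le.
  apply: le_trans (jensen_exp x n0); rewrite ler_expR /x -mulr_sumr.
  rewrite (eq_bigr (fun k : nat => - (Frot (k.+1%:R * e) z - Frot (k%:R * e) z))); last first.
    by move=> k _; rewrite opprB -natr1 mulrDl mul1r.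
  rewrite sumrN telescope_sumr//; set D := - (Frot _ z - Frot _ z).
  have -> : n%:R^-1 * (mu * D) = a * D by rewrite /mu; field; rewrite gt_eqF.
  rewrite /D opprB.
  rewrite (_ : n%:R * e = pi / 2); last by rewrite /e mulrC divfK// gt_eqF.
  have -> : Frot (0%:R * e) z = F z.1.
    congr fmax; apply/funext => i.
    by rewrite mul0r /rot cos0 sin0 mul1r mul0r addr0.
  have -> // : Frot (pi / 2) z = F z.2.
  congr fmax; apply/funext => i.
  by rewrite /rot cos_pihalf sin_pihalf mul1r mul0r add0r.
rewrite ExZ; last exact: integ_sum.
rewrite Ex_sum// ler_pdivrMl// (@le_trans _ _ (\sum_(0 <= k < n)
  (expR (mu ^+ 2 * e ^+ 2 * L2 / 2) * (1 + mu * (1 - cos e) * C))))//.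
  by apply: ler_sum => k _; exact: G2.
rewrite sumr_const_nat subn0 -[X in X <= _]mulr_natl ler_wpM2l ?(ltW nR)// ler_wpM2r//.
  rewrite addr_ge0// mulr_ge0//; last by rewrite mulr_ge0 ?expR_ge0.
  by rewrite mulr_ge0// subr_ge0 cos_le1.
rewrite ler_expR -exprMn (_ : mu * e = a * (pi / 2)); last first.
  by rewrite /mu /e; field; rewrite gt_eqF.
have p2 : (pi / 2) ^+ 2 <= (2 : R) ^+ 2.
  by rewrite lerXn2r ?nnegrE ?divr_ge0 ?pi_ge0//; have := pi_le4 R; lra.
rewrite exprMn (_ : 2 * a ^+ 2 * L2 = a ^+ 2 * 2 ^+ 2 * L2 / 2); last by field.
by rewrite ler_pM2r// ler_wpM2r// ler_wpM2l ?sqr_ge0.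
Qed.

(** [n * (1 - cos (pi / (2 * n)))] is O(1 / n), so the term with [C] disappears as [n] grows, and
    with it the number of functionals. *)
Lemma Ex_exp_fmax_sym a : 0 <= a ->
  Ex Q (fun z => expR (a * (F z.1 - F z.2))) <= expR (2 * a ^+ 2 * L2).
Proof.
move=> a0; have C0 : 0 <= C by rewrite mulr_ge0 ?expR_ge0.
apply/ler_addgt0Pr => x x0.
set K := expR (2 * a ^+ 2 * L2).
have K0 : 0 <= K by exact: expR_ge0.
(* The first summand makes the coefficient of the drift at most 1, the second makes the error at
   most [x]. *)
pose B := 2 * a + 2 * a * K * C / x.
have B0 : 0 <= B.
  by rewrite addr_ge0 ?mulr_ge0// ?invr_ge0 ?ltW.
pose n := (Num.bound B).+1.
have nB : B < n%:R.
  by rewrite (lt_trans (archi_boundP B0))// ltr_nat.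
have nR : 0 < (n%:R : R) by rewrite ltr0n.
have dn : (a * n%:R) * (1 - cos (pi / 2 / n%:R)) <= 2 * a / n%:R.
  have h : 1 - cos (pi / 2 / n%:R) <= 2 / n%:R ^+ 2 :> R.
    apply: (le_trans (one_sub_cos_le _)); rewrite exprMn exprVn.
    rewrite mulrAC ler_pM2r ?invr_gt0 ?exprn_gt0// ler_pdivrMr//.
    have p2 : (pi / 2) ^+ 2 <= (2 : R) ^+ 2.
      by rewrite lerXn2r ?nnegrE ?divr_ge0 ?pi_ge0//; have := pi_le4 R; lra.
    by rewrite (le_trans p2).
  rewrite (@le_trans _ _ (a * n%:R * (2 / n%:R ^+ 2)))//.
    by rewrite ler_wpM2l// mulr_ge0// ltW.
  by rewrite le_eqVlt; apply/orP; left; apply/eqP; field; rewrite gt_eqF.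
have nB1 : 2 * a <= n%:R.
  by rewrite (le_trans _ (ltW nB))// lerDl !mulr_ge0// invr_ge0 ltW.
have nB2 : 2 * a * K * C <= n%:R * x.
  rewrite -ler_pdivrMr// (le_trans _ (ltW nB))// lerDr mulr_ge0//.
have d1 : (a * n%:R) * (1 - cos (pi / 2 / n%:R)) <= 1.
  by rewrite (le_trans dn)// ler_pdivrMr// mul1r.
rewrite (le_trans (Ex_exp_fmax_diff_le _ a0 d1))// -/K mulrDr mulr1 lerD2l.
rewrite (@le_trans _ _ (K * (2 * a / n%:R * C)))//.
  by rewrite ler_wpM2l// ler_wpM2r.
rewrite (_ : K * _ = (2 * a * K * C) / n%:R); last by field; rewrite gt_eqF.
by rewrite ler_pdivrMr// [leRHS]mulrC.
Qed.

Lemma Ex_exp_ge g a : integ P g -> integ P (fun w => expR (a * g w)) ->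
  expR (a * Ex P g) <= Ex P (fun w => expR (a * g w)).
Proof.
move=> ig ie; set k := Ex P g.
have i1 : integ P (fun w => expR (a * k) * a * (g w - k)).
  by apply: integZ; apply: integB => //; exact: integ_cst.
rewrite (@le_trans _ _ (Ex P (fun w => expR (a * k) + expR (a * k) * a * (g w - k))))//.
  rewrite ExD//; last exact: integ_cst.
  rewrite Ex_cst ExZ; last by apply: integB => //; exact: integ_cst.
  rewrite ExB//; last exact: integ_cst.
  by rewrite Ex_cst -/k subrr mulr0 addr0.
apply: le_Ex => //; first by apply: integD => //; exact: integ_cst.
move=> w; have -> : expR (a * g w) = expR (a * k) * expR (a * (g w - k)).
  by rewrite -expRD; congr expR; ring.
by rewrite -mulrA -[X in X + _]mulr1 -mulrDr ler_wpM2l ?expR_ge0// expR_ge1Dx.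
Qed.

(** The symmetrised moment is a product over the two copies; Jensen's inequality bounds one factor
    from below by the exponential of its mean. *)
Lemma Ex_exp_fmax_centered a : 0 <= a ->
  Ex P (fun w => expR (a * F w)) <= expR (2 * a ^+ 2 * L2 + a * Ex P F) /\
  Ex P (fun w => expR (- a * F w)) <= expR (2 * a ^+ 2 * L2 - a * Ex P F).
Proof.
move=> a0; have [_ e] := integ_prod (integ_exp_fmax a) (integ_exp_fmax (- a))
  (fun w => expR_ge0 _) (fun w => expR_ge0 _).
have h := Ex_exp_fmax_sym a0.
have E : (fun z : T * T => expR (a * (F z.1 - F z.2))) =
    (fun z => expR (a * F z.1) * expR (- a * F z.2)).
  by apply/funext => z; rewrite -expRD; congr expR; ring.
rewrite E e in h.
have h1 := Ex_exp_ge integ_fmax (integ_exp_fmax a).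
have h2 := Ex_exp_ge integ_fmax (integ_exp_fmax (- a)).
have E0 c : 0 <= Ex P (fun w => expR (c * F w)) by apply: Ex_ge0 => w; exact: expR_ge0.
split; rewrite expRD -ler_pdivrMr ?expR_gt0// -expRN.
  by apply: le_trans h; rewrite -mulNr ler_wpM2l.
by apply: le_trans h; rewrite opprK mulrC ler_wpM2r.
Qed.

Lemma fmax_concentration u : 0 < L2 -> 0 <= u ->
  (P [set w | (Ex P F + u <= F w)%R] <= (expR (- (u ^+ 2 / (8 * L2))))%:E)%E /\
  (P [set w | (F w <= Ex P F - u)%R] <= (expR (- (u ^+ 2 / (8 * L2))))%:E)%E.
Proof.
(* The minimiser of [2 * a^2 * L2 - a * u], with value [- u^2 / (8 * L2)]. *)
move=> L0 u0; pose a := u / (4 * L2).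
have a0 : 0 <= a by rewrite divr_ge0// mulr_ge0// ltW.
have [h1 h2] := Ex_exp_fmax_centered a0.
have [a00|a_neq0] := eqVneq a 0.
  have -> : u = 0.
    by move/eqP: a00; rewrite mulf_eq0 invr_eq0 mulf_eq0 pnatr_eq0/= (gt_eqF L0) orbF => /eqP.
  have mF := integ_meas integ_fmax.
  by rewrite expr0n/= mul0r oppr0 expR0; split; apply: probability_le1;
    apply: measurable_le_set.
have agt0 : 0 < a by rewrite lt_neqAle eq_sym a_neq0.
have aE : 2 * a ^+ 2 * L2 - a * u = - (u ^+ 2 / (8 * L2)).
  by rewrite /a; field; rewrite gt_eqF.
split.
  have := Ex_markov (integ_exp_fmax a) (fun w => expR_ge0 _) (expR_gt0 (a * (Ex P F + u))).
  rewrite (_ : [set x | _] = [set w | (Ex P F + u <= F w)%R]); last first.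
    by apply/seteqP; split => w /=; rewrite ler_expR ler_pM2l.
  move/le_trans; apply; rewrite lee_fin ler_pdivrMr ?expR_gt0// -expRD.
  by rewrite (le_trans h1)// ler_expR -aE; lra.
have := Ex_markov (integ_exp_fmax (- a)) (fun w => expR_ge0 _) (expR_gt0 (- a * (Ex P F - u))).
rewrite (_ : [set x | _] = [set w | (F w <= Ex P F - u)%R]); last first.
  by apply/seteqP; split => w /=; rewrite ler_expR !mulNr lerN2 ler_pM2l.
move/le_trans; apply; rewrite lee_fin ler_pdivrMr ?expR_gt0// -expRD.
by rewrite (le_trans h2)// ler_expR -aE; lra.
Qed.

End Concentration.

(** * Signed increments over index intervals *)

Section PositivePart.
Context (R : realType).
Implicit Types x y : R.

Definition pos x : R := Num.max x 0.

Lemma pos_ge0 x : 0 <= pos x. Proof. by rewrite le_max lexx orbT. Qed.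
Lemma le_pos x : x <= pos x. Proof. by rewrite le_max lexx. Qed.
Lemma pos_le x y : x <= y -> 0 <= y -> pos x <= y.
Proof. by move=> xy y0; rewrite ge_max xy. Qed.
Lemma pos_le0 x : x <= 0 -> pos x = 0.
Proof. exact: max_idPr. Qed.

End PositivePart.

Section Partitions.
Context (R : realType).

(* An interval of grid indices with the sign of the increment it is meant for. *)
Definition sitv : Type := ((nat * nat) * bool)%type.
Implicit Types (x : sitv) (th : seq sitv) (f v : nat -> R).

(** Intervals may be empty, as happens when indices are halved, and start no earlier than [a], as in
    the tail of a partition. *)
Definition weak_partition (a G : nat) th :=
  all (fun x => (a <= x.1.1)%N && (x.1.1 <= x.1.2 <= G)%N) th &&
  pairwise (fun x y => (x.1.2 <= y.1.1)%N) th.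

Definition index_partition (G : nat) th :=
  all (fun x => (x.1.1 < x.1.2 <= G)%N) th &&
  pairwise (fun x y => (x.1.2 <= y.1.1)%N) th.

Lemma partition_weak G th : index_partition G th -> weak_partition 0 G th.
Proof.
move=> /andP[h1 h2]; rewrite /weak_partition h2 andbT.
by apply: sub_all h1 => x /andP[xx ->]; rewrite leq0n andbT ltnW.
Qed.

Lemma partition_filter G th (p : pred sitv) : index_partition G th ->
  index_partition G [seq x <- th | p x].
Proof.
move=> /andP[h1 h2]; apply/andP; split; last exact: pairwise_filter.
by apply/allP => x; rewrite mem_filter => /andP[_]; apply: (allP h1).
Qed.

Lemma partition_take G th n : index_partition G th -> index_partition G (take n th).
Proof.
rewrite -{1}(cat_take_drop n th) /index_partition all_cat pairwise_cat.
by move=> /andP[/andP[-> _] /and3P[_ -> _]].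
Qed.

Lemma partition_cons G x th : index_partition G (x :: th) ->
  [/\ (x.1.1 < x.1.2 <= G)%N, index_partition G th & weak_partition x.1.2 G th].
Proof.
rewrite /index_partition /weak_partition /= => /andP[/andP[h1 h2] /andP[h3 h4]].
rewrite h1 h2 h4; split => //; rewrite andbT.
apply/allP => y yth; rewrite (allP h3 _ yth)/=.
by have /andP[/ltnW -> ->] := allP h2 _ yth.
Qed.

Lemma sum_partition_le v a G th :
  (forall i j, (a <= i)%N -> (i <= j)%N -> (j <= G)%N -> v i <= v j) ->
  (a <= G)%N -> weak_partition a G th ->
  \sum_(x <- th) (v x.1.2 - v x.1.1) <= v G - v a.
Proof.
elim: th a => [|x th IH] a mv aG; first by rewrite big_nil subr_ge0 mv.
rewrite /weak_partition/= => /andP[/andP[/andP[ax /andP[xx xG]] h2] /andP[h3 h4]].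
rewrite big_cons; have ax2 : (a <= x.1.2)%N by exact: leq_trans ax xx.
have := IH x.1.2 _ xG; have mv' i j : (x.1.2 <= i)%N -> (i <= j)%N -> (j <= G)%N -> v i <= v j.
  by move=> xi; apply: mv; exact: leq_trans xi.
have wp : weak_partition x.1.2 G th.
  rewrite /weak_partition h4 andbT; apply/allP => y yth.
  by rewrite (allP h3 _ yth); have /andP[_ ->] := allP h2 _ yth.
move=> /(_ mv' wp) h; have := mv _ _ (leqnn a) ax (leq_trans xx xG).
by move=> ?; lra.
Qed.

Definition incr f x := f x.1.2 - f x.1.1.
(** The sign belongs to the interval and not to the path, so that the gain is affine in [f];
    maximising over signs restores the absolute values. *)
Definition osc f x := (-1) ^+ x.2 * incr f x.
Definition gain f (c : R) th := \sum_(x <- th) (osc f x - c).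

Lemma osc_le_norm f x : osc f x <= `|incr f x|.
Proof. by rewrite (le_trans (ler_norm _))// normrM normrX normrN1 expr1n mul1r. Qed.

Lemma gain_le_pos f c th : gain f c th <= \sum_(x <- th) pos (`|incr f x| - c).
Proof.
apply: ler_sum => x _; apply: (le_trans _ (le_pos _)).
by rewrite lerD2r osc_le_norm.
Qed.

Lemma gain_filter f c th : gain f c th <= gain f c [seq x <- th | c < osc f x].
Proof.
rewrite /gain big_filter [leRHS]big_mkcond/=; apply: ler_sum => x _.
by case: ltP => //; rewrite subr_le0.
Qed.

Lemma gainE f c th : gain f c th = \sum_(x <- th) osc f x - c * (size th)%:R.
Proof. by rewrite /gain sumrB big_const_seq count_predT iter_addr_0 -[c *+ _]mulr_natr. Qed.

(* Of the increments above [c] keep any [K]: each exceeds [c / 2] by [c / 2]. *)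
Lemma gain_half f c G K th : 0 <= c -> index_partition G th ->
  (forall th', index_partition G th' -> (size th' <= K)%N -> gain f c th' < gain f c th) ->
  exists th', [/\ index_partition G th', (size th' <= K)%N & K%:R * (c / 2) <= gain f (c / 2) th'].
Proof.
move=> c0 pth hK; set th1 := [seq x <- th | c < osc f x].
have p1 : index_partition G th1 by exact: partition_filter.
(* Dropping the signed increments at most [c] does not lower the gain, so [th1] still beats every
   family of at most [K] intervals. *)
have s1 : (K < size th1)%N.
  by rewrite ltnNge; apply/negP => /(hK _ p1); rewrite ltNge gain_filter.
exists (take K th1); split; first exact: partition_take.
  by rewrite size_take s1.
have sK : size (take K th1) = K by rewrite size_take s1.
rewrite -{1}sK -sum1_size natr_sum mulr_suml /gain.
rewrite big_seq_cond [leRHS]big_seq_cond; apply: ler_sum => x.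
rewrite andbT => /mem_take; rewrite mem_filter => /andP[cx _].
by rewrite mul1r; lra.
Qed.

(** Intervals are disjoint and nonempty, so an index is the left end of at most one of them; in
    terms of the prefix sums [v] this is [sum_partition_le]. *)
Lemma sum_partition_left (e : nat -> R) G th : (forall k, 0 <= e k) -> index_partition G th ->
  \sum_(x <- th) e x.1.1 <= \sum_(0 <= k < G.+1) e k.
Proof.
move=> e0 pth; pose v k := \sum_(0 <= i < k) e i.
have mv i j : (0 <= i)%N -> (i <= j)%N -> (j <= G)%N -> v i <= v j.
  by move=> _ ij _; rewrite /v (big_cat_nat (leq0n _) ij)//= lerDl sumr_ge0.
apply: (@le_trans _ _ (v G - v 0%N)); last first.
  by rewrite /v big_nil subr0 big_nat_recr//= lerDl.
apply: le_trans (sum_partition_le mv (leq0n _) (partition_weak pth)).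
rewrite big_seq_cond [leRHS]big_seq_cond; apply: ler_sum => x; rewrite andbT => xth.
have /andP[/allP/(_ _ xth)/andP[xx _] _] := pth.
rewrite /v (big_cat_nat (leq0n _) (ltnW xx))//= addrAC subrr add0r.
by rewrite big_ltn// lerDl sumr_ge0.
Qed.

Lemma sum_partition_right (e : nat -> R) G th : (forall k, 0 <= e k) -> index_partition G th ->
  \sum_(x <- th) e x.1.2 <= \sum_(0 <= k < G.+1) e k.
Proof.
(* Here the prefix sums include their last index, since the right end is the one counted. *)
move=> e0 pth; pose v k := \sum_(0 <= i < k.+1) e i.
have mv i j : (0 <= i)%N -> (i <= j)%N -> (j <= G)%N -> v i <= v j.
  by move=> _ ij _; rewrite /v (@big_cat_nat _ _ _ i.+1 0%N j.+1)//= lerDl sumr_ge0.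
apply: (@le_trans _ _ (v G - v 0%N)); last first.
  by rewrite gerBl /v sumr_ge0.
apply: le_trans (sum_partition_le mv (leq0n _) (partition_weak pth)).
rewrite big_seq_cond [leRHS]big_seq_cond; apply: ler_sum => x; rewrite andbT => xth.
have /andP[/allP/(_ _ xth)/andP[xx _] _] := pth.
rewrite /v (@big_cat_nat _ _ _ x.1.1.+1 0%N x.1.2.+1)//=; last by rewrite ltnS ltnW.
rewrite addrAC subrr add0r big_nat_recr//= lerDr sumr_ge0//.
Qed.

End Partitions.

(** * Pathwise chaining by rounding to coarser grids *)

Section Chaining.
Context (R : realType) (M : nat) (f : nat -> nat -> R) (a : nat -> R).
Hypothesis fS : forall N k, f N.+1 k.*2 = f N k.
Hypothesis a0 : forall j, 0 <= a j.

Definition chain_threshold (N : nat) : R := 2 * \sum_(0 <= j < N) a j.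

(** The variation on the coarsest grid plus, level by level, the excesses at the new points, which
    are those of odd index; the factor 2 stands for the two ends of an interval. *)
Definition chain_bound (N : nat) : R :=
  \sum_(0 <= k < M) `|f 0 k.+1 - f 0 k| +
  \sum_(0 <= j < N) (2 * \sum_(0 <= k < M * 2 ^ j)
    pos (`|f j.+1 k.*2.+1 - f j.+1 k.*2| - a j)).

Lemma sum_nat_double (e : nat -> R) G : (forall k, e k.*2 = 0) ->
  \sum_(0 <= k < (G.*2).+1) e k = \sum_(0 <= k < G) e k.*2.+1.
Proof.
move=> e0; elim: G => [|G IH]; first by rewrite double0 big_nat1 big_nil -(e0 0%N).
rewrite doubleS big_nat_recr//= big_nat_recr//= IH [RHS]big_nat_recr//=.
by rewrite -doubleS e0 addr0.
Qed.

Lemma chain_threshold_ge0 N : 0 <= chain_threshold N.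
Proof. by rewrite mulr_ge0// sumr_ge0. Qed.

Lemma sum_pos_strict (g : nat -> R) c a' G th : 0 <= c -> weak_partition a' G th ->
  exists th', index_partition G th' /\
    \sum_(x <- th) pos (`|incr g x| - c) = \sum_(x <- th') pos (`|incr g x| - c).
Proof.
move=> c0 /andP[h1 h2]; exists [seq x <- th | (x.1.1 < x.1.2)%N]; split.
  apply/andP; split; last exact: pairwise_filter.
  apply/allP => x; rewrite mem_filter => /andP[-> xth].
  by have /andP[_ /andP[_ ->]] := allP h1 _ xth.
rewrite big_filter [RHS]big_mkcond/= big_seq_cond [RHS]big_seq_cond.
apply: eq_bigr => x; rewrite andbT => xth; case: ltnP => // x21.
have /andP[_ /andP[x12 _]] := allP h1 _ xth.
rewrite /incr (_ : x.1.2 = x.1.1); last by apply/eqP; rewrite eqn_leq x21.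
by rewrite subrr normr0 pos_le0// sub0r oppr_le0.
Qed.

(** Both ends of each interval are rounded down to the coarser grid. Each end may change the value
    by [a N] for free, whence [2 * a N] in the threshold, and pays for the excess. An index serves
    at most once as a left end and once as a right end, and even indices do not move. At level 0 the
    variation of the coarsest grid remains. *)
Lemma sum_pos_chain N th : weak_partition 0 (M * 2 ^ N) th ->
  \sum_(x <- th) pos (`|incr (f N) x| - chain_threshold N) <= chain_bound N.
Proof.
elim: N th => [|N IH] th wth.
  rewrite /chain_bound big_nil addr0 expn0 muln1 in wth *.
  pose v k := \sum_(0 <= i < k) `|f 0 i.+1 - f 0 i|.
  have mv i j : (0 <= i)%N -> (i <= j)%N -> (j <= M)%N -> v i <= v j.
    by move=> _ ij _; rewrite /v (big_cat_nat (leq0n _) ij)//= lerDl sumr_ge0.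
  rewrite -[leRHS]subr0 -[X in _ - X](_ : v 0%N = 0); last by rewrite /v big_nil.
  apply: le_trans (sum_partition_le mv (leq0n _) wth).
  have /andP[/allP h1 _] := wth.
  rewrite big_seq_cond [leRHS]big_seq_cond; apply: ler_sum => x; rewrite andbT.
  move=> /h1 /andP[_ /andP[x12 xM]]; apply: pos_le; last by rewrite subr_ge0 mv.
  rewrite /chain_threshold big_nil mulr0 subr0 /v.
  rewrite (big_cat_nat (leq0n _) x12)//= addrAC subrr add0r.
  rewrite /incr -(telescope_sumr (f 0) x12); exact: ler_norm_sum.
have [th1 [pth1 ->]] := sum_pos_strict (f N.+1) (chain_threshold_ge0 N.+1) wth.
pose e k := pos (`|f N.+1 k - f N k./2| - a N).
have e0 k : 0 <= e k by exact: pos_ge0.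
pose th2 : seq sitv := [seq ((x.1.1./2, x.1.2./2), x.2) | x <- th1].
have wth2 : weak_partition 0 (M * 2 ^ N) th2.
  move: pth1 => /andP[h1 h2]; apply/andP; split.
    rewrite all_map; apply: sub_all h1 => x /andP[x12 xG] /=.
    rewrite half_leq ?(ltnW x12)//= -(doubleK (M * 2 ^ N)%N) half_leq//.
    by rewrite -mul2n mulnCA -expnS.
  by rewrite pairwise_map; apply: sub_pairwise h2 => x y /= xy; exact: half_leq.
have step x : pos (`|incr (f N.+1) x| - chain_threshold N.+1) <=
    pos (`|incr (f N) ((x.1.1./2, x.1.2./2), x.2)| - chain_threshold N) +
    (e x.1.1 + e x.1.2).
  have thE : chain_threshold N.+1 = chain_threshold N + 2 * a N.
    by rewrite /chain_threshold big_nat_recr//= mulrDr.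
  apply: pos_le; last by rewrite !addr_ge0 ?pos_ge0.
  set A := incr _ _; set B := incr _ _.
  have AB : `|A| <= `|B| + `|f N.+1 x.1.1 - f N x.1.1./2| + `|f N.+1 x.1.2 - f N x.1.2./2|.
    have -> : A = B - (f N.+1 x.1.1 - f N x.1.1./2) + (f N.+1 x.1.2 - f N x.1.2./2).
      by rewrite /A /B /incr/=; ring.
    by rewrite (le_trans (ler_normD _ _))// lerD2r ler_normB.
  have h1 := le_pos (`|B| - chain_threshold N).
  have h2 := le_pos (`|f N.+1 x.1.1 - f N x.1.1./2| - a N).
  have h3 := le_pos (`|f N.+1 x.1.2 - f N x.1.2./2| - a N).
  by rewrite thE /e; lra.
apply: (@le_trans _ _ (\sum_(x <- th1)
    (pos (`|incr (f N) ((x.1.1./2, x.1.2./2), x.2)| - chain_threshold N) +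
    (e x.1.1 + e x.1.2)))); first exact: ler_sum.
rewrite big_split/= big_split/=.
have := IH _ wth2; rewrite big_map => hIH.
have hl := sum_partition_left e0 pth1; have hr := sum_partition_right e0 pth1.
have eS : \sum_(0 <= k < (M * 2 ^ N.+1).+1) e k =
    \sum_(0 <= k < M * 2 ^ N) pos (`|f N.+1 k.*2.+1 - f N.+1 k.*2| - a N).
  rewrite expnS mulnCA mul2n sum_nat_double.
    apply: eq_bigr => k _; rewrite /e; have -> : k.*2.+1./2 = k by exact: (half_bit_double k true).
    by rewrite fS.
  by move=> k; rewrite /e doubleK fS subrr normr0 pos_le0// sub0r oppr_le0.
rewrite eS in hl hr.
rewrite /chain_bound in hIH *; rewrite [X in _ <= _ + X]big_nat_recr//=.
by rewrite [leRHS]addrA; lra.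
Qed.

End Chaining.

(** * Increments of fractional Brownian motion *)

Section PowRConcave.
Context (R : realType) (p : R).
Hypothesis p01 : 0 < p < 1.
Implicit Types x y h : R.

Let p0 : 0 < p. Proof. by case/andP: p01. Qed.
Let p1 : p < 1. Proof. by case/andP: p01. Qed.

Lemma powRB1E y : 0 < y -> y `^ (p - 1) = y `^ p / y.
Proof.
by move=> y0; rewrite -(mulr_powRB1 (ltW y0) p0) mulrAC divff ?mul1r// gt_eqF.
Qed.

Lemma powR_tangent_le x y : 0 <= x -> 0 < y ->
  x `^ p <= y `^ p + p * y `^ (p - 1) * (x - y).
Proof.
move=> x0 y0; rewrite powRB1E//.
move: x0; rewrite le_eqVlt => /predU1P[<-|x0].
  rewrite powR0 ?gt_eqF// sub0r mulrN -mulrA divfK ?gt_eqF//.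
  by rewrite subr_ge0 ler_piMl ?powR_ge0// ltW.
have h : (x / y) `^ p <= 1 - p + p * (x / y).
  have xy : 0 < x / y by rewrite divr_gt0.
  rewrite -{2}(lnK xy) /powR gt_eqF//.
  by apply: expR_convex1; rewrite !ltW.
have yp : 0 < y `^ p by rewrite powR_gt0.
have -> : x `^ p = (x / y) `^ p * y `^ p.
  by rewrite -powRM ?divfK ?gt_eqF ?divr_ge0 ?ltW.
have := ler_wpM2r (ltW yp) h; move/le_trans; apply.
by rewrite le_eqVlt; apply/orP; left; apply/eqP; field; rewrite gt_eqF.
Qed.

Lemma powR_slope_anti x y : 0 < x -> x <= y -> y `^ (p - 1) <= x `^ (p - 1).
Proof.
move=> x0 xy; have y0 := lt_le_trans x0 xy.
rewrite -[p - 1]opprB !powRN lef_pV2 ?posrE ?powR_gt0//.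
by apply: ge0_ler_powR => //; rewrite ?nnegrE ?subr_ge0 ltW.
Qed.

(** Concavity through tangents. If [x, x + h] and [y, y + h] do not overlap, the tangents at [x + h]
    and [y] separate them; otherwise the common part cancels and [x, y] is compared with
    [x + h, y + h]. *)
Lemma powR_incr_anti x y h : 0 <= x -> x <= y -> 0 <= h ->
  (y + h) `^ p - y `^ p <= (x + h) `^ p - x `^ p.
Proof.
move=> x0 xy h0.
have [->|x_neq_y] := eqVneq x y; first by [].
have y0 : 0 < y by rewrite (le_lt_trans x0)// lt_neqAle x_neq_y.
have [->|h_neq0] := eqVneq h 0; first by rewrite !addr0 !subrr.
have hp : 0 < h by rewrite lt_neqAle eq_sym h_neq0.
have xh : 0 < x + h by rewrite ltr_wpDl.
have [le1|/ltW le1] := leP (x + h) y.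
- have h1 := powR_tangent_le x0 xh.
  have h2 := powR_tangent_le (addr_ge0 (ltW y0) h0) y0.
  have h3 : p * y `^ (p - 1) * h <= p * (x + h) `^ (p - 1) * h.
    by rewrite ler_pM2r// ler_pM2l// powR_slope_anti.
  rewrite (_ : x - (x + h) = - h) in h1; last by ring.
  rewrite (_ : y + h - y = h) in h2; last by ring.
  rewrite mulrN in h1; move: h1 h2 h3.
  set A := x `^ p; set B := y `^ p; set C := _ `^ p; set D := _ `^ p.
  by set E := _ * h; set F := _ * h => ? ? ?; lra.
- have h1 := powR_tangent_le x0 y0.
  have h2 := powR_tangent_le (addr_ge0 (ltW y0) h0) xh.
  have h3 : p * (x + h) `^ (p - 1) * (y - x) <= p * y `^ (p - 1) * (y - x).
    by rewrite ler_wpM2r ?subr_ge0// ler_pM2l// powR_slope_anti.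
  rewrite (_ : y + h - (x + h) = y - x) in h2; last by ring.
  rewrite (_ : x - y = - (y - x)) in h1; last by ring.
  rewrite mulrN in h1; move: h1 h2 h3.
  set A := x `^ p; set B := y `^ p; set C := _ `^ p; set D := _ `^ p.
  by set E := _ * (y - x); set F := _ * (y - x) => ? ? ?; lra.
Qed.

Lemma powR_le_affine x y : 0 <= x -> 0 < y -> x `^ p <= y `^ p * (1 + x / y).
Proof.
move=> x0 y0; apply: (le_trans (powR_tangent_le x0 y0)).
rewrite powRB1E//.
have yp : 0 < y `^ p by rewrite powR_gt0.
rewrite (_ : y `^ p + _ = y `^ p * (1 - p + p * (x / y))); last by field; rewrite gt_eqF.
by rewrite ler_pM2l// lerD ?gerBl ?(ltW p0)// ler_piMl ?(ltW p1)// divr_ge0// ltW.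
Qed.

End PowRConcave.

Section Variance.
Context (d : measure_display) (T : measurableType d) (R : realType).
Context (P : probability T R) (H : R) (W : R -> T -> R).
Hypothesis H01 : 0 < 2 * H < 1.
Hypothesis fbm : fractional_brownian_motion P H W.

Local Notation r x := (x `^ (2 * H)).

Let H0 : 0 < 2 * H. Proof. by case/andP: H01. Qed.

Lemma fbm_space : gaussian_space P (process_span W).
Proof.
by apply: gaussian_process_space; [exact: (fbm_gaussian fbm)|exact: (fbm_centered fbm)].
Qed.

Lemma integ_spanM f g : process_span W f -> process_span W g ->
  integ P (fun w => f w * g w).
Proof.
move=> Vf Vg; have gs := fbm_space.
apply: (@le_integ _ _ _ _ _ (fun w => f w ^+ 2 + g w ^+ 2)).
- by apply: measurable_funM; exact: (gs_meas gs).
- by apply: integD; exact: (gs_sqr gs).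
- by move=> w; rewrite normrM -[f w ^+ 2]real_normK ?num_real// -[g w ^+ 2]real_normK ?num_real//;
    have := sqr_ge0 (`|f w| - `|g w|); have := sqr_ge0 (`|f w| + `|g w|); lra.
Qed.

Lemma fbm_cov s t : 0 <= s -> 0 <= t ->
  Ex P (fun w => W s w * W t w) = 2^-1 * (r s + r t - r `|t - s|).
Proof.
move=> s0 t0; rewrite /Ex /Rintegral; have := fbm_covariance fbm s0 t0.
by rewrite unlock => ->; rewrite (ger0_norm s0) (ger0_norm t0).
Qed.

Lemma fbm_incr_cov s t s' t' : 0 <= s -> 0 <= t -> 0 <= s' -> 0 <= t' ->
  Ex P (fun w => (W t w - W s w) * (W t' w - W s' w)) =
  2^-1 * (r `|t' - s| - r `|t' - t| - r `|s' - s| + r `|s' - t|).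
Proof.
move=> s0 t0 s0' t0'.
have V u : 0 <= u -> process_span W (W u) by exact: process_span1.
have -> : (fun w => (W t w - W s w) * (W t' w - W s' w)) =
    (fun w => (W t w * W t' w - W t w * W s' w) - (W s w * W t' w - W s w * W s' w)).
  by apply/funext => w; ring.
have I u v : 0 <= u -> 0 <= v -> integ P (fun w => W u w * W v w).
  by move=> u0 v0; apply: integ_spanM; exact: V.
rewrite ExB; [|by apply: integB; exact: I|by apply: integB; exact: I].
rewrite ExB; [|exact: I|exact: I].
rewrite ExB; [|exact: I|exact: I].
rewrite !fbm_cov//.
by set a := _ `^ _; set b := _ `^ _; set c := _ `^ _; set e := _ `^ _;
  set f := _ `^ _; set g := _ `^ _; set h := _ `^ _; set k := _ `^ _; lra.
Qed.

Lemma fbm_incr_var s t : 0 <= s <= t -> Ex P (fun w => (W t w - W s w) ^+ 2) = r (t - s).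
Proof.
move=> /andP[s0 st]; have t0 := le_trans s0 st.
under eq_fun do rewrite expr2.
rewrite fbm_incr_cov// !subrr normr0 powR0 ?gt_eqF// [`|s - t|]distrC !ger0_norm ?subr_ge0//.
by set a := _ `^ _; lra.
Qed.

Let phi s t x := 2^-1 * (r (x - s) - r (x - t)).

(** The sign of the covariance comes from the concavity of [x ^ (2 * H)]; its absolute value is the
    decrease of the single function [phi s t] over the later interval. *)
Lemma norm_fbm_incr_cov s t s' t' : 0 <= s -> s <= t -> t <= s' -> s' <= t' ->
  `|Ex P (fun w => (W t w - W s w) * (W t' w - W s' w))| = phi s t s' - phi s t t'.
Proof.
move=> s0 st ts' st'.
have t0 := le_trans s0 st; have s0' := le_trans t0 ts'; have t0' := le_trans s0' st'.
rewrite fbm_incr_cov//.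
rewrite [`|t' - s|]ger0_norm; last by lra.
rewrite [`|t' - t|]ger0_norm; last by lra.
rewrite [`|s' - s|]ger0_norm; last by lra.
rewrite [`|s' - t|]ger0_norm; last by lra.
have := @powR_incr_anti R _ H01 (s' - t) (t' - t) (t - s).
rewrite !subr_ge0 lerD2r => /(_ ts' st' st).
rewrite !subrKA /phi.
set a := (t' - s) `^ _; set b := (t' - t) `^ _; set c := (s' - s) `^ _.
by set e := (s' - t) `^ _ => h; rewrite ler0_norm; lra.
Qed.

Variable p : nat -> R.
Hypothesis p0 : 0 <= p 0%N.
Hypothesis pmono : forall i j, (i <= j)%N -> p i <= p j.

Let pge0 i : 0 <= p i. Proof. exact: le_trans p0 (pmono _). Qed.

Definition sgain (th : seq sitv) (w : T) := \sum_(x <- th) osc (fun k => W (p k) w) x.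

Lemma span_osc x : process_span W (fun w => osc (fun k => W (p k) w) x).
Proof.
have := @process_span_lin _ _ _ W ((-1) ^+ x.2) (- (-1) ^+ x.2) _ _
  (process_span1 W (pge0 x.1.2)) (process_span1 W (pge0 x.1.1)).
by congr process_span; apply/funext => w; rewrite /osc /incr; ring.
Qed.

Lemma span_sgain th : process_span W (sgain th).
Proof.
elim: th => [|x th IH].
  have := @process_span_lin _ _ _ W 0 0 _ _
    (process_span1 W (lexx 0)) (process_span1 W (lexx 0)).
  by congr process_span; apply/funext => w; rewrite /sgain big_nil !mul0r addr0.
have := @process_span_lin _ _ _ W 1 1 _ _ (span_osc x) IH.
by congr process_span; apply/funext => w; rewrite /sgain big_cons !mul1r.
Qed.

(* Increments over disjoint intervals are negatively correlated, so the absolute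
   covariances of one increment with later ones telescope. *)
Lemma var_sgain_le G th : index_partition G th ->
  Ex P (fun w => sgain th w ^+ 2) <= 2 * \sum_(x <- th) r (p x.1.2 - p x.1.1).
Proof.
elim: th => [|x th IH] pth.
  by rewrite big_nil mulr0 (_ : (fun w => _) = fun=> 0) ?Ex_cst//;
    apply/funext => w; rewrite /sgain big_nil expr0n.
have [/andP[x12 xG] pth' wth] := partition_cons pth.
have gs := fbm_space.
have E : (fun w => sgain (x :: th) w ^+ 2) = (fun w =>
    (osc (fun k => W (p k) w) x) ^+ 2 + (2 * (\sum_(y <- th) osc (fun k => W (p k) w) x *
      osc (fun k => W (p k) w) y) + sgain th w ^+ 2)).
  apply/funext => w; rewrite -mulr_sumr /sgain big_cons.
  set a := osc _ _; set b := \sum_(_ <- _) _; ring.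
have I y : integ P (fun w => osc (fun k => W (p k) w) x * osc (fun k => W (p k) w) y).
  by apply: integ_spanM; exact: span_osc.
rewrite E ExD; [|exact: (gs_sqr gs (span_osc _))|]; last first.
  apply: integD; last exact: (gs_sqr gs (span_sgain _)).
  by apply: integZ; exact: integ_sum.
rewrite ExD; [|by apply: integZ; exact: integ_sum|exact: (gs_sqr gs (span_sgain _))].
rewrite ExZ ?Ex_sum//; last exact: integ_sum.
have v1 : Ex P (fun w => osc (fun k => W (p k) w) x ^+ 2) = r (p x.1.2 - p x.1.1).
  rewrite -fbm_incr_var ?pge0 ?pmono ?(ltnW x12)//; congr (Ex P); apply/funext => w.
  by rewrite /osc exprMn sqrr_sign mul1r.
have v2 : \sum_(y <- th) Ex P (fun w => osc (fun k => W (p k) w) x * osc (fun k => W (p k) w) y)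
    <= 2^-1 * r (p x.1.2 - p x.1.1).
  pose v k := - phi (p x.1.1) (p x.1.2) (p k).
  have cov y : (x.1.2 <= y.1.1)%N -> (y.1.1 <= y.1.2)%N ->
      `|Ex P (fun w => incr (fun k => W (p k) w) x * incr (fun k => W (p k) w) y)| =
      v y.1.2 - v y.1.1.
    move=> xy y12; rewrite norm_fbm_incr_cov ?pge0 ?pmono ?(ltnW x12)//.
    by rewrite /v; ring.
  have mv i j : (x.1.2 <= i)%N -> (i <= j)%N -> (j <= G)%N -> v i <= v j.
    move=> xi ij _; have := cov ((i, j), true) xi ij => /= h.
    by rewrite -subr_ge0 -h.
  apply: (@le_trans _ _ (v G - v x.1.2)); last first.
    rewrite /v /phi subrr powR0 ?gt_eqF// subr0 opprK gerDr oppr_le0.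
    rewrite mulr_ge0 ?invr_ge0// subr_ge0.
    have x1G : (x.1.1 <= G)%N by rewrite (leq_trans (ltnW x12)).
    by apply: ge0_ler_powR; rewrite ?nnegrE ?subr_ge0 ?(ltW H0) ?pmono// lerB// pmono// ltnW.
  apply: le_trans (sum_partition_le mv xG wth).
  have /andP[/allP hth _] := wth.
  rewrite big_seq_cond [leRHS]big_seq_cond; apply: ler_sum => y; rewrite andbT.
  move=> /hth /andP[xy /andP[y12 _]]; rewrite -cov//.
  rewrite (_ : (fun w => _) = (fun w => ((-1) ^+ x.2 * (-1) ^+ y.2) *
      (incr (fun k => W (p k) w) x * incr (fun k => W (p k) w) y))); last first.
    by apply/funext => w; rewrite /osc; ring.
  rewrite ExZ; last first.
    apply: (@integ_spanM (fun w => incr (fun k => W (p k) w) x)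
      (fun w => incr (fun k => W (p k) w) y)).
    - by have := span_osc (x.1, false); rewrite /osc/= /incr/=; under eq_fun do rewrite mul1r.
    - by have := span_osc (y.1, false); rewrite /osc/= /incr/=; under eq_fun do rewrite mul1r.
  by rewrite (le_trans (ler_norm _))// !normrM !normrX !normrN1 !expr1n !mul1r.
rewrite big_cons v1; have := IH pth'; lra.
Qed.

(** Jensen's inequality for a concave power, through an affine upper bound taken at the length
    [S / K]. Fewer intervals and gaps between them are then allowed, at the price of a factor 2. *)
Lemma sum_powR_le G (K : nat) th : (0 < K)%N -> 0 < p G - p 0%N ->
  index_partition G th -> (size th <= K)%N ->
  \sum_(x <- th) r (p x.1.2 - p x.1.1) <= 2 * K%:R * r ((p G - p 0%N) / K%:R).
Proof.
move=> K0 pG pth sK; set S := p G - p 0%N.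
have KR : 0 < (K%:R : R) by rewrite ltr0n.
have SK : 0 < S / K%:R by rewrite divr_gt0.
set c := r (S / K%:R); have c0 : 0 <= c by exact: powR_ge0.
apply: (@le_trans _ _ (\sum_(x <- th) (c + c / (S / K%:R) * (p x.1.2 - p x.1.1)))).
  have /andP[/allP hth _] := pth.
  rewrite big_seq_cond [leRHS]big_seq_cond; apply: ler_sum => y; rewrite andbT.
  move=> /hth /andP[/ltnW y12 _].
  have := @powR_le_affine R _ H01 (p y.1.2 - p y.1.1) (S / K%:R).
  rewrite subr_ge0 pmono// => /(_ isT SK); rewrite mulrDr mulr1.
  by rewrite mulrAC mulrA.
rewrite big_split/= -mulr_sumr big_const_seq count_predT iter_addr_0.
have h := sum_partition_le (fun i j _ ij _ => pmono ij) (leq0n _) (partition_weak pth).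
have cS : c / (S / K%:R) * S = K%:R * c by field; rewrite !gt_eqF.
rewrite (_ : 2 * K%:R * c = K%:R * c + K%:R * c); last by ring.
apply: lerD.
  by rewrite -[c *+ _]mulr_natl ler_wpM2r// ler_nat.
by rewrite -cS ler_wpM2l// divr_ge0// ltW.
Qed.

End Variance.

(** * Chaining over dyadic levels *)

Section L2Bounds.
Context (d : measure_display) (T : measurableType d) (R : realType).
Context (P : probability T R).
Implicit Types (X Y : T -> R) (s t : R).

(** The L2 norm of [X] is at most [s], stated without forming the norm; Cauchy-Schwarz and the
    triangle inequality follow in this form. *)
Definition L2le X s := [/\ measurable_fun setT X, integ P (fun w => X w ^+ 2),
  0 <= s & Ex P (fun w => X w ^+ 2) <= s ^+ 2].

Lemma L2le_integM X Y s t : L2le X s -> L2le Y t -> integ P (fun w => X w * Y w).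
Proof.
move=> [mX iX _ _] [mY iY _ _].
apply: (@le_integ _ _ _ _ _ (fun w => X w ^+ 2 + Y w ^+ 2)).
- exact: measurable_funM.
- exact: integD.
- by move=> w; rewrite normrM -[X w ^+ 2]real_normK ?num_real// -[Y w ^+ 2]real_normK ?num_real//;
    have := sqr_ge0 (`|X w| - `|Y w|); have := sqr_ge0 (`|X w| + `|Y w|); lra.
Qed.

Lemma L2le_ExM X Y s t : L2le X s -> L2le Y t -> Ex P (fun w => X w * Y w) <= s * t.
Proof.
move=> hX hY; have iXY := L2le_integM hX hY.
move: hX hY => [mX iX s0 eX] [mY iY t0 eY].
(* The best weight is [t / s]; when [s] or [t] vanishes it degenerates, and [zero] lets the weight
   vary instead. *)
have young e : 0 < e -> 2 * Ex P (fun w => X w * Y w) <= e * s ^+ 2 + e^-1 * t ^+ 2.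
  move=> e0; apply: (@le_trans _ _ (e * Ex P (fun w => X w ^+ 2) + e^-1 * Ex P (fun w => Y w ^+ 2))).
    rewrite -!ExZ// -ExD; [|exact: integZ|exact: integZ].
    apply: le_Ex; [exact: integZ|by apply: integD; exact: integZ|move=> w].
    rewrite -subr_ge0 (_ : _ - _ = e^-1 * (e * X w - Y w) ^+ 2).
      by rewrite mulr_ge0 ?sqr_ge0// invr_ge0 ltW.
    by field; rewrite gt_eqF.
  by apply: lerD; rewrite ler_pM2l ?invr_gt0.
have zero (v x : R) : 0 <= v -> (forall e, 0 < e -> 2 * x <= e * v ^+ 2) -> x <= 0.
  move=> v0 h; rewrite leNgt; apply/negP => x0.
  have v1 : 0 < v ^+ 2 + 1 by rewrite ltr_wpDl// sqr_ge0.
  have := h (x / (v ^+ 2 + 1)) (divr_gt0 x0 v1).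
  apply/negP; rewrite -ltNge mulrAC ltr_pdivrMr//.
  by have := sqr_ge0 v; nra.
have [s00|s_neq0] := eqVneq s 0.
  rewrite s00 mul0r; apply: (zero t) => // e e0.
  by have := young e^-1; rewrite invr_gt0 invrK s00 expr0n/= mulr0 add0r; apply.
have [t00|t_neq0] := eqVneq t 0.
  rewrite t00 mulr0; apply: (zero s) => // e e0.
  by have := young e e0; rewrite t00 expr0n/= mulr0 addr0.
have sp : 0 < s by rewrite lt_neqAle eq_sym s_neq0.
have tp : 0 < t by rewrite lt_neqAle eq_sym t_neq0.
have h := young (t / s) (divr_gt0 tp sp).
have e : t / s * s ^+ 2 + (t / s)^-1 * t ^+ 2 = 2 * (s * t) by field; rewrite !gt_eqF.
by move: h; rewrite e ler_pM2l.
Qed.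

Lemma L2leD X Y s t : L2le X s -> L2le Y t -> L2le (fun w => X w + Y w) (s + t).
Proof.
move=> hX hY; have iXY := L2le_integM hX hY; have eXY := L2le_ExM hX hY.
move: hX hY => [mX iX s0 eX] [mY iY t0 eY].
have E : (fun w => (X w + Y w) ^+ 2) = (fun w => X w ^+ 2 + Y w ^+ 2 + 2 * (X w * Y w)).
  by apply/funext => w; ring.
have i1 : integ P (fun w => X w ^+ 2 + Y w ^+ 2) by exact: integD.
have i2 : integ P (fun w => 2 * (X w * Y w)) by exact: integZ.
split; [exact: measurable_funD|by rewrite E; exact: integD|exact: addr_ge0|].
rewrite E ExD// ExD// ExZ//.
by rewrite (_ : (s + t) ^+ 2 = s ^+ 2 + t ^+ 2 + 2 * (s * t)); [lra|ring].
Qed.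

Lemma L2le_cst0 : L2le (fun=> 0) 0.
Proof. by split => //; rewrite expr0n/= ?Ex_cst//; exact: integ_cst. Qed.

Lemma L2leZ X s a : 0 <= a -> L2le X s -> L2le (fun w => a * X w) (a * s).
Proof.
move=> a0 [mX iX s0 eX].
have E : (fun w => (a * X w) ^+ 2) = (fun w => a ^+ 2 * X w ^+ 2).
  by apply/funext => w; rewrite exprMn.
split; [exact: measurable_funM|by rewrite E; exact: integZ|exact: mulr_ge0|].
by rewrite E ExZ// exprMn ler_wpM2l ?sqr_ge0.
Qed.

Lemma L2le_sum (X_ : nat -> T -> R) (s_ : nat -> R) n : (forall i, (i < n)%N -> L2le (X_ i) (s_ i)) ->
  L2le (fun w => \sum_(0 <= i < n) X_ i w) (\sum_(0 <= i < n) s_ i).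
Proof.
elim: n => [|n IH] h.
  by rewrite big_nil; under eq_fun do rewrite big_nil; exact: L2le_cst0.
rewrite big_nat_recr//=; under eq_fun do rewrite big_nat_recr//=.
by apply: L2leD; [apply: IH => i im; apply: h; exact: ltnW|exact: h].
Qed.

Lemma L2le_weaken X s t : s <= t -> L2le X s -> L2le X t.
Proof.
move=> st [mX iX s0 eX]; split => //; first exact: le_trans st.
by rewrite (le_trans eX)// lerXn2r// nnegrE (le_trans s0).
Qed.

(** [pos y <= s * exp (y / s)] turns the threshold into the factor [exp (- a / s)]. The square then
    calls for the exponential moments at [2 / s] and [- 2 / s], which are at most [exp 2] whatever
    [s]. *)
Lemma L2le_pos_gaussian (V : set (T -> R)) X s a : gaussian_space P V -> V X ->
  0 < s -> Ex P (fun w => X w ^+ 2) <= s ^+ 2 ->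
  L2le (fun w => pos (`|X w| - a)) (2 * expR 1 * s * expR (- (a / s))).
Proof.
move=> gs VX s0 eX.
have VcX c : V (fun w => c * X w).
  by have := gs_lin gs c 0 VX VX; under eq_fun do rewrite mul0r addr0.
have mX := gs_meas gs VX.
pose K := s ^+ 2 * expR (- (2 * a / s)).
have K0 : 0 <= K by rewrite mulr_ge0 ?sqr_ge0 ?expR_ge0.
have bnd w : pos (`|X w| - a) ^+ 2 <= K * (expR (2 / s * X w) + expR (- (2 / s) * X w)).
  apply: (@le_trans _ _ (K * expR (2 / s * `|X w|))); last first.
    by rewrite ler_wpM2l// expR_norm_le2.
  have h : pos (`|X w| - a) <= s * expR ((`|X w| - a) / s).
    apply: pos_le; last by rewrite mulr_ge0 ?expR_ge0// ltW.
    rewrite -ler_pdivrMl// mulrC; have := expR_ge1Dx ((`|X w| - a) / s); lra.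
  rewrite (_ : K * _ = (s * expR ((`|X w| - a) / s)) ^+ 2).
    by rewrite lerXn2r ?nnegrE ?pos_ge0// mulr_ge0 ?expR_ge0// ltW.
  rewrite /K exprMn -mulrA -expRD -expRM_natl; congr (_ * expR _).
  by field; rewrite gt_eqF.
have mpos : measurable_fun setT (fun w => pos (`|X w| - a)).
  by apply: measurable_maxr => //; apply: measurable_funB => //; exact: measurableT_comp.
have i1 c := gs_exp gs (VcX c).
have i2 : integ P (fun w => K * (expR (2 / s * X w) + expR (- (2 / s) * X w))).
  by apply: integZ; apply: integD.
have i3 : integ P (fun w => pos (`|X w| - a) ^+ 2).
  apply: (le_integ _ i2); first exact: measurable_funX.
  by move=> w; rewrite ger0_norm ?sqr_ge0.
split => //; first by rewrite !mulr_ge0 ?expR_ge0// ltW.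
apply: (le_trans (le_Ex i3 i2 bnd)); rewrite ExZ ?ExD//; last exact: integD.
have mgf c : c ^+ 2 = 4 / s ^+ 2 -> Ex P (fun w => expR (c * X w)) <= expR 1 ^+ 2.
  move=> c2; rewrite (gs_mgf gs (VcX c)) -expRM_natl mulr1 ler_expR ler_pdivrMr//.
  under eq_fun do rewrite exprMn; rewrite ExZ ?(gs_sqr gs VX)// c2.
  rewrite mulrAC ler_pdivrMr ?exprn_gt0//.
  have -> : 2 * 2 = 4 :> R by ring.
  by rewrite ler_pM2l.
have m1 := mgf (2 / s); have m2 := mgf (- (2 / s)).
have e1 : (2 / s) ^+ 2 = 4 / s ^+ 2 by field; rewrite gt_eqF.
rewrite sqrrN e1 in m2; rewrite e1 in m1.
apply: (@le_trans _ _ (K * (expR 1 ^+ 2 + expR 1 ^+ 2))).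
  by rewrite ler_wpM2l// lerD ?m1 ?m2.
rewrite (_ : (2 * expR 1 * s * expR (- (a / s))) ^+ 2 = K * (4 * expR 1 ^+ 2)).
  by rewrite ler_wpM2l//; have := sqr_ge0 (expR 1 : R); lra.
rewrite /K (_ : - (2 * a / s) = - (a / s) + - (a / s)); last by field; rewrite gt_eqF.
by rewrite expRD; ring.
Qed.

End L2Bounds.

(** * Constants of the chaining *)

Section ChainConstants.
Context (R : realType) (H : R).
Hypothesis H0 : 0 < H.

(* [rho = 2 ^ (- H / 2)] : increments at dyadic level [j] have standard deviation
   at most [c * rho ^ (2 j)] and are compared with the threshold [kappa * c * rho ^ j]. *)
Definition chain_ratio : R := expR (- (H * ln 2 / 2)).
Local Notation rho := chain_ratio.
(** Chosen so that the thresholds of all levels, counted twice for the two ends, add up to at most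
    [c / 2]. *)
Definition chain_scale : R := (1 - rho) / 4.
Local Notation kappa := chain_scale.
(** More than [4 / H], so that [rho ^ (- n * m)] is at least [4 ^ n]. *)
Definition chain_order : nat := Num.bound (4 / H).
Local Notation m := chain_order.
Definition chain_tail : R := (m%:R / kappa) ^+ m.
Definition chain_const : R := 1 + 2 * expR 1 * chain_tail.

Let ln2 : 0 < ln 2 :> R. Proof. by rewrite ln_gt0// ltr1n. Qed.

Lemma chain_ratio_gt0 : 0 < rho. Proof. exact: expR_gt0. Qed.

Lemma chain_ratio_lt1 : rho < 1.
Proof. by rewrite expR_lt1 oppr_lt0 divr_gt0// mulr_gt0. Qed.

Lemma chain_scale_gt0 : 0 < kappa.
Proof. by rewrite divr_gt0// subr_gt0 chain_ratio_lt1. Qed.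

Lemma chain_order_gt : 4 / H < m%:R.
Proof. by apply: archi_boundP; rewrite divr_ge0// ltW. Qed.

Lemma chain_order_gt0 : 0 < (m%:R : R).
Proof. by apply: (lt_trans _ chain_order_gt); rewrite divr_gt0. Qed.

Lemma chain_tail_gt0 : 0 < chain_tail.
Proof. by rewrite exprn_gt0// divr_gt0 ?chain_order_gt0 ?chain_scale_gt0. Qed.

Lemma chain_const_ge1 : 1 <= chain_const.
Proof. by rewrite lerDl !mulr_ge0 ?expR_ge0// ltW// chain_tail_gt0. Qed.

Lemma powR_exp2 n : (2 ^+ n)^-1 `^ H = (rho ^+ n) ^+ 2.
Proof.
have p2 : 0 < (2 ^+ n)^-1 :> R by rewrite invr_gt0 exprn_gt0.
rewrite /powR gt_eqF// lnV ?posrE ?exprn_gt0// lnXn// -!expRM_natl.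
by congr expR; rewrite -mulr_natl; field.
Qed.

Lemma sum_geometric_le (x : R) n : 0 <= x -> x < 1 ->
  \sum_(0 <= j < n) x ^+ j <= (1 - x)^-1.
Proof.
move=> x0 x1; have x10 : 0 < 1 - x by rewrite subr_gt0.
rewrite -[leRHS]mul1r ler_pdivlMr// mulrC.
have -> : (1 - x) * (\sum_(0 <= j < n) x ^+ j) = 1 - x ^+ n.
  elim: n => [|n IH]; first by rewrite big_nil mulr0 expr0 subrr.
  by rewrite big_nat_recr//= mulrDr IH exprS; ring.
by rewrite gerBl exprn_ge0.
Qed.

Lemma chain_scale_sum n : 2 * \sum_(0 <= j < n) (kappa * rho ^+ j.+1) <= 2^-1.
Proof.
have r0 := chain_ratio_gt0; have r1 := chain_ratio_lt1.
have k0 := chain_scale_gt0.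
rewrite -mulr_sumr (_ : \sum_(0 <= j < n) rho ^+ j.+1 = rho * \sum_(0 <= j < n) rho ^+ j); last first.
  by rewrite mulr_sumr; apply: eq_bigr => j _; rewrite exprS.
have := sum_geometric_le n (ltW r0) r1; set g := \sum_(_ <= _ < _) _ => h.
rewrite (@le_trans _ _ (2 * (kappa * (1 * (1 - rho)^-1))))//.
  rewrite ler_pM2l// ler_pM2l// ler_pM ?(ltW r0) ?(ltW r1)//.
  by rewrite sumr_ge0// => j _; rewrite exprn_ge0// ltW.
by rewrite /kappa le_eqVlt; apply/orP; left; apply/eqP; field; rewrite gt_eqF ?subr_gt0.
Qed.

(** From [(x / m) ^ m <= exp x] at [x = kappa / rho ^ n]. The decay [4 ^ (- n)] is meant to beat the
    number of points at a level, of order [2 ^ n]. *)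
Lemma chain_tail_le n : expR (- (kappa / rho ^+ n)) <= chain_tail * (4 ^+ n)^-1.
Proof.
have r0 := chain_ratio_gt0; have k0 := chain_scale_gt0.
have m0 := chain_order_gt0.
have rn : 0 < rho ^+ n by rewrite exprn_gt0.
have mH : 4 < m%:R * H by rewrite -ltr_pdivrMr// chain_order_gt.
set x := kappa / rho ^+ n; have x0 : 0 < x by rewrite divr_gt0.
have h1 : (x / m%:R) ^+ m <= expR x.
  rewrite (_ : expR x = expR (x / m%:R) ^+ m); last first.
    by rewrite -expRM_natl mulrC divfK// gt_eqF.
  have xm : 0 <= x / m%:R by exact: divr_ge0 (ltW x0) (ltW m0).
  rewrite lerXn2r ?nnegrE ?expR_ge0//.
  by have := expR_ge1Dx (x / m%:R); lra.
have h2 : 4 ^+ n <= ((rho ^+ n)^-1) ^+ m.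
  rewrite -exprVn -exprM mulnC exprM lerXn2r ?nnegrE ?exprn_ge0 ?invr_ge0 ?(ltW r0)//.
  rewrite /rho -expRN opprK -expRM_natl (_ : 4 = expR (2 * ln 2)); last first.
    by rewrite expRM_natl lnK ?posrE//; ring.
  rewrite ler_expR (_ : m%:R * (H * ln 2 / 2) = (m%:R * H / 2) * ln 2); last by field.
  by rewrite ler_pM2r// ler_pdivlMr//; lra.
rewrite expRN -[leLHS]mul1r ler_pdivrMr ?expR_gt0//.
apply: (@le_trans _ _ (chain_tail * (4 ^+ n)^-1 * (x / m%:R) ^+ m)); last first.
  apply: ler_wpM2l => //.
  by apply: divr_ge0; [exact: ltW chain_tail_gt0|exact: exprn_ge0].
rewrite /chain_tail mulrAC -exprMn.
rewrite (_ : m%:R / kappa * (x / m%:R) = (rho ^+ n)^-1); last first.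
  by rewrite /x; field; rewrite !gt_eqF.
by rewrite ler_pdivlMr ?exprn_gt0// mul1r.
Qed.

End ChainConstants.

(** * Second moment of the gain, uniformly in the mesh *)

Section GridMoment.
Context (d : measure_display) (T : measurableType d) (R : realType).
Context (P : probability T R) (H : R) (W : R -> T -> R).
Hypothesis H0 : 0 < H.
Hypothesis H01 : 0 < 2 * H < 1.
Hypothesis fbm : fractional_brownian_motion P H W.
Context (M : nat) (S c : R).
Hypothesis M0 : (0 < M)%N.
Hypothesis S0 : 0 < S.
Hypothesis c0 : 0 < c.
Hypothesis Sc : (S / M%:R) `^ H <= c.

Local Notation rho := (chain_ratio H).
Local Notation kappa := (chain_scale H).

Definition grid (N k : nat) : R := S * k%:R / (M * 2 ^ N)%:R.

Let MR N : 0 < ((M * 2 ^ N)%:R : R).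
Proof. by rewrite ltr0n muln_gt0 M0 expn_gt0. Qed.

Lemma grid0 N : grid N 0 = 0. Proof. by rewrite /grid mulr0 mul0r. Qed.

Lemma grid_end N : grid N (M * 2 ^ N) = S.
Proof. by rewrite /grid mulfK// gt_eqF. Qed.

Lemma grid_mono N i j : (i <= j)%N -> grid N i <= grid N j.
Proof. by move=> ij; rewrite /grid ler_pM2r ?invr_gt0// ler_pM2l// ler_nat. Qed.

Lemma grid_ge0 N k : 0 <= grid N k.
Proof. by rewrite -(grid0 N) grid_mono. Qed.

Lemma grid_double N k : grid N.+1 k.*2 = grid N k.
Proof.
rewrite /grid expnS mulnCA -!mul2n !natrM natrX; field.
by rewrite !gt_eqF ?exprn_gt0 ?ltr0n.
Qed.

Lemma grid_step N k : grid N k.+1 - grid N k = S / M%:R / 2 ^+ N.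
Proof.
rewrite /grid -natr1 natrM natrX; field.
by rewrite !gt_eqF ?exprn_gt0 ?ltr0n.
Qed.

Definition grid_path (w : T) (N k : nat) : R := W (grid N k) w.
Definition threshold (j : nat) : R := kappa * c * rho ^+ j.+1.
Definition grid_bound (N : nat) (w : T) : R := chain_bound M (grid_path w) threshold N.

Lemma threshold_ge0 j : 0 <= threshold j.
Proof.
apply: mulr_ge0; last exact: exprn_ge0 (ltW (chain_ratio_gt0 H)).
exact: mulr_ge0 (ltW (chain_scale_gt0 H0)) (ltW c0).
Qed.

(** The chaining threshold stays below [c / 2] at all levels. The right-hand side does not depend on
    [th], so it bounds the maximum over families of any size. *)
Lemma gain_le_grid_bound N th w : index_partition (M * 2 ^ N) th ->
  gain (grid_path w N) (c / 2) th <= grid_bound N w.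
Proof.
move=> pth; have fS N' k : grid_path w N'.+1 k.*2 = grid_path w N' k by rewrite /grid_path grid_double.
have := sum_pos_chain fS threshold_ge0 (partition_weak pth).
apply: le_trans; apply: (le_trans (gain_le_pos _ _ _)); apply: ler_sum => x _.
apply: pos_le; last exact: pos_ge0.
apply: (le_trans _ (le_pos _)); rewrite lerD2l lerN2 /chain_threshold.
rewrite (eq_bigr (fun j => c * (kappa * rho ^+ j.+1))); last first.
  by move=> j _; rewrite /threshold; ring.
rewrite -mulr_sumr mulrCA ler_pM2l//.
exact: chain_scale_sum.
Qed.

Lemma incr_var_le N k : Ex P (fun w => (grid_path w N k.+1 - grid_path w N k) ^+ 2) <=
  (c * (rho ^+ N) ^+ 2) ^+ 2.
Proof.
rewrite /grid_path (fbm_incr_var H01 fbm) ?grid_ge0 ?grid_mono// grid_step.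
have SM : 0 <= S / M%:R by rewrite divr_ge0// ltW.
rewrite powRM ?invr_ge0 ?exprn_ge0//.
have e (x : R) : 0 <= x -> x `^ (2 * H) = (x `^ H) ^+ 2.
  by move=> x0; rewrite mulrC powRrM powR_mulrn ?powR_ge0.
rewrite !e ?invr_ge0 ?exprn_ge0// powR_exp2 -exprMn.
have y0 : 0 <= (rho ^+ N) ^+ 2 by exact: sqr_ge0.
have h := ler_wpM2r y0 Sc.
have h0 := mulr_ge0 (powR_ge0 (S / M%:R) H) y0.
by rewrite lerXn2r ?nnegrE// (le_trans h0).
Qed.

Lemma span_step N k : process_span W (fun w => grid_path w N k.+1 - grid_path w N k).
Proof.
have := @process_span_lin _ _ _ W 1 (-1) _ _
  (process_span1 W (grid_ge0 N k.+1)) (process_span1 W (grid_ge0 N k)).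
by congr process_span; apply/funext => w; rewrite /grid_path mul1r mulN1r.
Qed.

Lemma L2le_grid_bound N : L2le P (grid_bound N) (M%:R * c * chain_const H).
Proof.
have gs := fbm_space fbm.
have r0 := chain_ratio_gt0 H.
(* Level [j] has [M * 2 ^ j] excesses, each with tail [4 ^ (- j - 1)]; the geometric sum makes the
   bound uniform in [N]. *)
pose s j := M%:R * c * (expR 1 * chain_tail H) * (2^-1) ^+ j.
have base : L2le P (fun w => \sum_(0 <= k < M) `|grid_path w 0 k.+1 - grid_path w 0 k|) (M%:R * c).
  have -> : M%:R * c = \sum_(0 <= k < M) c by rewrite sumr_const_nat subn0 mulr_natl.
  apply: L2le_sum => k _.
  have E : (fun w => `|grid_path w 0 k.+1 - grid_path w 0 k| ^+ 2) =
      (fun w => (grid_path w 0 k.+1 - grid_path w 0 k) ^+ 2).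
    by apply/funext => w; rewrite real_normK// num_real.
  split; rewrite ?E.
  - by apply: measurableT_comp => //; exact: (gs_meas gs (span_step 0 k)).
  - exact: (gs_sqr gs (span_step 0 k)).
  - exact: ltW.
  - by have := incr_var_le 0 k; rewrite expr0 expr1n mulr1.
have level j : L2le P (fun w => 2 * \sum_(0 <= k < M * 2 ^ j)
    pos (`|grid_path w j.+1 k.*2.+1 - grid_path w j.+1 k.*2| - threshold j)) (s j).
  pose sg := c * (rho ^+ j.+1) ^+ 2.
  have sg0 : 0 < sg by rewrite mulr_gt0 ?exprn_gt0.
  have one k : L2le P (fun w => pos (`|grid_path w j.+1 k.*2.+1 - grid_path w j.+1 k.*2| - threshold j))
      (2 * expR 1 * sg * expR (- (threshold j / sg))).
    exact: (L2le_pos_gaussian (threshold j) gs (span_step j.+1 k.*2) sg0 (incr_var_le j.+1 k.*2)).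
  have := L2leZ (ler0n R 2) (L2le_sum (n := (M * 2 ^ j)%N) (fun k _ => one k)).
  apply: L2le_weaken; rewrite sumr_const_nat subn0 -[_ *+ (M * 2 ^ j)]mulr_natl.
  have -> : threshold j / sg = kappa / rho ^+ j.+1.
    by rewrite /threshold /sg; field; rewrite !gt_eqF// exprn_gt0.
  have sgc : sg <= c.
    rewrite /sg ler_piMr ?(ltW c0)// exprn_ile1 ?exprn_ge0 ?(ltW r0)//.
    by rewrite exprn_ile1 ?(ltW r0) ?(ltW (chain_ratio_lt1 H0)).
  have e1 : 0 <= 2 * expR 1 :> R by rewrite mulr_ge0 ?expR_ge0.
  rewrite (@le_trans _ _ (2 * ((M * 2 ^ j)%:R * (2 * expR 1 * c * (chain_tail H * (4 ^+ j.+1)^-1)))))//.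
    rewrite ler_pM2l// ler_pM2l// ler_pM ?expR_ge0 ?chain_tail_le//.
      exact: mulr_ge0 e1 (ltW sg0).
    by rewrite ler_wpM2l.
  rewrite /s natrM natrX exprS.
  have -> : (4 : R) ^+ j = 2 ^+ j * 2 ^+ j by rewrite -exprMn; congr (_ ^+ _); ring.
  rewrite le_eqVlt; apply/orP; left; apply/eqP; rewrite exprVn; field.
  by rewrite gt_eqF// exprn_gt0.
rewrite /grid_bound /chain_bound.
apply: (L2le_weaken _ (L2leD base (L2le_sum (n := N) (fun j _ => level j)))).
rewrite /s -mulr_sumr /chain_const -mulrA -[leRHS]mulrA mulrDr mulr1 -[X in _ + X <= _]mulrA.
have h : \sum_(0 <= j < N) (2^-1 : R) ^+ j <= 2.
  apply: (le_trans (sum_geometric_le N _ _)); [by []|by lra|].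
  by rewrite (_ : (1 - 2^-1)^-1 = 2) //; field.
set g := \sum_(_ <= _ < _) _ in h *.
have K0 : 0 <= M%:R * (c * (expR 1 * chain_tail H)).
  by rewrite !mulr_ge0 ?expR_ge0 ?(ltW c0)// ltW// chain_tail_gt0.
have := ler_wpM2l K0 h.
by rewrite !mulrDr !mulr1 !mulrA => h'; rewrite lerD2l (le_trans h')// le_eqVlt; apply/orP; left; apply/eqP; ring.
Qed.

End GridMoment.

(** * Truncated variation on a grid *)

Section Enumeration.
Implicit Types (A : seq sitv) (th : seq sitv).

Fixpoint seqs_upto A (K : nat) : seq (seq sitv) :=
  if K is K'.+1 then [::] :: [seq x :: th | x <- A, th <- seqs_upto A K'] else [:: [::]].

Lemma mem_seqs_upto A K th : (th \in seqs_upto A K) = (size th <= K)%N && all (mem A) th.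
Proof.
elim: K th => [|K IH] [|x th] //=.
rewrite inE/=; apply/allpairsP/idP => [[[y t] /= [yA tK [-> ->]]]|].
  by move: tK; rewrite IH yA ltnS => /andP[-> ->].
rewrite ltnS => /and3P[sK xA aA]; exists (x, th); split => //.
by rewrite IH sK.
Qed.

Definition sitvs (G : nat) : seq sitv :=
  [seq (kl, b) | kl <- [seq (k, l) | k <- iota 0 G.+1, l <- iota 0 G.+1], b <- [:: true; false]].

Lemma mem_sitvs G (x : sitv) : (x.1.1 <= G)%N -> (x.1.2 <= G)%N -> x \in sitvs G.
Proof.
move: x => [[k l] b] kG lG; apply: (allpairs_f (fun kl b => (kl, b))).
  by apply: (allpairs_f (fun k l => (k, l))); rewrite mem_iota.
by case: b {kG lG}.
Qed.

Definition partitions (G K : nat) := [seq th <- seqs_upto (sitvs G) K | index_partition G th].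

Lemma mem_partitions G K th : (th \in partitions G K) = index_partition G th && (size th <= K)%N.
Proof.
rewrite mem_filter mem_seqs_upto; case: (boolP (index_partition G th)) => //= /andP[/allP h _].
rewrite (_ : all _ th) ?andbT//; apply/allP => x /h /andP[x12 xG].
by apply: mem_sitvs => //; exact: leq_trans (ltnW x12) xG.
Qed.

End Enumeration.

Section MaxGain.
Context (R : realType).
Implicit Types (f : nat -> R) (c : R).

(** An explicit list of partitions makes this an [fmax] of affine functionals. The list contains the
    empty partition, so the predecessor of its size is its last index. *)
Definition maxgain f c (G K : nat) : R :=
  fmax (size (partitions G K)).-1 (fun i => gain f c (nth [::] (partitions G K) i)).

Lemma le_maxgain f c G K th : index_partition G th -> (size th <= K)%N ->
  gain f c th <= maxgain f c G K.
Proof.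
move=> pth sK; have tp : th \in partitions G K by rewrite mem_partitions pth.
rewrite -(nth_index [::] tp).
apply: (le_fmax (fun i => gain f c (nth [::] (partitions G K) i))).
rewrite -ltnS prednK ?index_mem//.
by rewrite (leq_ltn_trans _ (_ : index th (partitions G K) < _)%N)// index_mem.
Qed.

(** Past the end of the list the default is the empty partition. All [i] are covered because the
    concentration result asks for its variance bound at every index. *)
Lemma partition_nth G K i : index_partition G (nth [::] (partitions G K) i) /\
  (size (nth [::] (partitions G K) i) <= K)%N.
Proof.
have [iS|iS] := ltnP i (size (partitions G K)).
  by have := mem_nth [::] iS; rewrite mem_partitions => /andP[].
by rewrite nth_default.
Qed.

Lemma maxgainP f c G K : exists th, [/\ index_partition G th, (size th <= K)%N &
  maxgain f c G K = gain f c th].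
Proof.
have [i _ e] := fmaxP (size (partitions G K)).-1
  (fun i => gain f c (nth [::] (partitions G K) i)).
by have [h1 h2] := partition_nth G K i; exists (nth [::] (partitions G K) i).
Qed.

Lemma maxgain_ge0 f c G K : 0 <= maxgain f c G K.
Proof. by have := @le_maxgain f c G K [::]; rewrite /gain big_nil; apply. Qed.

Lemma maxgain_anti_c f c c' G K : c <= c' -> maxgain f c' G K <= maxgain f c G K.
Proof.
move=> cc; have [th [pth sth ->]] := maxgainP f c' G K.
apply: (le_trans _ (le_maxgain _ _ pth sth)).
by apply: ler_sum => x _; rewrite lerD2l lerN2.
Qed.

(** Each interval has length at least 1. Hence [maxgain] with [K = G] is the unrestricted
    maximum. *)
Lemma size_partition G th : index_partition G th -> (size th <= G)%N.
Proof.
move=> pth; rewrite -(ler_nat R).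
have mono i j : (0 <= i)%N -> (i <= j)%N -> (j <= G)%N -> (i%:R : R) <= j%:R.
  by move=> _ ij _; rewrite ler_nat.
have := sum_partition_le mono (leq0n _) (partition_weak pth); rewrite subr0.
apply: le_trans; rewrite -sum1_size natr_sum.
rewrite big_seq_cond [leRHS]big_seq_cond; apply: ler_sum => x; rewrite andbT => xth.
have /andP[/allP/(_ _ xth)/andP[x12 _] _] := pth.
by rewrite -natrB ?(ltnW x12)// ler_nat subn_gt0.
Qed.

Lemma maxgain_half f c G K K' : 0 <= c -> maxgain f c G K < maxgain f c G K' ->
  K%:R * (c / 2) <= maxgain f (c / 2) G K.
Proof.
move=> c0; have [th [pth _ ->]] := maxgainP f c G K' => lt.
have [th' [pth' sth' h]] : exists th', [/\ index_partition G th', (size th' <= K)%N &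
    K%:R * (c / 2) <= gain f (c / 2) th'].
  apply: (gain_half c0 pth) => th1 pth1 sth1.
  exact: le_lt_trans (le_maxgain f c pth1 sth1) lt.
exact: le_trans h (le_maxgain _ _ pth' sth').
Qed.

End MaxGain.

(** * Concentration of the gain on a grid *)

Section GridConcentration.
Context (d : measure_display) (T : measurableType d) (R : realType).
Context (P : probability T R) (H : R) (W : R -> T -> R).
Hypothesis H0 : 0 < H.
Hypothesis H01 : 0 < 2 * H < 1.
Hypothesis fbm : fractional_brownian_motion P H W.
Context (M : nat) (S c : R).
Hypothesis M0 : (0 < M)%N.
Hypothesis S0 : 0 < S.
Hypothesis c0 : 0 < c.
Hypothesis Sc : (S / M%:R) `^ H <= c.
Context (N : nat).

Local Notation G := (M * 2 ^ N)%N.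
Local Notation D := (chain_const H).

Definition grid_gain (a : R) (K : nat) (w : T) : R := maxgain (grid_path W M S w N) a G K.

Let MR : 0 < (M%:R : R). Proof. by rewrite ltr0n. Qed.

Lemma grid_gainE a K : grid_gain a K = (fun w => fmax (size (partitions G K)).-1
  (fun i => sgain W (grid M S N) (nth [::] (partitions G K) i) w -
     a * (size (nth [::] (partitions G K) i))%:R)).
Proof.
by apply/funext => w; rewrite /grid_gain /maxgain; congr fmax; apply/funext => i; rewrite gainE.
Qed.

Lemma integ_grid_gain a K : integ P (grid_gain a K).
Proof.
rewrite grid_gainE; apply: (integ_fmax (fbm_space fbm)) => i.
by apply: span_sgain; [rewrite grid0|move=> *; exact: grid_mono].
Qed.

Lemma measurable_grid_gain a K : measurable_fun setT (grid_gain a K).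
Proof. exact: integ_meas (integ_grid_gain a K). Qed.

Lemma grid_gain_concentration a (k : nat) u : (0 < k)%N -> 0 <= u ->
  let F := grid_gain a (k * M) in
  let e := expR (- (u ^+ 2 / (32 * M%:R * c ^+ 2 * k%:R `^ (1 - 2 * H)))) in
  (P [set w | (Ex P F + u <= F w)%R] <= e%:E)%E /\
  (P [set w | (F w <= Ex P F - u)%R] <= e%:E)%E.
Proof.
move=> k0 u0 F e.
have kR : 0 < (k%:R : R) by rewrite ltr0n.
(* With [k * M] intervals the variance is at most [4 * (k * M) * (S / (k * M)) ^ (2 * H)], and
   [(S / M) ^ H <= c] bounds this by [L2]. *)
pose L2 := 4 * M%:R * c ^+ 2 * k%:R `^ (1 - 2 * H).
have L20 : 0 < L2 by rewrite !mulr_gt0 ?exprn_gt0 ?powR_gt0.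
have h0 : 0 <= grid M S N 0 by rewrite grid0.
have hm i j : (i <= j)%N -> grid M S N i <= grid M S N j by exact: grid_mono.
have var i : Ex P (fun w => sgain W (grid M S N) (nth [::] (partitions G (k * M)) i) w ^+ 2) <= L2.
  have [pi si] := partition_nth G (k * M) i.
  apply: (le_trans (var_sgain_le H01 fbm h0 hm pi)).
  have kM0 : (0 < k * M)%N by rewrite muln_gt0 k0.
  have := sum_powR_le H01 hm kM0 _ pi si; rewrite grid0 grid_end// subr0 => /(_ S0) h.
  rewrite (@le_trans _ _ (2 * (2 * (k * M)%:R * (S / (k * M)%:R) `^ (2 * H))))//.
    by rewrite ler_pM2l.
  have -> : S / (k * M)%:R = S / M%:R / k%:R.
    by rewrite natrM; field; rewrite !gt_eqF.
  rewrite powRM ?invr_ge0 ?divr_ge0 ?(ltW S0)//.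
  have -> : (k%:R : R)^-1 `^ (2 * H) = k%:R `^ (1 - 2 * H) / k%:R.
    rewrite /powR !gt_eqF ?invr_gt0// lnV ?posrE// -[X in _ / X]lnK ?posrE//.
    by rewrite -expRN -expRD; congr expR; ring.
  have cS : (S / M%:R) `^ (2 * H) <= c ^+ 2.
    rewrite (mulrC 2 H) powRrM powR_mulrn ?powR_ge0//.
    by rewrite lerXn2r ?nnegrE ?powR_ge0 ?(ltW c0).
  rewrite (_ : _ * _ = 4 * M%:R * k%:R `^ (1 - 2 * H) * (S / M%:R) `^ (2 * H)); last first.
    by rewrite natrM; field; rewrite gt_eqF.
  rewrite /L2 mulrAC [leRHS]mulrAC -[leRHS]mulrA -[leLHS]mulrA.
  by rewrite ler_wpM2l ?mulr_ge0 ?ler0n// mulrC ler_wpM2l ?powR_ge0.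
have e8 : 8 * L2 = 32 * M%:R * c ^+ 2 * k%:R `^ (1 - 2 * H) by rewrite /L2; ring.
rewrite /e -e8 /F grid_gainE.
exact: (fmax_concentration (fbm_space fbm) (size (partitions G (k * M))).-1
  (fun i => a * (size (nth [::] (partitions G (k * M)) i))%:R)
  (fun i => span_sgain W h0 hm _) var L20 u0).
Qed.

Local Notation F := (grid_gain c G).
Local Notation Fk k := (grid_gain c (k * M)).

Lemma L2le_grid_gain a K : c / 2 <= a -> L2le P (grid_gain a K) (M%:R * c * D).
Proof.
move=> ca; have [mU iU s0 eU] := L2le_grid_bound H0 H01 fbm M0 S0 c0 Sc N.
have FU w : grid_gain a K w <= grid_bound H W M S c N w.
  apply: (le_trans (maxgain_anti_c _ _ _ ca)).
  have [th [pth _ ->]] := maxgainP (grid_path W M S w N) (c / 2) G K.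
  exact: (gain_le_grid_bound W H0 S M0 c0).
have F2U w : grid_gain a K w ^+ 2 <= grid_bound H W M S c N w ^+ 2.
  have F0 : 0 <= grid_gain a K w by exact: maxgain_ge0.
  by rewrite lerXn2r// nnegrE (le_trans F0).
have mF := measurable_grid_gain a K.
have iF : integ P (fun w => grid_gain a K w ^+ 2).
  apply: (le_integ _ iU); first exact: measurable_funX.
  by move=> w; rewrite ger0_norm ?sqr_ge0.
by split => //; apply: (le_trans _ eU); exact: le_Ex.
Qed.

Lemma Ex_grid_gain_le a K : c / 2 <= a -> Ex P (grid_gain a K) <= M%:R * c * D.
Proof.
move=> ca; have L1 : L2le P (fun=> 1) 1.
  by split => //; rewrite expr1n ?Ex_cst//; exact: integ_cst.
have := L2le_ExM (L2le_grid_gain K ca) L1; rewrite mulr1.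
by under eq_fun do rewrite mulr1.
Qed.

Let c2 : c / 2 <= c. Proof. by rewrite ler_pdivrMr// ler_peMr ?(ltW c0)// ler1n. Qed.

Let D1 : 1 <= D. Proof. exact: chain_const_ge1 H0. Qed.

Definition short_gain_fails (k : nat) := [set w | Fk k w < F w].

Lemma measurable_short_gain_fails k : measurable (short_gain_fails k).
Proof. by apply: measurable_lt_set; exact: measurable_grid_gain. Qed.

Lemma grid_gain_le k w : Fk k w <= F w.
Proof.
rewrite /grid_gain; have [th [pth _ ->]] := maxgainP (grid_path W M S w N) c G (k * M).
by apply: le_maxgain => //; exact: (size_partition R pth).
Qed.

Lemma grid_gain_short k w : ~ short_gain_fails k w -> Fk k w = F w.
Proof.
move=> /negP; rewrite -leNgt => FFk; apply/eqP; rewrite eq_le FFk andbT.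
exact: grid_gain_le.
Qed.

Lemma P_short_gain_fails k : 4 * D <= k%:R ->
  (P (short_gain_fails k) <= (expR (- (M%:R * k%:R `^ (1 + 2 * H) / 512)))%:E)%E.
Proof.
move=> Dk; have kR : 0 < (k%:R : R) by apply: lt_le_trans Dk; rewrite mulr_gt0// (lt_le_trans ltr01).
have k0 : (0 < k)%N by rewrite -(ltr0n R).
(* The event forces a value of at least [k * M * c / 2 = 2 * u] at the threshold [c / 2], where
   [4 * D <= k] keeps the mean at most [u]. *)
pose u := k%:R * M%:R * c / 4.
have u0 : 0 <= u by rewrite !mulr_ge0 ?ler0n ?(ltW c0).
have [h _] := grid_gain_concentration (c / 2) k0 u0.
have e : expR (- (u ^+ 2 / (32 * M%:R * c ^+ 2 * k%:R `^ (1 - 2 * H)))) =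
    expR (- (M%:R * k%:R `^ (1 + 2 * H) / 512)).
  congr (expR (- _)).
  have kp : 0 < k%:R `^ (1 - 2 * H) by exact: powR_gt0.
  have -> : k%:R `^ (1 + 2 * H) = k%:R ^+ 2 / k%:R `^ (1 - 2 * H).
    rewrite -powR_mulrn ?ler0n// -powRN -powRD ?(gt_eqF kR) ?implybT//.
    by congr powR; ring.
  by rewrite /u; field; rewrite !gt_eqF.
rewrite e in h; apply: le_trans h; apply: le_measure; rewrite ?inE.
- exact: measurable_short_gain_fails.
- by apply: measurable_le_set => //; exact: measurable_grid_gain.
move=> w /= Fw; have := maxgain_half (ltW c0) Fw; apply: le_trans.
have EF : Ex P (grid_gain (c / 2) (k * M)) <= M%:R * c * D by exact: Ex_grid_gain_le.
have : M%:R * c * (4 * D) <= M%:R * c * k%:R by rewrite ler_wpM2l// mulr_ge0// ltW.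
by rewrite natrM /u => ?; lra.
Qed.

(** The two gains differ only on [short_gain_fails k], whose indicator is separated from [F] by
    Young's inequality. *)
Lemma Ex_grid_gain_diff k : 4 * D <= k%:R ->
  Ex P F - Ex P (Fk k) <= (D ^+ 2 / 2 + 256) * c * Num.sqrt M%:R.
Proof.
move=> Dk; have kR : 1 <= (k%:R : R) by apply: (le_trans _ Dk); have := D1; lra.
set s := Num.sqrt M%:R; have s0 : 0 < s by rewrite sqrtr_gt0.
have s2 : s ^+ 2 = M%:R by rewrite sqr_sqrtr// ltW.
(* The weight that balances [t * (M * c) ^ 2] against [1 / (t * M)]: as [s ^ 2 = M], both equal
   [c * s]. *)
pose t := (c * s ^+ 3)^-1.
have t0 : 0 < t by rewrite invr_gt0 mulr_gt0// exprn_gt0.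
have mE := measurable_short_gain_fails k.
have [_ iF2 _ eF2] := L2le_grid_gain G c2.
have i1 : integ P (fun w => t / 2 * F w ^+ 2) by exact: integZ.
have i2 : integ P (fun w => (2 * t)^-1 * \1_(short_gain_fails k) w).
  by apply: integZ; exact: integ_indic.
rewrite -ExB; [|exact: integ_grid_gain|exact: integ_grid_gain].
apply: (@le_trans _ _ (Ex P (fun w => t / 2 * F w ^+ 2 + (2 * t)^-1 * \1_(short_gain_fails k) w))).
  apply: le_Ex.
  - by apply: integB; exact: integ_grid_gain.
  - exact: integD.
  move=> w; rewrite indicE; case: (boolP (w \in _)) => wE /=.
    have Fk0 : 0 <= Fk k w by exact: maxgain_ge0.
    rewrite mulr1; apply: (@le_trans _ _ (F w)); first by rewrite gerBl.
    rewrite -subr_ge0 (_ : _ - _ = (t * F w - 1) ^+ 2 / (2 * t)).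
      by rewrite divr_ge0 ?sqr_ge0// mulr_ge0// ltW.
    by field; rewrite gt_eqF.
  rewrite grid_gain_short ?subrr ?mulr0 ?addr0; last by move: wE; rewrite notin_setE.
  by rewrite mulr_ge0 ?sqr_ge0// divr_ge0// ltW.
rewrite ExD// ExZ// ExZ; last exact: integ_indic.
have i512 : 0 < (512 : R)^-1 by rewrite invr_gt0 ltr0n.
(* [exp (- x) <= 1 / x] at [x = M / 512], the power of [k] being at least 1. *)
have PE : Ex P (\1_(short_gain_fails k)) <= 512 / M%:R.
  rewrite -lee_fin Ex_indic//; apply: (le_trans (P_short_gain_fails Dk)); rewrite lee_fin.
  apply: (@le_trans _ _ (expR (- (M%:R / 512)))).
    rewrite ler_expR lerN2 (ler_pM2r i512); apply: (ler_peMr (ltW MR)).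
    rewrite -[leLHS](_ : 1 `^ (1 + 2 * H) = 1); last by rewrite powR1.
    apply: ge0_ler_powR; rewrite ?nnegrE ?ler0n//.
    by rewrite addr_ge0// mulr_ge0// ltW.
  rewrite expRN -[512 / _]invf_div lef_pV2 ?posrE ?expR_gt0 ?(mulr_gt0 MR i512)//.
  by have := expR_ge1Dx (M%:R / 512 : R); lra.
apply: (@le_trans _ _ (t / 2 * (M%:R * c * D) ^+ 2 + (2 * t)^-1 * (512 / M%:R))).
  apply: lerD; rewrite ler_pM2l// ?divr_gt0// invr_gt0 mulr_gt0//.
rewrite -s2 /t le_eqVlt; apply/orP; left; apply/eqP; field.
by rewrite !gt_eqF.
Qed.

Definition mean_gap : R := D ^+ 2 / 2 + 256.

(** Half of [u] absorbs the gap between the two means; the other half is a deviation of the gain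
    over [k * M] intervals, which coincides with [F] off [short_gain_fails k]. *)
Lemma grid_gain_deviation k u : 4 * D <= k%:R ->
  2 * (mean_gap * c * Num.sqrt M%:R) <= u ->
  (P [set w | (u < `|F w - Ex P F|)%R] <=
    (2 * expR (- (u ^+ 2 / (128 * M%:R * c ^+ 2 * k%:R `^ (1 - 2 * H)))) +
     expR (- (M%:R * k%:R `^ (1 + 2 * H) / 512)))%:E)%E.
Proof.
move=> Dk ub; have kR : 0 < (k%:R : R) by apply: lt_le_trans Dk; rewrite mulr_gt0// (lt_le_trans ltr01).
have k0 : (0 < k)%N by rewrite -(ltr0n R).
have gap := Ex_grid_gain_diff Dk; rewrite -/mean_gap in gap.
have FkF : Ex P (Fk k) <= Ex P F.
  apply: le_Ex; [exact: integ_grid_gain|exact: integ_grid_gain|exact: grid_gain_le].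
have C0 : 0 < mean_gap * c * Num.sqrt M%:R.
  by rewrite !mulr_gt0 ?sqrtr_gt0// ltr_pwDr ?ltr0n// mulr_ge0 ?sqr_ge0 ?invr_ge0.
have u0 : 0 <= u / 2 by rewrite divr_ge0// (le_trans _ ub)// mulr_ge0// ltW.
have [hU hL] := grid_gain_concentration c k0 u0.
have e : (u / 2) ^+ 2 / (32 * M%:R * c ^+ 2 * k%:R `^ (1 - 2 * H)) =
    u ^+ 2 / (128 * M%:R * c ^+ 2 * k%:R `^ (1 - 2 * H)).
  have kp : 0 < k%:R `^ (1 - 2 * H) by exact: powR_gt0.
  by field; rewrite !gt_eqF.
rewrite e in hU hL.
have hB := P_short_gain_fails Dk.
set A1 := [set w | _] in hU; set A2 := [set w | _] in hL.
have m1 : measurable A1 by apply: measurable_le_set => //; exact: measurable_grid_gain.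
have m2 : measurable A2 by apply: measurable_le_set => //; exact: measurable_grid_gain.
have m3 := measurable_short_gain_fails k.
have mF := measurable_grid_gain c G.
apply: (@le_trans _ _ (P (A1 `|` A2 `|` short_gain_fails k))).
  apply: le_measure; rewrite ?inE.
  - apply: measurable_lt_set => //; apply: measurableT_comp => //.
    exact: measurable_funB.
  - by apply: measurableU => //; exact: measurableU.
  move=> w /= dev; case: (pselect (short_gain_fails k w)) => [|bad]; [by right|left].
  rewrite /A1 /A2 /= (grid_gain_short bad).
  move: dev; rewrite ltr_normr => /orP[h|h]; [left|right]; lra.
rewrite EFinD mulrDl !mul1r EFinD.
apply: (le_trans (measureU2 _ _ _)) => //; first exact: measurableU.
apply: leeD => //; apply: (le_trans (measureU2 _ _ _)) => //.
exact: leeD.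
Qed.

End GridConcentration.

(** * Choice of the number of intervals *)

Section DeviationRate.
Context (R : realType) (H : R).
Hypothesis H0 : 0 < H.
Hypothesis H01 : 0 < 2 * H < 1.

Local Notation D := (chain_const H).
Local Notation C := (mean_gap H).

Definition base_multiplicity : nat := Num.bound (4 * D).

(** The first entry keeps the exponent at most 1/2 when the deviation is comparable with the gap
    between the means. The other two serve at [k = base_multiplicity], for the Gaussian term and for
    the failure probability; the last one also gives the bound 1/512 used for larger [k]. *)
Definition deviation_rate : R :=
  Num.min (16 * C ^+ 2)^-1 (Num.min (256 * base_multiplicity%:R)^-1 (512 * (4 * D) ^+ 2)^-1).

Lemma base_multiplicity_ge : 4 * D <= base_multiplicity%:R.
Proof.
rewrite ltW// archi_boundP// mulr_ge0//.
by rewrite (le_trans ler01)// chain_const_ge1.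
Qed.

Lemma mean_gap_gt0 : 0 < C.
Proof. by rewrite ltr_pwDr ?ltr0n// mulr_ge0 ?sqr_ge0 ?invr_ge0. Qed.

Lemma deviation_rate_gt0 : 0 < deviation_rate.
Proof.
have D0 := lt_le_trans ltr01 (chain_const_ge1 H0).
have k0 : 0 < base_multiplicity%:R :> R.
  by apply: lt_le_trans base_multiplicity_ge; rewrite mulr_gt0.
have D2 : 0 < (4 * D) ^+ 2 by rewrite exprn_gt0// mulr_gt0.
have C2 : 0 < C ^+ 2 by rewrite exprn_gt0// mean_gap_gt0.
by rewrite !lt_min !invr_gt0 !(pmulr_rgt0 _ (ltr0Sn _ _)) C2 k0 D2.
Qed.

Definition rate_profile (v : R) := Num.min (v `^ (1 + 2 * H)) (v ^+ 2).

Lemma rate_profile_ge0 v : 0 <= rate_profile v.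
Proof. by rewrite le_min powR_ge0 sqr_ge0. Qed.

(* [k] is [base_multiplicity] for moderate deviations and of order [v] for large ones. *)
Lemma multiplicity_exists (n m v : R) : 0 < n -> n <= m -> m <= 2 * n -> 0 < v ->
  exists k : nat, [/\ 4 * D <= k%:R,
    deviation_rate * n * rate_profile v <= (n * v) ^+ 2 / (128 * m * k%:R `^ (1 - 2 * H)) &
    deviation_rate * n * rate_profile v <= m * k%:R `^ (1 + 2 * H) / 512].
Proof.
have /andP[H2 H21] := H01.
have D1 := chain_const_ge1 H0.
have D41 : 1 <= 4 * D by rewrite (le_trans D1)// ler_peMl ?(le_trans ler01 D1)// ler1n.
have e1 : 0 < 1 - 2 * H by rewrite subr_gt0.
have e2 : 0 <= 1 + 2 * H by rewrite addr_ge0// ltW.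
have e3 : 1 - 2 * H <= 1 by rewrite gerBl ltW.
have c256 : 0 < (256 : R) by rewrite ltr0n.
have c512 : 0 < (512 : R) by rewrite ltr0n.
have c128 : 0 < (128 : R) by rewrite ltr0n.
have i512 : 0 < (512 : R)^-1 by rewrite invr_gt0.
move=> n0 nm m2 v0; have m0 := lt_le_trans n0 nm.
have B0 := deviation_rate_gt0.
have p0 := rate_profile_ge0 v.
have D4 : 0 < 4 * D by rewrite mulr_gt0// (lt_le_trans ltr01).
have pv2 : rate_profile v <= v ^+ 2 by rewrite ge_min lexx orbT.
have pv : rate_profile v <= v `^ (1 + 2 * H) by rewrite ge_min lexx.
have B2 : deviation_rate <= (256 * base_multiplicity%:R)^-1 by rewrite !ge_min lexx !orbT.
have B3 : deviation_rate <= (512 * (4 * D) ^+ 2)^-1 by rewrite !ge_min lexx !orbT.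
have [vD|Dv] := leP v (4 * D).
  exists base_multiplicity; have Dk := base_multiplicity_ge.
  set k := base_multiplicity%:R in Dk B2 *.
  have k1' : 1 <= k  := le_trans D41 Dk.
  have kp0 : 0 < k `^ (1 - 2 * H) by rewrite powR_gt0// (lt_le_trans ltr01).
  have kp : k `^ (1 - 2 * H) <= k.
    by rewrite -[leRHS]powRr1 ?(le_trans ler01)// ler_powR.
  have kq : 1 <= k `^ (1 + 2 * H).
    by rewrite -[leLHS](powRr0 k) ler_powR.
  split => //.
    apply: (@le_trans _ _ ((256 * k)^-1 * n * v ^+ 2)).
      by apply: ler_pM => //; [rewrite mulr_ge0 ?ltW|rewrite ler_pM2r].
    have m128 : 0 < 128 * m by exact: mulr_gt0.
    have a0 : 0 < 128 * m * k `^ (1 - 2 * H) by exact: mulr_gt0.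
    rewrite ler_pdivlMr//.
    have : 128 * m * k `^ (1 - 2 * H) <= 128 * (2 * n) * k.
      apply: ler_pM kp; [exact: ltW m128|exact: ltW kp0|by rewrite (ler_pM2l c128)].
    have q0 : 0 <= (256 * k)^-1 * n * v ^+ 2.
      apply: mulr_ge0 (sqr_ge0 v); apply: mulr_ge0 (ltW n0).
      by rewrite invr_ge0 (mulr_ge0 (ltW c256) (le_trans ler01 k1')).
    move=> /(ler_wpM2l q0) /le_trans; apply.
    rewrite le_eqVlt; apply/orP; left; apply/eqP; field.
    by rewrite gt_eqF// (lt_le_trans ltr01).
  apply: (@le_trans _ _ ((512 * (4 * D) ^+ 2)^-1 * n * (4 * D) ^+ 2)).
    apply: ler_pM => //; [by rewrite mulr_ge0 ?ltW|by rewrite ler_pM2r|].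
    by apply: (le_trans pv2); rewrite lerXn2r ?nnegrE ?(ltW v0) ?(ltW D4).
  rewrite [leLHS](_ : _ = n / 512); last by field; rewrite gt_eqF// (lt_le_trans ltr01).
  by rewrite (ler_pM2r i512); apply: (le_trans nm); exact: ler_peMr (ltW m0) kq.
have v1 : 1 <= v := le_trans D41 (ltW Dv).
(* [v <= k <= 2 * v], the upper bound because [v >= 1]; so [v ^ 2 / k ^ (1 - 2 * H)] and
   [k ^ (1 + 2 * H)] are both of order [v ^ (1 + 2 * H)]. *)
exists (Num.truncn v).+1.
have kv : v <= (Num.truncn v).+1%:R by rewrite ltW// truncnS_gt.
have k2 : (Num.truncn v).+1%:R <= 2 * v.
  have : (Num.truncn v)%:R <= v by rewrite truncn_le ltW.
  by rewrite -natr1 => ?; lra.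
set k := (Num.truncn v).+1%:R in kv k2 *.
have k0 : 0 < k := lt_le_trans v0 kv.
have B512 : deviation_rate <= 512^-1.
  apply: (le_trans B3); have D2 : 1 <= (4 * D) ^+ 2 by rewrite exprn_ege1.
  rewrite lef_pV2 ?posrE ?(mulr_gt0 c512 (lt_le_trans ltr01 D2)) ?c512//.
  by rewrite (ler_peMr (ler0n _ _)).
have hv : deviation_rate * n * rate_profile v <= n * v `^ (1 + 2 * H) / 512.
  rewrite -mulrA [leRHS]mulrC; apply: ler_pM (ltW B0) _ B512 _.
    by rewrite mulr_ge0// ltW.
  by rewrite (ler_pM2l n0).
split; first by rewrite (le_trans _ kv)// ltW.
  apply: (le_trans hv).
  have kp0 : 0 < k `^ (1 - 2 * H) by rewrite powR_gt0.
  have vp0 : 0 < v `^ (1 - 2 * H) by rewrite powR_gt0.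
  have kp : k `^ (1 - 2 * H) <= 2 * v `^ (1 - 2 * H).
    apply: (@le_trans _ _ ((2 * v) `^ (1 - 2 * H))).
      by apply: (ge0_ler_powR (ltW e1)); rewrite ?nnegrE ?(ltW k0) ?mulr_ge0 ?(ltW v0).
    rewrite powRM//; last exact: ltW.
    by rewrite (ler_pM2r vp0) -[leRHS]powRr1// ler_powR// ler1n.
  have e : v `^ (1 + 2 * H) = v ^+ 2 / v `^ (1 - 2 * H).
    rewrite -powR_mulrn ?(ltW v0)// -powRN -powRD ?(gt_eqF v0) ?implybT//.
    by congr powR; ring.
  rewrite e; set q := v `^ _ in vp0 kp *; set p := k `^ _ in kp kp0 *.
  have m128 : 0 < 128 * m by exact: mulr_gt0.
  rewrite (ler_pdivlMr _ _ (mulr_gt0 m128 kp0)).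
  have q0 : 0 <= n * (v ^+ 2 / q) / 512.
    apply: mulr_ge0 (ltW i512); apply: mulr_ge0 (ltW n0) _.
    by rewrite divr_ge0 ?sqr_ge0 ?(ltW vp0).
  have : 128 * m * p <= 128 * (2 * n) * (2 * q).
    apply: ler_pM kp; [exact: ltW m128|exact: ltW kp0|by rewrite (ler_pM2l c128)].
  move=> /(ler_wpM2l q0) /le_trans; apply.
  by rewrite le_eqVlt; apply/orP; left; apply/eqP; field; rewrite gt_eqF.
apply: (le_trans hv); rewrite (ler_pM2r i512); apply: ler_pM => //; [exact: ltW|exact: powR_ge0|].
by apply: (ge0_ler_powR e2); rewrite ?nnegrE ?(ltW k0) ?(ltW v0).
Qed.

End DeviationRate.

Section GridDeviation.
Context (d : measure_display) (T : measurableType d) (R : realType).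
Context (P : probability T R) (H : R) (W : R -> T -> R).
Hypothesis H0 : 0 < H.
Hypothesis H01 : 0 < 2 * H < 1.
Hypothesis fbm : fractional_brownian_motion P H W.
Context (M : nat) (S c n v : R).
Hypothesis M0 : (0 < M)%N.
Hypothesis S0 : 0 < S.
Hypothesis c0 : 0 < c.
Hypothesis Sc : (S / M%:R) `^ H <= c.
Hypothesis n0 : 0 < n.
Hypothesis nM : n <= M%:R.
Hypothesis M2 : M%:R <= 2 * n.
Hypothesis v0 : 0 < v.

Local Notation F N := (grid_gain W M S N c (M * 2 ^ N)).

Lemma grid_deviation N :
  (P [set w | (n * c * v < `|F N w - Ex P (F N)|)%R] <=
    (36 * expR (- (deviation_rate H * n * rate_profile H v)))%:E)%E.
Proof.
set e := deviation_rate H * n * rate_profile H v.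
have C0 := mean_gap_gt0 H.
have MR := lt_le_trans n0 nM.
have s0 : 0 < Num.sqrt M%:R :> R by rewrite sqrtr_gt0.
(* Below this level the gap between the means may exceed half of the deviation. There the exponent
   is at most 1/2, and the claimed bound exceeds 1. *)
have [small|large] := ltP (n * c * v) (2 * (mean_gap H * c * Num.sqrt M%:R)).
  apply: (@le_trans _ _ 1%E).
    apply: probability_le1; apply: measurable_lt_set => //.
    apply: measurableT_comp => //; apply: measurable_funB => //.
    exact: (measurable_grid_gain fbm M0 S0).
  rewrite lee_fin.
  have B1 : deviation_rate H <= (16 * mean_gap H ^+ 2)^-1 by rewrite ge_min lexx.
  have small2 : n * v <= 2 * mean_gap H * Num.sqrt M%:R.
    by rewrite -(ler_pM2r c0); lra.
  have nv : n ^+ 2 * v ^+ 2 <= 4 * mean_gap H ^+ 2 * (2 * n).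
    apply: (@le_trans _ _ (4 * mean_gap H ^+ 2 * M%:R)).
      rewrite -exprMn -[X in _ <= _ * X]sqr_sqrtr ?ler0n// (_ : 4 * _ * _ = (2 * mean_gap H * Num.sqrt M%:R) ^+ 2).
        by rewrite lerXn2r ?nnegrE// ?mulr_ge0 ?(ltW n0) ?(ltW v0) ?(ltW C0) ?sqrtr_ge0.
      by rewrite !exprMn; ring.
    by rewrite ler_pM2l// mulr_gt0// exprn_gt0.
  have nv2 : n * v ^+ 2 <= 8 * mean_gap H ^+ 2.
    by rewrite -(ler_pM2l n0) mulrA -expr2; apply: (le_trans nv); rewrite le_eqVlt; apply/orP; left; apply/eqP; ring.
  have e2 : e <= 2^-1.
    apply: (@le_trans _ _ ((16 * mean_gap H ^+ 2)^-1 * (n * v ^+ 2))).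
      rewrite /e -mulrA; apply: ler_pM => //.
      - exact/ltW/deviation_rate_gt0.
      - by rewrite mulr_ge0 ?rate_profile_ge0// ltW.
      - by rewrite ler_pM2l// ge_min lexx orbT.
    apply: (@le_trans _ _ ((16 * mean_gap H ^+ 2)^-1 * (8 * mean_gap H ^+ 2))).
      by rewrite ler_pM2l// invr_gt0 mulr_gt0// exprn_gt0.
    by rewrite le_eqVlt; apply/orP; left; apply/eqP; field; rewrite gt_eqF.
  by have := expR_ge1Dx (- e); lra.
have [k [Dk h1 h2]] := multiplicity_exists H0 H01 n0 nM M2 v0.
apply: (le_trans (grid_gain_deviation H0 H01 fbm M0 S0 c0 Sc N Dk large)).
rewrite lee_fin.
have -> : (n * c * v) ^+ 2 / (128 * M%:R * c ^+ 2 * k%:R `^ (1 - 2 * H)) =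
    (n * v) ^+ 2 / (128 * M%:R * k%:R `^ (1 - 2 * H)).
  have kp : 0 < k%:R `^ (1 - 2 * H).
    by rewrite powR_gt0// (lt_le_trans _ Dk)// mulr_gt0// (lt_le_trans ltr01)// chain_const_ge1.
  by field; rewrite !gt_eqF.
rewrite -/e in h1 h2.
apply: (@le_trans _ _ (2 * expR (- e) + expR (- e))).
  by apply: lerD; [rewrite ler_pM2l// ler_expR lerN2|rewrite ler_expR lerN2].
by have := expR_ge0 (- e); lra.
Qed.

End GridDeviation.

(** * Vanishing mesh *)

Section GridApproximation.
Context (R : realType) (M : nat) (S c : R) (f : R -> R).
Hypothesis M0 : (0 < M)%N.
Hypothesis S0 : 0 < S.
Hypothesis c0 : 0 <= c.

Let MR N : 0 < ((M * 2 ^ N)%:R : R).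
Proof. by rewrite ltr0n muln_gt0 M0 expn_gt0. Qed.

Lemma grid_lt N i j : (i < j)%N -> grid M S N i < grid M S N j.
Proof. by move=> ij; rewrite /grid ltr_pM2r ?invr_gt0// ltr_pM2l// ltr_nat. Qed.

Local Notation Fn N K := (maxgain (fun k => f (grid M S N k)) c (M * 2 ^ N) K).

Lemma maxgain_le_truncated_variation N K :
  ((Fn N K)%:E <= truncated_variation c f 0 S)%E.
Proof.
have [th [pth _ ->]] := maxgainP (fun k => f (grid M S N k)) c (M * 2 ^ N) K.
case: th pth => [_|x s pth].
  (* The supremum runs over at least one interval, so the empty partition is matched with [0, S],
     whose term is nonnegative. *)
  rewrite /gain big_nil; apply: (@le_trans _ _ (Num.max (`|f S - f 0| - c) 0)%:E).
    by rewrite lee_fin le_max lexx orbT.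
  apply: ereal_sup_ubound; exists 0%N, (fun=> 0), (fun=> S); split => //.
  by rewrite big_ord_recl big_ord0 addr0.
set th := x :: s in pth *.
have /andP[/allP pa /(pairwiseP x) pp] := pth.
have nth_in i : (i <= size s)%N -> nth x th i \in th by move=> h; exact: mem_nth.
apply: (@le_trans _ _ (\sum_(i < (size s).+1) Num.max
    (`|f (grid M S N (nth x th i).1.2) - f (grid M S N (nth x th i).1.1)| - c) 0)%:E).
  rewrite lee_fin; apply: (le_trans (gain_le_pos _ _ _)).
  by rewrite (big_nth x) big_mkord.
apply: ereal_sup_ubound.
exists (size s), (fun i => grid M S N (nth x th i).1.1), (fun i => grid M S N (nth x th i).1.2).
split => //.
- exact: grid_ge0.
- by move=> i /nth_in /pa /andP[h _]; exact: grid_lt.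
- by move=> i ns; apply: grid_mono => //; apply: pp; rewrite ?inE ?ltnS// ltnW.
- rewrite -{2}(grid_end S M0 N); apply: grid_mono => //.
  by have /nth_in /pa /andP[_] := leqnn (size s).
Qed.

Definition grid_index (N : nat) (t : R) : nat := Num.truncn (t * (M * 2 ^ N)%:R / S).
Definition grid_floor (N : nat) (t : R) : R := grid M S N (grid_index N t).

Lemma grid_index_le N (s t : R) : s <= t -> (grid_index N s <= grid_index N t)%N.
Proof. by move=> st; rewrite le_truncn// ler_pM2r ?invr_gt0// ler_pM2r. Qed.

Lemma grid_index_end N : grid_index N S = (M * 2 ^ N)%N.
Proof. by rewrite /grid_index mulrAC mulfV ?gt_eqF// mul1r natrK. Qed.

Lemma grid_floor_dist N (t : R) : 0 <= t -> `|t - grid_floor N t| <= S / (M * 2 ^ N)%:R.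
Proof.
move=> t0; have a0 : 0 <= t * (M * 2 ^ N)%:R / S by rewrite !mulr_ge0 ?invr_ge0 ?ler0n ?(ltW S0).
have /andP[] := truncn_itv a0; rewrite -/(grid_index N t) => h1 h2.
have e : t = S * (t * (M * 2 ^ N)%:R / S) / (M * 2 ^ N)%:R.
  by rewrite [S * _]mulrC divfK ?gt_eqF// mulfK ?gt_eqF.
rewrite [X in X - _]e /grid_floor /grid -mulrBl -mulrBr normrM normrM.
have im : 0 < ((M * 2 ^ N)%:R : R)^-1 by rewrite invr_gt0.
rewrite (gtr0_norm S0) (gtr0_norm im) (ler_pM2r im).
rewrite ger0_norm ?subr_ge0// ler_piMr ?(ltW S0)//.
by rewrite lerBlDl natr1 ltW.
Qed.

(** Rounding down preserves the order of the ends but may collapse an interval. Only rounded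
    increments above [c >= 0] contribute, and their intervals are nonempty; each receives the sign
    of its increment. *)
Lemma sum_floor_le_maxgain n (l r : nat -> R) N : 0 <= l 0%N ->
  (forall i, (i <= n)%N -> l i < r i) ->
  (forall i, (i < n)%N -> r i <= l i.+1) -> r n <= S ->
  \sum_(i < n.+1) Num.max (`|f (grid_floor N (r i)) - f (grid_floor N (l i))| - c) 0 <=
  Fn N (M * 2 ^ N).
Proof.
move=> l0 lr rl rS.
have rlt i j : (i < j <= n)%N -> r i <= l j.
  elim: j => // j IH /andP[]; rewrite ltnS leq_eqVlt => /predU1P[->|ij] jn; first exact: rl.
  apply: (le_trans (IH _)); first by rewrite ij ltnW.
  by apply: (le_trans _ (rl _ jn)); exact/ltW/lr/ltnW.
have rS' i : (i <= n)%N -> r i <= S.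
  rewrite leq_eqVlt => /predU1P[->//|im].
  apply: (le_trans (rlt _ n _)); first by rewrite im leqnn.
  by apply: (le_trans _ rS); exact/ltW/lr.
pose F t := f (grid_floor N t).
pose big i := c < `|F (r i) - F (l i)|.
pose itv i : sitv := ((grid_index N (l i), grid_index N (r i)), F (r i) < F (l i)).
pose th := [seq itv i | i <- [seq i <- iota 0 n.+1 | big i]].
have pth : index_partition (M * 2 ^ N) th.
  apply/andP; split.
    apply/allP => x /mapP[i]; rewrite mem_filter mem_iota/= add0n ltnS => /andP[bi ni] -> /=.
    rewrite -[in X in _ && X](grid_index_end N) (grid_index_le _ (rS' _ ni)) andbT.
    rewrite ltn_neqAle grid_index_le ?(ltW (lr _ ni))// andbT; apply/eqP => e.
    by move: bi; rewrite /big /F /grid_floor e subrr normr0 ltNge c0.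
  rewrite pairwise_map; apply: pairwise_filter.
  have := iota_ltn_sorted 0 n.+1; rewrite sorted_pairwise//; last exact: ltn_trans.
  apply: (@sub_in_pairwise _ (fun i => (i <= n)%N)).
    by move=> i j _ jn ij; apply: grid_index_le; apply: rlt; apply/andP.
  by apply/allP => i; rewrite mem_iota/= add0n ltnS.
apply: (le_trans _ (le_maxgain _ _ pth (size_partition R pth))).
rewrite /gain big_map big_filter [leRHS]big_mkcond -(big_mkord xpredT
  (fun i => Num.max (`|F (r i) - F (l i)| - c) 0)) /index_iota subn0.
rewrite le_eqVlt; apply/orP; left; apply/eqP; apply: eq_bigr => i _.
rewrite /big; case: ltP => bi.
  rewrite max_l ?subr_ge0 ?(ltW bi)//; congr (_ - _).
  rewrite /osc /incr /= -/(F (r i)) -/(F (l i)).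
  have [h|h] := ltP (F (r i)) (F (l i)).
    by rewrite ltr0_norm ?subr_lt0//= expr1 mulN1r.
  by rewrite ger0_norm ?subr_ge0//= expr0 mul1r.
by rewrite max_r// subr_le0.
Qed.

Lemma grid_step_cvg0 : S / (M * 2 ^ N)%:R @[N --> \oo] --> 0.
Proof.
have h : (2^-1 : R) ^+ N @[N --> \oo] --> 0 by apply: cvg_expr; rewrite ger0_norm; lra.
rewrite -[X in _ --> X](mulr0 (S / M%:R)).
have -> : (fun N => S / (M * 2 ^ N)%:R) = (fun N => S / M%:R * (2^-1) ^+ N).
  by apply/funext => N; rewrite natrM natrX invfM exprVn mulrA.
by apply: cvgM; [exact: cvg_cst|].
Qed.

Lemma grid_floor_cvg (t : R) : {within `[0, +oo[, continuous f} -> 0 <= t ->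
  f (grid_floor N t) @[N --> \oo] --> f t.
Proof.
move=> /continuous_within_itvcyP[cf _] t0.
(* Continuity at 0 is only one-sided, but 0 is rounded to itself. *)
have [->|tn0] := eqVneq t 0.
  have -> : (fun N => f (grid_floor N 0)) = (fun=> f 0).
    by apply/funext => N; rewrite /grid_floor /grid_index !mul0r truncn0 grid0.
  exact: cvg_cst.
have t1 : 0 < t by rewrite lt_neqAle eq_sym tn0.
have ct : f x @[x --> t] --> f t by apply: cf; rewrite in_itv/= t1.
apply: (cvg_comp _ _ _ ct).
apply/cvgrPdist_le => e e0; have /cvgrPdist_le/(_ e e0) := grid_step_cvg0.
apply: filterS => N; rewrite sub0r normrN ger0_norm ?divr_ge0 ?ler0n ?(ltW S0)//.
exact: le_trans (grid_floor_dist N t0).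
Qed.

(** The truncated variation bounds the gain on every grid, and any family of intervals is
    approximated by its rounding. Stating the lower bound for reals [y] below [V] treats finite and
    infinite values alike. *)
Lemma maxgain_cvg : {within `[0, +oo[, continuous f} ->
  (Fn N (M * 2 ^ N))%:E @[N --> \oo] --> truncated_variation c f 0 S.
Proof.
move=> cf; set V := truncated_variation c f 0 S.
have lower y : (y%:E < V)%E -> \forall N \near \oo, y < Fn N (M * 2 ^ N).
  move=> /ereal_sup_gt[_ [n [l [r [l0 lr rl rS ->]]]]]; rewrite lte_fin => yx.
  have rl0 i : (i <= n)%N -> 0 <= l i.
    elim: i => // i IH ni; apply: (le_trans (IH (ltnW ni))).
    by apply: (le_trans _ (rl _ ni)); exact/ltW/lr/ltnW.
  have cv : \sum_(i < n.+1) Num.max (`|f (grid_floor N (r i)) - f (grid_floor N (l i))| - c) 0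
      @[N --> \oo] --> \sum_(i < n.+1) Num.max (`|f (r i) - f (l i)| - c) 0.
    apply: cvg_big => [|i _]; first exact: add_continuous.
    have ni : (i <= n)%N by rewrite -ltnS.
    have cvl := grid_floor_cvg cf (rl0 _ ni).
    have cvr := grid_floor_cvg cf (le_trans (rl0 _ ni) (ltW (lr _ ni))).
    have step : `|f (grid_floor N (r i)) - f (grid_floor N (l i))| - c @[N --> \oo] -->
        `|f (r i) - f (l i)| - c.
      by apply: cvgB; [apply: cvg_norm; exact: cvgB|exact: cvg_cst].
    have cm : {for `|f (r i) - f (l i)| - c, continuous (fun x : R => Num.max x 0)}.
      exact: (continuous_max cvg_id (cvg_cst _)).
    exact: (cvg_comp _ _ step cm).
  have : \forall N \near \oo, y < \sum_(i < n.+1)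
      Num.max (`|f (grid_floor N (r i)) - f (grid_floor N (l i))| - c) 0.
    exact: cvgr_gt cv _ yx.
  by apply: filterS => N h; apply: (lt_le_trans h); exact: sum_floor_le_maxgain.
have upper N : ((Fn N (M * 2 ^ N))%:E <= V)%E by exact: maxgain_le_truncated_variation.
have V0 : (0 <= V)%E by apply: (le_trans _ (upper 0%N)); rewrite lee_fin maxgain_ge0.
move: V0 lower upper; case: V => [v| |]//= _ lower upper.
  apply/cvg_EFin; [exact: nearW|]; apply/cvgrPdist_lt => e e0.
  have := lower (v - e); rewrite lte_fin gtrBl => /(_ e0); apply: filterS => N h /=.
  have := upper N; rewrite lee_fin => h2.
  by rewrite ger0_norm ?subr_ge0//; lra.
apply/cvgeyPgt => A; have := lower A; rewrite ltry => /(_ isT).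
by apply: filterS => N h; rewrite lte_fin.
Qed.

End GridApproximation.

(** * Passage to the limit in the deviation probability *)

Section DeviationLimit.
Import HBNNSimple.
Context (d : measure_display) (T : measurableType d) (R : realType).
Context (P : probability T R) (F : nat -> T -> R) (V : T -> \bar R) (m : R).
Hypothesis iF : forall N, integ P (F N).
Hypothesis F0 : forall N w, 0 <= F N w.
Hypothesis FV : forall N w, ((F N w)%:E <= V w)%E.
Hypothesis cvgF : {ae P, forall w, (F N w)%:E @[N --> \oo] --> V w}.
Hypothesis Fm : forall N, Ex P (F N) <= m.

Local Open Scope ereal_scope.

Let V0 w : 0 <= V w.
Proof. by apply: (le_trans _ (FV 0%N w)); rewrite lee_fin. Qed.

Let mF N : measurable_fun setT (fun w => (F N w)%:E).
Proof. by apply/measurable_EFinP; exact: integ_meas (iF N). Qed.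

(* [V] need not be measurable: its integral is the supremum of the integrals of
   the simple functions below it. *)
Lemma cvg_Ex_integral : (Ex P (F N))%:E @[N --> \oo] --> \int[P]_w V w.
Proof.
pose u w N := (F N w)%:E.
(* A measurable substitute for [V]: a lower limit is measurable, and it equals [V] wherever the
   convergence holds. *)
pose g w := limn_einf (u w).
have mg : measurable_fun setT g.
  rewrite (_ : g = fun w => - limn_esup (-%E \o u w)); last first.
    by apply/funext => w; rewrite limn_esupN oppeK.
  apply: measurableT_comp => //.
  apply: (measurable_fun_limn_esup (f := fun N w => - (F N w)%:E)) => N.
  exact: measurableT_comp.
have gV : {ae P, forall w, g w = V w}.
  by apply: filterS cvgF => w /cvg_limn_einf_sup[].
have g0 w : 0 <= g w.
  rewrite /g limn_einf_lim; apply: lime_ge; first exact: is_cvg_einfs.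
  by apply: nearW => n; apply: le_ereal_inf_tmp => _ [k _ <-]; rewrite lee_fin.
have Vg : \int[P]_w V w <= \int[P]_w g w.
  rewrite ge0_integralTE//; apply: ge_ereal_sup => _ [h /= hV <-].
  rewrite -(integralT_nnsfun P h).
  apply: ae_ge0_le_integral => //; first by move=> w _; rewrite lee_fin fun_ge0.
    by apply/measurable_EFinP.
  by apply: filterS gV => w + _; move=> ->.
have FleV N : (Ex P (F N))%:E <= \int[P]_w V w.
  rewrite EFin_Ex// !ge0_integralTE//; last by move=> w; rewrite lee_fin.
  apply: ge_ereal_sup => _ [h /= hF <-]; apply: ereal_sup_ubound; exists h => // w.
  exact: le_trans (hF w) (FV N w).
pose e N := (Ex P (F N))%:E.
have ge : \int[P]_w g w <= limn_einf e.
  rewrite (_ : e = (fun N => \int[P]_w (F N w)%:E)); last first.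
    by apply/funext => N; rewrite /e EFin_Ex.
  by apply: fatou => // N w _; rewrite lee_fin.
have einfs_le n : einfs e n <= e n.
  by apply: ereal_inf_lbound; exists n => /=.
(* By Fatou's lemma the tail infima of the means tend to at least the integral of [V], which is also
   an upper bound of all the means; the latter are squeezed in between. *)
have ce : einfs e @ \oo --> \int[P]_w V w.
  rewrite [X in _ --> X](_ : _ = limn (einfs e)); first exact: is_cvg_einfs.
  apply/eqP; rewrite eq_le -limn_einf_lim (le_trans Vg)//= limn_einf_lim.
  apply: lime_le; first exact: is_cvg_einfs.
  by apply: nearW => n; exact: le_trans (einfs_le n) (FleV n).
apply: (squeeze_cvge _ ce (cvg_cst _)).
by apply: nearW => n; rewrite einfs_le FleV.
Qed.

(** The inequality is strict, so wherever convergence holds a deviation of the limit is shared by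
    all sufficiently fine grids. The event thus lies in the union of a null set and the lower limit
    of the events [A k], whose probability is at most [b] by continuity from below. *)
Lemma deviation_le (x : R) (b : \bar R) :
  (forall N, P [set w | (x < `|F N w - Ex P (F N)|)%R] <= b) ->
  mu_ext P [set w | x%:E < `|V w - \int[P]_w V w|] <= b.
Proof.
move=> Pb; set I := \int[P]_w V w.
pose A N := [set w | (x < `|F N w - Ex P (F N)|)%R].
have mA N : measurable (A N).
  apply: measurable_lt_set => //; apply: measurableT_comp => //.
  by apply: measurable_funB => //; exact: integ_meas.
(* The common bound [m] on the means is needed here: subtracting the limit mean is meaningful only
   if it is finite. *)
have I_fin : I \is a fin_num.
  rewrite ge0_fin_numE; last exact: integral_ge0.
  apply: (@le_lt_trans _ _ m%:E); last exact: ltry.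
  have ce := cvg_Ex_integral.
  rewrite /I -(cvg_lim _ ce)//; apply: lime_le; first by apply/cvg_ex; exists I.
  by apply: nearW => N; rewrite lee_fin.
have [N0 [mN0 PN0 sub]] := cvgF.
pose B n := \bigcap_(k in [set k | (n <= k)%N]) A k.
have mB n : measurable (B n) by apply: bigcap_measurable => [|k _]; [exists n => /=|exact: mA].
have mU : measurable (\bigcup_n B n) by apply: bigcup_measurable => n _; exact: mB.
have PU : P (\bigcup_n B n) <= b.
  have ndB : nondecreasing_seq B.
    by move=> i j ij; apply/subsetPset => w Bi k /= jk; apply: Bi; exact: leq_trans jk.
  have cB := nondecreasing_cvg_mu (mu := P) mB mU ndB.
  rewrite -(cvg_lim _ cB)//; apply: lime_le; first by apply/cvg_ex; exists (P (\bigcup_n B n)).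
  apply: nearW => n; apply: (le_trans _ (Pb n)); apply: le_measure; rewrite ?inE//.
    exact: mA.
  by move=> w Bw; apply: (Bw n) => /=.
apply: (@le_trans _ _ (P (N0 `|` \bigcup_n B n))).
  rewrite -measurable_mu_extE; last exact: measurableU.
  apply: le_mu_ext => w /= dev; case: (pselect (N0 w)) => [|nN0]; [by left|right].
  have cw : (F N w)%:E @[N --> \oo] --> V w.
    by apply: contrapT => h; apply: nN0; apply: sub.
  have cd : `|(F N w)%:E - (Ex P (F N))%:E| @[N --> \oo] --> `|V w - I|.
    apply: cvg_abse; apply: cvgeB cw cvg_Ex_integral.
    by rewrite fin_num_adde_defl// fin_numN.
  have [n _ hn] : \forall N \near \oo, x%:E < `|(F N w)%:E - (Ex P (F N))%:E|.
    exact: (cd _ (open_ereal_gt' dev)).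
  by exists n => // k /= nk; have := hn _ nk; rewrite -EFinB lte_fin.
by rewrite setUC measureU0.
Qed.

End DeviationLimit.

(** * Return to the parameters of the statement *)

Section ScaledDeviation.
Context (d : measure_display) (T : measurableType d) (R : realType).
Context (P : probability T R) (H : R) (W : R -> T -> R).
Hypothesis H0 : 0 < H.
Hypothesis H12 : H < 2^-1.
Hypothesis fbm : fractional_brownian_motion P H W.
Context (S c : R).
Hypothesis S0 : 0 < S.
Hypothesis c0 : 0 < c.
Hypothesis cS : c <= S `^ H.

(** [c ^ (1 / H)] is the time over which an increment has standard deviation [c]; [n] counts such
    times in [0, S] and is at least 1 because [c <= S ^ H]. *)
Let n := S * c `^ (- H^-1).

Let H01 : 0 < 2 * H < 1.
Proof. by rewrite mulr_gt0//= mulrC -ltr_pdivlMr// mul1r. Qed.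

Let nE : n = S / c `^ H^-1. Proof. by rewrite /n powRN. Qed.

Let a0 : 0 < c `^ H^-1. Proof. exact: powR_gt0. Qed.

Let n1 : 1 <= n.
Proof.
rewrite nE ler_pdivlMr// mul1r.
have -> : S = (S `^ H) `^ H^-1 by rewrite -powRrM mulfV ?gt_eqF// powRr1 ?ltW.
by apply: ge0_ler_powR; rewrite ?nnegrE ?invr_ge0 ?powR_ge0 ?(ltW H0) ?(ltW c0).
Qed.

Let n0 : 0 < n. Proof. exact: lt_le_trans n1. Qed.

Lemma threshold_scale : S * c `^ (1 - H^-1) = n * c.
Proof. by rewrite powRD ?(gt_eqF c0) ?implybT// powRr1 ?(ltW c0)// /n; ring. Qed.

Lemma deviation_profile v : 0 < v ->
  (deviation_probability P W c S (n * c * v) <=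
    (36 * expR (- (deviation_rate H * n * rate_profile H v)))%:E)%E.
Proof.
(* An integer above [n] makes the increments over [S / M] of size at most [c]; [n >= 1] keeps it
   below [2 * n]. *)
move=> v0; pose M := (Num.truncn n).+1.
have M0 : (0 < M)%N by [].
have nM : n <= M%:R by rewrite ltW// truncnS_gt.
have M2 : M%:R <= 2 * n.
  have : (Num.truncn n)%:R <= n by rewrite truncn_le ltW.
  by rewrite /M -natr1 => h; have := n1; lra.
have MR : 0 < (M%:R : R) by rewrite ltr0n.
have Sc : (S / M%:R) `^ H <= c.
  have cE : (c `^ H^-1) `^ H = c by rewrite -powRrM mulVf ?gt_eqF// powRr1 ?ltW.
  rewrite -[leRHS]cE; apply: ge0_ler_powR; rewrite ?nnegrE ?divr_ge0 ?powR_ge0 ?(ltW H0) ?(ltW S0)//.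
  by rewrite ler_pdivrMr// mulrC -ler_pdivrMr// -nE.
rewrite /deviation_probability /mean_TV /TV.
apply: (@deviation_le _ _ _ _ (fun N => grid_gain W M S N c (M * 2 ^ N)) _ (M%:R * c * chain_const H)).
- by move=> N; exact: (integ_grid_gain fbm M0 S0).
- by move=> N w; exact: maxgain_ge0.
- by move=> N w; exact: (maxgain_le_truncated_variation c (W ^~ w) M0 S0).
- apply: filterS (fbm_continuous fbm) => w cw.
  exact: (maxgain_cvg M0 S0 (ltW c0) cw).
- move=> N; apply: (Ex_grid_gain_le H0 H01 fbm M0 S0 c0 Sc).
  by rewrite ler_pdivrMr// ler_peMr ?(ltW c0)// ler1n.
- by move=> N; exact: grid_deviation.
Qed.

(** This is the equivalence of the two forms of the exponent. The minimum is [n * c * min 1 v], so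
    the powers of [n * c] combine to its square, and those of [v] to exponent 2 or [1 + 2 * H]
    according to whether [v <= 1]. *)
Lemma rate_profileE v : 0 < v ->
  n^-1 * c ^- 2 * (n * c * v) `^ (1 + 2 * H) * Num.min (n * c) (n * c * v) `^ (1 - 2 * H) =
  n * rate_profile H v.
Proof.
move=> v0; have nc0 : 0 < n * c by exact: mulr_gt0.
have /andP[H2 H21] := H01.
have e1 : 0 < 1 - 2 * H by rewrite subr_gt0.
have nc2 : (n * c) `^ (1 + 2 * H) * (n * c) `^ (1 - 2 * H) = (n * c) ^+ 2.
  rewrite -powRD ?(gt_eqF nc0) ?implybT// -powR_mulrn ?(ltW nc0)//.
  by congr powR; ring.
have v2 : v `^ (1 + 2 * H) * v `^ (1 - 2 * H) = v ^+ 2.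
  rewrite -powRD ?(gt_eqF v0) ?implybT// -powR_mulrn ?(ltW v0)//.
  by congr powR; ring.
have p1 : 0 <= v `^ (1 + 2 * H) by exact: powR_ge0.
rewrite (powRM _ (ltW nc0) (ltW v0)).
have [v1|v1] := leP v 1.
  have -> : rate_profile H v = v ^+ 2.
    rewrite /rate_profile min_r// -v2 ler_piMr//.
    rewrite -[leRHS](_ : 1 `^ (1 - 2 * H) = 1); last by rewrite powR1.
    by apply: (ge0_ler_powR (ltW e1)); rewrite ?nnegrE ?ler01 ?(ltW v0).
  rewrite min_r; last by rewrite ler_piMr// ltW.
  rewrite (powRM _ (ltW nc0) (ltW v0)).
  rewrite -[RHS](_ : n^-1 * c ^- 2 * (n * c) ^+ 2 * v ^+ 2 = _); last first.
    by field; rewrite !gt_eqF.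
  by rewrite -nc2 -v2; ring.
have -> : rate_profile H v = v `^ (1 + 2 * H).
  rewrite /rate_profile min_l// -v2 ler_peMr//.
  rewrite -[leLHS](powRr0 v).
  by apply: ler_powR; rewrite ?(ltW v1) ?(ltW e1).
rewrite min_l; last by rewrite ler_peMr// ltW.
rewrite -[RHS](_ : n^-1 * c ^- 2 * (n * c) ^+ 2 * v `^ (1 + 2 * H) = _); last first.
  by field; rewrite !gt_eqF.
by rewrite -nc2; ring.
Qed.

Lemma scaled_deviation u : 0 < u ->
  (deviation_probability P W c S u <=
    (36 * expR (- (deviation_rate H * S^-1 * c `^ (H^-1 - 2) * u `^ (1 + 2 * H) *
      Num.min (S * c `^ (1 - H^-1)) u `^ (1 - 2 * H))))%:E)%E.
Proof.
move=> u0; have nc0 : 0 < n * c by exact: mulr_gt0.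
have v0 : 0 < u / (n * c) by exact: divr_gt0.
have uE : u = n * c * (u / (n * c)) by rewrite mulrC divfK// gt_eqF.
have := deviation_profile v0; rewrite -(mulrA (deviation_rate H)) -(rate_profileE v0) -uE -threshold_scale.
congr (_ <= (_ * expR (- _))%:E)%E.
have -> : n^-1 * c ^- 2 = S^-1 * c `^ (H^-1 - 2).
  rewrite powRD ?(gt_eqF c0) ?implybT// powRN powR_mulrn ?(ltW c0)// nE invfM invrK.
  by rewrite mulrA.
by rewrite !mulrA.
Qed.

End ScaledDeviation.

Theorem theorem2p1 (R : realType) (H : R) (H_gt0 : 0 < H) (H_lt_half : H < 2^-1) :
  exists A B : R, [/\ 0 < A, A <= 36, 0 < B &
    forall (d : measure_display) (T : measurableType d) (P : probability T R)
      (W : R -> T -> R), fractional_brownian_motion P H W ->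
    forall S c : R, 0 < S -> 0 < c -> c <= S `^ H ->
      (forall u : R, 0 < u ->
        (deviation_probability P W c S u <=
          (A * expR (- (B * S^-1 * c `^ (H^-1 - 2) * u `^ (1 + 2 * H) *
             Num.min (S * c `^ (1 - H^-1)) u `^ (1 - 2 * H))))%:E)%E) /\
      (forall v : R, 0 < v ->
        (deviation_probability P W c S (S * c `^ (1 - H^-1) * v) <=
          (A * expR (- (B * S * c `^ (- H^-1) *
             Num.min (v `^ (1 + 2 * H)) (v ^+ 2))))%:E)%E)].
Proof.
exists 36, (deviation_rate H); split => //; first exact: deviation_rate_gt0.
move=> d T P W fbm S c S0 c0 cS; split => [u u0|v v0].
  exact: scaled_deviation.
rewrite threshold_scale// -(mulrA _ S).
exact: deviation_profile.
Qed.
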